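(* Let $n\ge 1$, let $\Delta_n=\{(x_0,\ldots,x_n)\in\mathbb{R}^{n+1}: x_i\ge 0,\ \sum_i x_i=1\}$ be the standard $n$-simplex, equipped with the $n$-form $\omega=dx_1\wedge\cdots\wedge dx_n$. Let $f\in\mathbb{Q}[x_0,\ldots,x_n]$ be a polynomial with rational coefficients which is non-negative on $\Delta_n$, and let $I(s)=\int_{\Delta_n} f^s\,\omega$, viewed as a meromorphic function of $s\in\mathbb{C}$. Let $s_0\in\mathbb{Z}$ and let $I(s)=\sum_{i\ge N}a_i(s-s_0)^i$ be the Laurent series expansion of $I$ at $s_0$. Then every coefficient $a_i$ is a period.
   Context: A subset $C\subset\mathbb{R}^n$ is semi-arithmetic if it is a finite union of finite intersections of sets of the form $\{x: g(x)>0\}$ or $\{x: g(x)=0\}$ with $g\in\mathbb{R}_{\mathrm{alg}}[x_1,\ldots,x_n]$, where $\mathbb{R}_{\mathrm{alg}}=\mathbb{R}\cap\overline{\mathbb{Q}}$. A complex number is a period (in the sense of Kontsevich–Zagier) if its real and imaginary parts are given by absolutely convergent integrals $\int_C g\,d\mu$ with $C\subset\mathbb{R}^n$ semi-arithmetic, $g\in\mathbb{R}_{\mathrm{alg}}(x_1,\ldots,x_n)$ a rational function, and $\mu$ Lebesgue measure; the periods form a $\mathbb{Q}$-algebra. The function $I(s)$, defined by the integral for $\mathrm{Re}(s)>0$, extends meromorphically to all of $\mathbb{C}$ (Atiyah, Bernstein–Gelfand); $I(s)$ denotes this extension. *)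

(* Defs.v *)
From HB Require Import structures.
From mathcomp Require Import all_boot all_order all_algebra.
From mathcomp Require Import complex.
(* The notations of mpoly and of MathComp-Analysis are incompatible: here
   [mpoly n R] is the ring of polynomials in n variables over R, and
   [meval v p] is the value of p at v. *)
From mathcomp Require Import -(notations) mpoly.
From mathcomp Require Import all_classical all_reals all_analysis.

Set Implicit Arguments.
Unset Strict Implicit.
Unset Printing Implicit Defensive.

Import Order.TTheory GRing.Theory Num.Theory.
Import numFieldNormedType.Exports.

Local Open Scope classical_set_scope.
Local Open Scope ring_scope.

(* [measurableTypeR R] is R with its Borel sigma-algebra, on which
   [lebesgue_measure] is defined. *)
Definition euclid (R : realType) (n : nat) := n.-tuple (measurableTypeR R).

HB.instance Definition _ (R : realType) (n : nat) :=
  Measurable.on (euclid R n).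

Section Lebesgue.
Variable R : realType.

Definition euclid_cons (n : nat) (p : measurableTypeR R * euclid R n) :
  euclid R n.+1 := [tuple of p.1 :: p.2].

Lemma measurable_euclid_cons n : measurable_fun [set: _] (@euclid_cons n).
Proof. exact: measurable_cons. Qed.

Section Step.
Variables (n : nat) (mu : {sigma_finite_measure set (euclid R n) -> \bar R}).

Definition lebesgue_step : set (euclid R n.+1) -> \bar R :=
  pushforward (@lebesgue_measure R \x mu)%E (@euclid_cons n).

Let measurable_preimage_cons (A : set (euclid R n.+1)) :
  measurable A -> measurable (@euclid_cons n @^-1` A).
Proof.
by move=> mA; rewrite -[X in measurable X]setTI; exact: measurable_euclid_cons.
Qed.

Let lebesgue_step0 : lebesgue_step set0 = 0%E.
Proof. by rewrite /lebesgue_step /pushforward preimage_set0 measure0. Qed.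

Let lebesgue_step_ge0 A : (0 <= lebesgue_step A)%E.
Proof. exact: (@measure_ge0 _ _ _ (@lebesgue_measure R \x mu)%E). Qed.

Let lebesgue_step_sigma_additive : semi_sigma_additive lebesgue_step.
Proof.
move=> F mF tF mUF; rewrite /lebesgue_step /pushforward preimage_bigcup.
apply: measure_semi_sigma_additive.
- by move=> k; exact: measurable_preimage_cons.
- apply/trivIsetP => /= i j _ _ ij; rewrite -preimage_setI.
  by move/trivIsetP : tF => /(_ _ _ _ _ ij) ->//; rewrite preimage_set0.
- by rewrite -preimage_bigcup; exact: measurable_preimage_cons.
Qed.

HB.instance Definition _ := isMeasure.Build _ _ _ lebesgue_step
  lebesgue_step0 lebesgue_step_ge0 lebesgue_step_sigma_additive.

Let lebesgue_step_sigma_finite : sigma_finite [set: euclid R n.+1] lebesgue_step.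
Proof.
have /sigma_finiteP[F [UF ndF mF]] := sigma_finiteT (@lebesgue_measure R).
have /sigma_finiteP[G [UG ndG mG]] := sigma_finiteT mu.
pose uncons (x : euclid R n.+1) : measurableTypeR R * euclid R n :=
  (tnth x ord0, [tuple of behead x]).
have consK : uncons \o @euclid_cons n = id.
  by apply/funext => -[x t]; congr (_, _); exact/val_inj.
have munc : measurable_fun [set: euclid R n.+1] uncons.
  apply/measurable_fun_pair; first exact: measurable_tnth.
  exact: measurable_behead.
exists (fun k => uncons @^-1` (F k `*` G k)).
  apply/esym/seteqP; split=> // x _.
  have [i _ Fi] : (\bigcup_k F k) (uncons x).1 by rewrite -UF.
  have [j _ Gj] : (\bigcup_k G k) (uncons x).2 by rewrite -UG.
  exists (maxn i j) => //; split.
    by move: Fi; exact/subsetPset/ndF/leq_maxl.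
  by move: Gj; exact/subsetPset/ndG/leq_maxr.
move=> k; have [mFk Fk] := mF k; have [mGk Gk] := mG k; split.
  rewrite -[X in measurable X]setTI; apply: munc => //; exact: measurableX.
rewrite /lebesgue_step /pushforward -comp_preimage consK preimage_id.
by rewrite product_measure1E// lte_mul_pinfty// ge0_fin_numE.
Qed.

HB.instance Definition _ := Measure_isSigmaFinite.Build _ _ _ lebesgue_step
  lebesgue_step_sigma_finite.

End Step.

(* On R^0, a single point, it is the unit mass; on R^(n+1) it is the product of
   the Lebesgue measures of R and R^n. *)
Fixpoint lebesgue (n : nat) : {sigma_finite_measure set (euclid R n) -> \bar R} :=
  match n with
  | 0 => dirac ([tuple] : euclid R 0)
  | m.+1 => lebesgue_step (lebesgue m)
  end.

End Lebesgue.

Section Periods.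
Variable R : realType.

Definition Ralg : {pred R} := [pred x | `[< algebraicOver ratr x >]].

Definition semi_arithmetic_basic n (A : set (euclid R n)) : Prop :=
  exists2 g : mpoly n R, g \is a mpolyOver n Ralg &
    A = [set x : euclid R n | 0 < meval (tnth x) g] \/
    A = [set x : euclid R n | meval (tnth x) g = 0].

Definition semi_arithmetic n (C : set (euclid R n)) : Prop :=
  exists2 F : seq (seq (set (euclid R n))),
    (forall s, s \in F -> forall A, A \in s -> semi_arithmetic_basic A) &
    C = \big[setU/set0]_(s <- F) \big[setI/setT]_(A <- s) A.

(* The rational function is p / q. The zeros of q form a null set, so its values
   there do not matter. *)
Definition real_period (x : R) : Prop :=
  exists n (C : set (euclid R n)) (p q : mpoly n R),
    let g (y : euclid R n) := meval (tnth y) p / meval (tnth y) q in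
    [/\ semi_arithmetic C,
        p \is a mpolyOver n Ralg,
        q \is a mpolyOver n Ralg /\ q != 0,
        (lebesgue R n).-integrable C (EFin \o g) &
        x = \int[lebesgue R n]_(y in C) g y].

Definition period (z : R[i]) : Prop :=
  real_period (complex.Re z) /\ real_period (complex.Im z).

End Periods.

Section Zeta.
Variable R : realType.

Definition simplex n : set (euclid R n.+1) :=
  [set x : euclid R n.+1 | (forall i, 0 <= tnth x i) /\
    \sum_(i < n.+1) tnth x i = 1].

(* The coordinates (x_1, ..., x_n) on the simplex, in which the form
   dx_1 /\ ... /\ dx_n is the Lebesgue measure of R^n. *)
Definition simplex_chart n (y : euclid R n) : euclid R n.+1 :=
  [tuple of 1 - \sum_(i < n) tnth y i :: y].

(* x^s = exp (s log x) if x > 0, and 0^s = 0 if 0 < Re s. *)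
Definition cpow (x : R) (s : R[i]) : R[i] :=
  (x `^ complex.Re s * cos (complex.Im s * ln x) +i*
   (x `^ complex.Re s * sin (complex.Im s * ln x)))%C.

Definition simplex_zeta n (f : mpoly n.+1 rat) (s : R[i]) : R[i] :=
  let D := @simplex_chart n @^-1` @simplex n in
  let fs y := cpow (meval (tnth (simplex_chart y)) (map_mpoly ratr f)) s in
  ((\int[lebesgue R n]_(y in D) complex.Re (fs y)) +i*
   (\int[lebesgue R n]_(y in D) complex.Im (fs y)))%C.

End Zeta.

Section Meromorphic.
Variable K : numClosedFieldType.

Definition holomorphic_at (g : K -> K) (c : K) : Prop :=
  \forall z \near c, derivable g z 1.

(* The values of J at its poles are irrelevant. *)
Definition meromorphic (J : K -> K) : Prop :=
  forall c, exists (m : nat) (g : K -> K),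
    holomorphic_at g c /\ \forall z \near c^', J z = g z / (z - c) ^+ m.

(* J z = \sum_(i >= N) a i * (z - c) ^ i in a punctured neighbourhood of c. *)
Definition laurent_expansion (J : K -> K) (c : K) (N : int) (a : int -> K) : Prop :=
  \forall z \near c^',
    series (fun k : nat => a (N + k%:Z) * (z - c) ^ (N + k%:Z)) @ \oo --> J z.

End Meromorphic.

(* Main.v *)
Require Import Defs.
From HB Require Import structures.
From mathcomp Require Import all_boot all_order all_algebra.
From mathcomp Require Import complex.
From mathcomp Require Import -(notations) mpoly.
From mathcomp Require Import all_classical all_reals all_analysis.
From mathcomp Require Import measurable_realfun.
From mathcomp Require Import ring lra zify.

Set Implicit Arguments.
Unset Strict Implicit.
Unset Printing Implicit Defensive.

Import Order.TTheory GRing.Theory Num.Theory.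
Import numFieldNormedType.Exports.

Local Open Scope classical_set_scope.
Local Open Scope ring_scope.

(* Write I(s) for the zeta integral. On the real axis I satisfies a linear
   recurrence sum_j p_j(s) I(s + j) = 0 with polynomial coefficients over Q, not
   all zero: after a polynomial substitution the simplex becomes the cube and the
   integrand acquires the weight prod (t_i (1 - t_i))^2; applying words in the
   operators D_i = d_i o t_i (1 - t_i) to W F^j F^s produces more expressions than
   there are monomials of the corresponding degree, so they are linearly dependent
   over Q, and pairing a dependence with products of the weights times powers of
   log (t_i / (1 - t_i)), on which D_i acts nilpotently, leaves a relation between
   the values I(s + j). The recurrence extends to the meromorphic function J and
   expresses the Laurent coefficients at s0 through those at s0 + 1, s0 + 2, ...;
   so they all lie in the Q-span of the Taylor coefficients of I at the integers
   l >= 1, which are the integrals of F^l (log F)^k / k!. The latter are periods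
   because log F = int_0^1 (F - 1) / (1 + (F - 1) t) dt. *)

(** * Derivatives in a numeric field *)

(** A relation exists by counting. With S the shift of the exponent and e, j and all beta_i below B,
    there are B^(n+2) operators s^e S^j D^beta. After multiplication by powers of F, their values
    become polynomials in s and t_1, ..., t_n of degree O(B), a space of dimension O(B^(n+1)). In a
    nonzero relation a word of minimal length dictates the exponents of the logarithms in the test
    function: the other words of the relation pair to zero with it, and no D remains. The squared
    weights are there to kill every boundary term on the faces of the cube. The polynomial p_0 may
    vanish at s0. The descent therefore handles whole germs rather than values: solving for the germ
    at s0 divides by the first nonzero coefficient of p_0 at s0, a rational number. Meromorphy is
    given through complex differentiability, so power series must be won by Goursat and Cauchy, here
    on squares. After that only real arguments occur, where the integrand is a real power. Finally a
    period is one integral, so a rational combination must become one integrand on one domain: each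
    power of the logarithm gets the same number of auxiliary variables. *)

Section FieldContinuity.
Variable F : numFieldType.
Implicit Types (f g : F -> F) (z : F).

Lemma fcont_cst (k z : F) : {for z, continuous (fun=> k : F)}.
Proof. exact: cst_continuous. Qed.

Lemma fcont_id z : {for z, continuous (fun x : F => x)}.
Proof. exact: cvg_id. Qed.

Lemma fcontD f g z : {for z, continuous f} -> {for z, continuous g} ->
  {for z, continuous (fun x => f x + g x)}.
Proof. by move=> h1 h2; exact: continuousD. Qed.

Lemma fcontB f g z : {for z, continuous f} -> {for z, continuous g} ->
  {for z, continuous (fun x => f x - g x)}.
Proof. by move=> h1 h2; exact: continuousB. Qed.

Lemma fcontM f g z : {for z, continuous f} -> {for z, continuous g} ->
  {for z, continuous (fun x => f x * g x)}.
Proof. by move=> h1 h2; exact: continuousM. Qed.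

Lemma fcontV f z : f z != 0 -> {for z, continuous f} ->
  {for z, continuous (fun x => (f x)^-1)}.
Proof. by move=> f0 h1; exact: continuousV. Qed.

Lemma fcont_near f z :
  (forall e, 0 < e -> \forall x \near z, `|f z - f x| < e) -> {for z, continuous f}.
Proof.
move=> H A /nbhs_normP[e e0 He]; have /nbhs_normP[e' e'0 He'] := H e e0.
by apply/nbhs_normP; exists e' => // x hx; apply: He; exact: He'.
Qed.

Lemma fderivB f g z : derivable f z 1 -> derivable g z 1 ->
  derivable (fun x => f x - g x) z 1.
Proof. exact: derivableB. Qed.

Lemma fderivM f g z : derivable f z 1 -> derivable g z 1 ->
  derivable (fun x => f x * g x) z 1.
Proof. exact: derivableM. Qed.

Lemma fderivV f z : f z != 0 -> derivable f z 1 ->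
  derivable (fun x => (f x)^-1) z 1.
Proof. by move=> f0; apply: derivableV. Qed.

Lemma fderiv_cst (k z : F) : derivable (fun=> k : F) z 1.
Proof. exact: derivable_cst. Qed.

Lemma fderiv_id z : derivable (fun x : F => x) z 1.
Proof. exact: derivable_id. Qed.

Lemma fderiv_cont f z : derivable f z 1 -> {for z, continuous f}.
Proof. by move=> /derivable1_diffP/differentiable_continuous. Qed.

Lemma near_eq_derivable f g z : (\forall x \near z, f x = g x) ->
  derivable f z 1 -> derivable g z 1.
Proof.
move=> fg; by apply: near_eq_derivable.
Qed.

Lemma near_eq_continuous f g z : (\forall x \near z, f x = g x) ->
  {for z, continuous f} -> {for z, continuous g}.
Proof.
move=> fg fz; rewrite /prop_for /continuous_at -(nbhs_singleton fg).
exact: (cvg_trans (near_eq_cvg fg) fz).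
Qed.

End FieldContinuity.

(** * Neighbourhoods, limits and derivatives through the norm *)

Section Gen.
Variable K : numFieldType.
Lemma near_normP (P : K -> Prop) (c : K) :
  (\forall z \near c, P z) <-> exists2 e : K, 0 < e & forall z, `|z - c| < e -> P z.
Proof.
split.
  move=> /nbhs_normP[e e0 He]; exists e => // z h; apply: He.
  by rewrite /= distrC.
move=> [e e0 He]; apply/nbhs_normP; exists e => // z /= h; apply: He.
by rewrite distrC.
Qed.

Lemma dnear_normP (P : K -> Prop) (c : K) :
  (\forall z \near c^', P z) <->
  exists2 e : K, 0 < e & forall z, z != c -> `|z - c| < e -> P z.
Proof.
split.
  move=> /near_normP[e e0 He]; exists e => // z zc h; exact: He.
move=> [e e0 He]; apply/near_normP; exists e => // z h zc; exact: He.
Qed.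

Lemma is_derive_normP (f : K -> K) (z d : K) : is_derive z 1 f d ->
  forall e, 0 < e -> exists2 dl, 0 < dl &
   forall h, `|h| < dl -> `|f (z + h) - f z - d * h| <= e * `|h|.
Proof.
move=> [fd fE] e e0.
have /cvgrPdist_lt/(_ e e0) : h^-1 *: ((f \o shift z) (h *: 1) - f z) @[h --> 0^'] --> d.
  by rewrite -fE; exact: fd.
move=> /dnear_normP[dl dl0 H]; exists dl => // h hd.
have [->|h0] := eqVneq h 0.
  by rewrite addr0 subrr mulr0 subrr normr0 mulr0.
have := H h h0; rewrite subr0 => /(_ hd).
rewrite /= distrC [_ *: _]mulrC [h *: _]mulr1 (addrC h).
rewrite -(ltr_pM2r (_ : 0 < `|h|)) ?normr_gt0// -normrM mulrBl mulfVK//.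
by move/ltW.
Qed.

Lemma cvgn_normP (u : nat -> K) (l : K) : (u @ \oo --> l) <->
  forall e, 0 < e -> exists N, forall n, (N <= n)%N -> `|u n - l| < e.
Proof.
split.
  move=> /cvgrPdist_lt H e /H[N _ hN]; exists N => n Nn; rewrite distrC; exact: hN.
move=> H; apply/cvgrPdist_lt => e /H[N hN]; exists N => // n /= Nn.
rewrite distrC; exact: hN.
Qed.

Lemma continuous_normP (f : K -> K) (z : K) : {for z, continuous f} ->
  forall e, 0 < e -> exists2 dl, 0 < dl & forall h, `|h| < dl -> `|f (z + h) - f z| < e.
Proof.
move=> /cvgrPdist_lt fd e /fd /near_normP[dl dl0 H]; exists dl => // h hd.
by rewrite distrC; apply: H; rewrite addrAC subrr add0r.
Qed.

End Gen.

(** * The real-valued modulus on R[i] *)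

Section CNorm.
Variable R : realType.
Local Notation K := (R[i] : numClosedFieldType).

(** The norm of [R[i]] takes its values in [R[i]]; this one takes them in [R], where the order is
    total and linear arithmetic applies. *)
Definition cnorm (z : R[i]) : R := ComplexField.Normc.normc z.

Lemma normE (z : R[i]) : `|z| = (cnorm z)%:C%C.
Proof. by rewrite normc_def; case: z. Qed.

Lemma cnorm_lt (z : R[i]) (e : R) : (`|z| < e%:C%C) = (cnorm z < e).
Proof. by rewrite normE ltcR. Qed.

(** In the partial order of [R[i]] comparable elements have equal imaginary parts, so every epsilon
    of the complex topology is a real one. *)
Lemma gt0_complex (e : R[i]) : 0 < e -> exists2 r : R, 0 < r & e = r%:C%C.
Proof.
case: e => a b; rewrite ltcE => /andP[/eqP/= -> a0].
by exists a.
Qed.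

Lemma near_complexP (P : K -> Prop) (c : K) : (\forall z \near c, P z) <->
  exists2 e : R, 0 < e & forall z, cnorm (z - c) < e -> P z.
Proof.
apply: (iff_trans (near_normP P c)).
split.
  move=> [e /gt0_complex[r r0 ->] H]; exists r => // z h; apply: H.
  by rewrite cnorm_lt.
move=> [r r0 H]; exists r%:C%C; first by rewrite ltcR.
by move=> z; rewrite cnorm_lt; exact: H.
Qed.

Lemma dnear_complexP (P : K -> Prop) (c : K) : (\forall z \near c^', P z) <->
  exists2 e : R, 0 < e & forall z, z != c -> cnorm (z - c) < e -> P z.
Proof.
apply: (iff_trans (dnear_normP P c)).
split.
  move=> [e /gt0_complex[r r0 ->] H]; exists r => // z zc h; apply: H => //.
  by rewrite cnorm_lt.
move=> [r r0 H]; exists r%:C%C; first by rewrite ltcR.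
by move=> z zc; rewrite cnorm_lt; exact: H.
Qed.

Lemma cnorm_le (z : R[i]) (e : R) : (`|z| <= e%:C%C) = (cnorm z <= e).
Proof. by rewrite normE lecR. Qed.

Lemma cnorm_ge0 (z : R[i]) : 0 <= cnorm z.
Proof. by have := normr_ge0 z; rewrite normE lecR. Qed.

Lemma cnormM (x y : R[i]) : cnorm (x * y) = cnorm x * cnorm y.
Proof. exact: ComplexField.Normc.normcM. Qed.

Lemma cnormD (x y : R[i]) : cnorm (x + y) <= cnorm x + cnorm y.
Proof. exact: le_normcD. Qed.

Lemma cnormN (x : R[i]) : cnorm (- x) = cnorm x.
Proof. exact: normcN. Qed.

Lemma cnormB (x y : R[i]) : cnorm (x - y) <= cnorm x + cnorm y.
Proof. by rewrite (le_trans (cnormD _ _))// cnormN. Qed.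

Lemma cnormC (x y : R[i]) : cnorm (x - y) = cnorm (y - x).
Proof. by rewrite -cnormN opprB. Qed.

Lemma cnorm0 : cnorm 0 = 0.
Proof. exact: ComplexField.Normc.normc0. Qed.

Lemma cnorm1 : cnorm 1 = 1.
Proof. exact: ComplexField.Normc.normc1. Qed.

Lemma cnormV (x : R[i]) : cnorm x^-1 = (cnorm x)^-1.
Proof. exact: ComplexField.Normc.normcV. Qed.

Lemma cnormX (x : R[i]) n : cnorm (x ^+ n) = cnorm x ^+ n.
Proof. by elim: n => [|n IH]; rewrite ?expr0 ?cnorm1// !exprS cnormM IH. Qed.

Lemma cnorm_eq0 (x : R[i]) : (cnorm x == 0) = (x == 0).
Proof.
apply/eqP/eqP => [/ComplexField.Normc.eq0_normc//|->]; exact: cnorm0.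
Qed.

Lemma cnorm_gt0 (x : R[i]) : (0 < cnorm x) = (x != 0).
Proof. by rewrite lt_neqAle cnorm_ge0 andbT eq_sym cnorm_eq0. Qed.

Lemma cnormR (x : R) : cnorm x%:C%C = `|x|.
Proof. by rewrite /cnorm /ComplexField.Normc.normc/= expr0n/= addr0 sqrtr_sqr. Qed.

Lemma cnormi : cnorm 'i%C = 1.
Proof. by rewrite /cnorm /ComplexField.Normc.normc/= expr0n/= add0r expr1n sqrtr1. Qed.

Lemma cnorm_Re (x : R[i]) : `|complex.Re x| <= cnorm x.
Proof. by rewrite -lecR -normE normc_ge_Re. Qed.

Lemma cnorm_Im (x : R[i]) : `|complex.Im x| <= cnorm x.
Proof.
case: x => a b; rewrite /cnorm /ComplexField.Normc.normc /= -sqrtr_sqr ler_sqrt.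
  by rewrite lerDr sqr_ge0.
by rewrite addr_ge0// sqr_ge0.
Qed.

Lemma cnorm_le_ReIm (x : R[i]) :
  cnorm x <= `|complex.Re x| + `|complex.Im x|.
Proof.
rewrite {1}[x]complexE; apply: (le_trans (cnormD _ _)).
by rewrite cnormM cnormi mul1r !cnormR.
Qed.

Lemma cderivP (f : K -> K) (z d : K) : is_derive z 1 f d ->
  forall e : R, 0 < e -> exists2 dl : R, 0 < dl &
   forall h, cnorm h < dl -> cnorm (f (z + h) - f z - d * h) <= e * cnorm h.
Proof.
move=> /is_derive_normP H e e0.
have [|dl /gt0_complex[r r0 ->] h1] := H e%:C%C; first by rewrite ltcR.
exists r => // h hr; rewrite -cnorm_le rmorphM /= -normE; apply: h1.
by rewrite cnorm_lt.
Qed.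

Lemma ccvgnP (u : nat -> K) (l : K) : (u @ \oo --> l) <->
  forall e : R, 0 < e -> exists N, forall n, (N <= n)%N -> cnorm (u n - l) < e.
Proof.
apply: (iff_trans (cvgn_normP u l)); split=> H.
  move=> e e0; have [|N hN] := H e%:C%C; first by rewrite ltcR.
  by exists N => n Nn; rewrite -cnorm_lt; exact: hN.
move=> e /gt0_complex[r r0 ->]; have [N hN] := H r r0.
by exists N => n Nn; rewrite cnorm_lt; exact: hN.
Qed.

Lemma ccontP (f : K -> K) (z : K) : {for z, continuous f} ->
  forall e : R, 0 < e ->
  exists2 dl : R, 0 < dl & forall h, cnorm h < dl -> cnorm (f (z + h) - f z) < e.
Proof.
move=> /continuous_normP H e e0.
have [|dl /gt0_complex[r r0 ->] h1] := H e%:C%C; first by rewrite ltcR.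
by exists r => // h hr; rewrite -cnorm_lt; apply: h1; rewrite cnorm_lt.
Qed.

End CNorm.

(** * Complex-valued integrals over a real interval *)

Section CInt.
Variable R : realType.
Local Notation K := (R[i] : numClosedFieldType).
Local Notation mu := (@lebesgue_measure R).
Implicit Types (a b c : R) (f g : R -> R[i]).

Definition cint a b f : R[i] :=
  ((\int[mu]_(t in `[a, b]) complex.Re (f t)) +i*
   (\int[mu]_(t in `[a, b]) complex.Im (f t)))%C.

Definition cintble a b f : Prop :=
  mu.-integrable `[a, b] (EFin \o (@complex.Re R \o f)) /\
  mu.-integrable `[a, b] (EFin \o (@complex.Im R \o f)).

Lemma ReD (x y : R[i]) : complex.Re (x + y) = complex.Re x + complex.Re y.
Proof. by case: x; case: y. Qed.

Lemma ImD (x y : R[i]) : complex.Im (x + y) = complex.Im x + complex.Im y.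
Proof. by case: x; case: y. Qed.

Lemma ReM (x y : R[i]) :
  complex.Re (x * y) = complex.Re x * complex.Re y - complex.Im x * complex.Im y.
Proof. by case: x; case: y. Qed.

Lemma ImM (x y : R[i]) :
  complex.Im (x * y) = complex.Re x * complex.Im y + complex.Im x * complex.Re y.
Proof. by case: x; case: y. Qed.

Let mitv a b : measurable (`[a, b]%classic : set (measurableTypeR R)).
Proof. exact: measurable_itv. Qed.

Lemma fine_mu_itv a b : a <= b -> fine (mu `[a, b]%classic) = b - a.
Proof.
move=> ab; rewrite lebesgue_measure_itv/= lte_fin.
case: ltP => [_|ba]; first by rewrite -EFinD.
have/eqP-> : a == b by rewrite eq_le ab ba.
by rewrite subrr.
Qed.

Lemma itv_integrable_cst a b (r : R) :
  mu.-integrable `[a, b] (EFin \o (fun=> r)).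
Proof.
apply/integrableP; split; first exact: measurable_cst.
under eq_integral do rewrite /=.
rewrite integral_cst//= lebesgue_measure_itv/=; case: ifP => _.
  by rewrite -EFinD -EFinM ltry.
by rewrite mule0 ltry.
Qed.

Lemma cintbleD a b f g : cintble a b f -> cintble a b g ->
  cintble a b (fun t => f t + g t).
Proof.
move=> [f1 f2] [g1 g2]; split.
  have := integrableD (mitv a b) f1 g1; apply: eq_integrable => // t _ /=.
  by rewrite -EFinD -ReD.
have := integrableD (mitv a b) f2 g2; apply: eq_integrable => // t _ /=.
by rewrite -EFinD -ImD.
Qed.

Lemma cintD a b f g : cintble a b f -> cintble a b g ->
  cint a b (fun t => f t + g t) = cint a b f + cint a b g.
Proof.
move=> [f1 f2] [g1 g2]; rewrite /cint.
under eq_Rintegral do rewrite ReD.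
under [X in (_ +i* X)%C = _]eq_Rintegral do rewrite ImD.
by rewrite !RintegralD.
Qed.

Lemma cintbleZ a b f (k : R[i]) : cintble a b f -> cintble a b (fun t => k * f t).
Proof.
move=> [f1 f2].
have h1 u := integrableZl (mitv a b) u f1.
have h2 u := integrableZl (mitv a b) u f2.
split.
  have := integrableB (mitv a b) (h1 (complex.Re k)) (h2 (complex.Im k)).
  by apply: eq_integrable => // t _ /=; rewrite -!EFinM -EFinB ReM.
have := integrableD (mitv a b) (h2 (complex.Re k)) (h1 (complex.Im k)).
by apply: eq_integrable => // t _ /=; rewrite -!EFinM -EFinD ImM.
Qed.

Lemma cintZ a b f (k : R[i]) : cintble a b f ->
  cint a b (fun t => k * f t) = k * cint a b f.
Proof.
move=> [f1 f2]; rewrite /cint.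
have h1 u := integrableZl (mitv a b) u f1.
have h2 u := integrableZl (mitv a b) u f2.
under eq_Rintegral do rewrite ReM.
under [X in (_ +i* X)%C = _]eq_Rintegral do rewrite ImM.
rewrite RintegralB//= ?RintegralD//=; [|exact: h2|exact: h1|exact: h1|exact: h2].
rewrite !RintegralZl//.
by apply/eqP; rewrite eq_complex ReM ImM /= !eqxx.
Qed.

Lemma cintN a b f : cintble a b f -> cint a b (fun t => - f t) = - cint a b f.
Proof.
move=> h; rewrite -mulN1r -cintZ//; congr cint; apply/funext => t.
by rewrite mulN1r.
Qed.

Lemma cintB a b f g : cintble a b f -> cintble a b g ->
  cint a b (fun t => f t - g t) = cint a b f - cint a b g.
Proof.
move=> hf hg; rewrite -cintN// -cintD//.
have := cintbleZ (-1) hg; congr cintble.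
by apply/funext => t; rewrite mulN1r.
Qed.

Lemma cint_cat a b c f : a <= b -> b <= c -> cintble a c f ->
  cint a c f = cint a b f + cint b c f.
Proof.
move=> ab bc [f1 f2].
have H (h : R -> R) : mu.-integrable `[a, c] (EFin \o h) ->
   \int[mu]_(t in `[a, c]) h t = \int[mu]_(t in `[a, b]) h t +
   \int[mu]_(t in `[b, c]) h t.
  move=> ih; apply/eqP; rewrite addrC -subr_eq; apply/eqP.
  rewrite Rintegral_itvB ?bnd_simp//.
  rewrite Rintegral_itv_obnd_cbnd//; apply: integrableS ih => //.
  by move=> t /=; rewrite !in_itv/= => /andP[/ltW/(le_trans ab)-> ->].
by apply/eqP; rewrite eq_complex ReD ImD /= !H ?eqxx.
Qed.

(** The real and the imaginary part are bounded separately, each by [M]; hence the factor 2. *)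
Lemma cint_bound a b f (M : R) : a <= b -> cintble a b f ->
  (forall t, a <= t <= b -> cnorm (f t) <= M) ->
  cnorm (cint a b f) <= 2 * M * (b - a).
Proof.
move=> ab [f1 f2] fM.
have H (h : R -> R) : mu.-integrable `[a, b] (EFin \o h) ->
   (forall t, a <= t <= b -> `|h t| <= M) ->
   `|\int[mu]_(t in `[a, b]) h t| <= M * (b - a).
  move=> ih hM; apply: (le_trans (le_normr_Rintegral _ ih)) => //.
  have -> : M * (b - a) = \int[mu]_(t in `[a, b]) M.
    by rewrite Rintegral_cst// fine_mu_itv.
  apply: le_Rintegral => //.
  - by have := integrable_abse ih; apply: eq_integrable.
  - exact: itv_integrable_cst.
apply: (le_trans (cnorm_le_ReIm _)) => /=.
rewrite -mulrA mulr_natl mulr2n; apply: lerD; apply: H => // t tab.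
  exact: le_trans (cnorm_Re _) (fM t tab).
exact: le_trans (cnorm_Im _) (fM t tab).
Qed.

Lemma cint_cst a b (k : R[i]) : a <= b -> cint a b (fun=> k) = k * (b - a)%:C%C.
Proof.
move=> ab.
have H (r : R) : \int[mu]_(t in `[a, b]) r = r * (b - a).
  by rewrite Rintegral_cst// fine_mu_itv.
by apply/eqP; rewrite eq_complex ReM ImM /= !H !mulr0 subr0 add0r !eqxx.
Qed.

Lemma eq_cint a b f g : (forall t, a <= t <= b -> f t = g t) ->
  cint a b f = cint a b g.
Proof.
move=> fg; rewrite /cint; congr (_ +i* _)%C; apply: eq_Rintegral => t;
by rewrite inE/= in_itv/= => /fg->.
Qed.

(** [p] stands for the real part, the imaginary part or the modulus, all of them 1-Lipschitz. *)
Lemma path_continuous a b (F : K -> K) (z v : R[i]) (p : R[i] -> R) :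
  (forall x y, `|p x - p y| <= cnorm (x - y)) ->
  (forall t, a <= t <= b -> {for (z + t%:C%C * v : K), continuous F}) ->
  {within `[a, b], continuous (p \o (fun t => F (z + t%:C%C * v)))}.
Proof.
move=> pL cF; apply: continuous_in_subspaceT => t.
rewrite inE/= in_itv/= => /cF/ccontP H.
apply/cvgrPdist_lt => e e0; have [dl dl0 h1] := H e e0.
(* The summand 1 covers the case v = 0. *)
have c0 : 0 < dl / (cnorm v + 1) by rewrite divr_gt0// ltr_wpDl// cnorm_ge0.
apply/nbhs_normP; exists (dl / (cnorm v + 1)) => // u /= hu.
rewrite /= (le_lt_trans (pL _ _))//.
have -> : z + u%:C%C * v = z + t%:C%C * v + (u - t)%:C%C * v.
  by rewrite rmorphB/=; ring.
rewrite cnormC; apply: h1.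
rewrite cnormM cnormR; apply: (@le_lt_trans _ _ (`|u - t| * (cnorm v + 1))).
  by rewrite ler_wpM2l// lerDl.
by rewrite -ltr_pdivlMr ?ltr_wpDl ?cnorm_ge0// distrC.
Qed.

Lemma cnorm_lip (x y : R[i]) : `|cnorm x - cnorm y| <= cnorm (x - y).
Proof.
have H u v : cnorm u - cnorm v <= cnorm (u - v).
  by rewrite lerBlDr -{1}(subrK v u) cnormD.
by rewrite ler_norml lerNl opprB H cnormC H.
Qed.

Lemma cintble_continuous a b (F : K -> K) (z v : R[i]) :
  (forall t, a <= t <= b -> {for (z + t%:C%C * v : K), continuous F}) ->
  cintble a b (fun t => F (z + t%:C%C * v)).
Proof.
move=> cF.
by split; apply: continuous_compact_integrable; do ?[exact: segment_compact];
   apply: path_continuous => // x y; rewrite -raddfB/=;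
   [exact: cnorm_Re|exact: cnorm_Im].
Qed.

End CInt.

(** * Goursat's lemma *)

Section Bisection.
Variable R : realType.
Variable P : R -> R -> R -> R -> Prop.
Variables a0 b0 c0 d0 : R.
Hypotheses (ab0 : a0 <= b0) (cd0 : c0 <= d0).

Hypothesis Pquad : forall a b c d, a <= b -> c <= d ->
  let m := (a + b) / 2 in let n := (c + d) / 2 in
  P a m c n -> P m b c n -> P a m n d -> P m b n d -> P a b c d.

Hypothesis Ploc : forall x y, a0 <= x <= b0 -> c0 <= y <= d0 ->
  exists2 dl, 0 < dl & forall a b c d, a0 <= a -> b <= b0 -> c0 <= c -> d <= d0 ->
    a <= x <= b -> c <= y <= d -> b - a < dl -> d - c < dl -> P a b c d.

(** Selects a quarter on which [P] fails. The last quarter is the default; it is a failing one by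
    [Pquad] when the other three satisfy [P]. *)
Let step (q : R * R * R * R) : R * R * R * R :=
  let: (a, b, c, d) := q in
  let m := (a + b) / 2 in let n := (c + d) / 2 in
  if `[< ~ P a m c n >] then (a, m, c, n) else
  if `[< ~ P m b c n >] then (m, b, c, n) else
  if `[< ~ P a m n d >] then (a, m, n, d) else (m, b, n, d).

Let q n := iter n step (a0, b0, c0, d0).
Let qa n := (q n).1.1.1.
Let qb n := (q n).1.1.2.
Let qc n := (q n).1.2.
Let qd n := (q n).2.

Let stepP n : [/\ qa n <= qb n, qc n <= qd n, qa n <= qa n.+1 & qb n.+1 <= qb n] ->
  [/\ qc n <= qc n.+1 , qd n.+1 <= qd n, qa n.+1 <= qb n.+1, qc n.+1 <= qd n.+1 &
   qb n.+1 - qa n.+1 = (qb n - qa n) / 2 /\ qd n.+1 - qc n.+1 = (qd n - qc n) / 2].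
Proof.
rewrite /qa /qb /qc /qd /q iterS; case: (iter n _ _) => [[[a b] c] d] /=.
move=> [ab cd _ _].
by do !case: ifP => _ /=; split; try split; try lra.
Qed.

Let qP n : [/\ qa n <= qb n, qc n <= qd n, qa n <= qa n.+1 & qb n.+1 <= qb n].
Proof.
have H m : qa m <= qb m -> qa m <= qa m.+1 /\ qb m.+1 <= qb m.
  rewrite /qa /qb /q iterS; case: (iter m _ _) => [[[a b] c] d] /= ab.
  by do !case: ifP => _ /=; split; lra.
elim: n => [|n IH]; first by have [] := H 0%N ab0; split.
have [_ _ h1 h2 _] := stepP IH; have [] := H n.+1 h1; by split.
Qed.

Let q_bad : ~ P a0 b0 c0 d0 -> forall n, ~ P (qa n) (qb n) (qc n) (qd n).
Proof.
move=> bad; elim => [//|n].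
have [] := qP n.
rewrite /qa /qb /qc /qd /q iterS; case: (iter n _ _) => [[[a b] c] d] /= ab cd _ _.
move=> nP.
case: asboolP => //= /contrapT P1.
case: asboolP => //= /contrapT P2.
case: asboolP => //= /contrapT P3 P4.
by apply: nP; apply: Pquad.
Qed.

Let q_size n : qb n - qa n = (b0 - a0) / 2 ^+ n /\ qd n - qc n = (d0 - c0) / 2 ^+ n.
Proof.
elim: n => [|n [h1 h2]]; first by rewrite expr0 !divr1.
have [_ _ _ _ [-> ->]] := stepP (qP n).
by rewrite h1 h2 exprSr invfM !mulrA.
Qed.

Let mono (u v : nat -> R) :
  (forall n, u n <= v n) -> (forall n, u n <= u n.+1) -> (forall n, v n.+1 <= v n) ->
  exists x, forall n, u n <= x <= v n.
Proof.
move=> uv uS vS.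
have u_le : {homo u : i j / (i <= j)%N >-> i <= j}.
  by apply: homo_leq => // ? ? ?; exact: le_trans.
have v_le : {homo v : i j / (i <= j)%N >-> j <= i}.
  by apply: homo_leq => // ? ? ? h1 h2; exact: le_trans h2 h1.
have uv' i j : u i <= v j.
  apply: (le_trans (u_le _ _ (leq_maxl i j))).
  by apply: (le_trans (uv _)); apply: v_le; exact: leq_maxr.
exists (sup (range u)) => n; apply/andP; split.
  apply: ub_le_sup; last by exists n.
  by exists (v 0%N) => _ [i _ <-].
by apply: ge_sup; [exists (u 0%N), 0%N|move=> _ [i _ <-]].
Qed.

(** If [P] failed on the whole rectangle, failing quarters could be chosen for ever; they shrink to
    a point, and [Ploc] at that point contradicts the failure of a small one. *)
Lemma bisection2 : P a0 b0 c0 d0.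
Proof.
apply: contrapT => /q_bad bad.
have [x hx] : exists x, forall n, qa n <= x <= qb n.
  by apply: mono => n; have [] := qP n.
have [y hy] : exists x, forall n, qc n <= x <= qd n.
  apply: mono => n; first by have [] := qP n.
    by have [] := stepP (qP n).
  by have [] := stepP (qP n).
have [||dl dl0 H] := Ploc (x := x) (y := y); [exact: (hx 0%N)|exact: (hy 0%N)|].
have a_le n : a0 <= qa n.
  by elim: n => // n /le_trans; apply; have [] := qP n.
have b_le n : qb n <= b0.
  by elim: n => // n; apply: le_trans; have [] := qP n.
have c_le n : c0 <= qc n.
  by elim: n => // n /le_trans; apply; have [] := stepP (qP n).
have d_le n : qd n <= d0.
  by elim: n => // n; apply: le_trans; have [] := stepP (qP n).
have [n hn] : exists n, (b0 - a0) + (d0 - c0) < dl * 2 ^+ n.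
  exists (Num.bound (((b0 - a0) + (d0 - c0)) / dl)).
  rewrite mulrC -ltr_pdivrMr//.
  apply: (lt_le_trans (archi_boundP _)).
    by apply: divr_ge0; [rewrite addr_ge0// subr_ge0|exact: ltW].
  by rewrite -natrX ler_nat ltnW// ltn_expl.
have [h1 h2] := q_size n.
apply: (bad n); apply: H => //; rewrite ?h1 ?h2 ltr_pdivrMr ?exprn_gt0//;
  by move: hn ab0 cd0; set u := dl * _; lra.
Qed.

End Bisection.

Section Goursat.
Variable R : realType.
Local Notation K := (R[i] : numClosedFieldType).
Implicit Types (f : K -> K) (a b c d : R).

Definition pt (x y : R) : R[i] := (x +i* y)%C.

Lemma ptE x y : pt x y = x%:C%C + y%:C%C * 'i%C.
Proof. by rewrite {1}[pt x y]complexE mulrC. Qed.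

Lemma ptxE x y : pt x y = y%:C%C * 'i%C + x%:C%C * 1.
Proof. by rewrite ptE mulr1 addrC. Qed.

(** The contour integral along the boundary of the rectangle, counterclockwise: bottom minus top,
    plus i times right minus left. *)
Definition rint f a b c d : R[i] :=
  cint a b (fun x => f (pt x c)) - cint a b (fun x => f (pt x d)) +
  'i%C * (cint c d (fun y => f (pt b y)) - cint c d (fun y => f (pt a y))).

Definition rcont f a b c d := forall x y, a <= x <= b -> c <= y <= d ->
  {for (pt x y : K), continuous f}.

Lemma rcontS f a b c d a' b' c' d' : a <= a' -> b' <= b -> c <= c' -> d' <= d ->
  rcont f a b c d -> rcont f a' b' c' d'.
Proof.
move=> aa bb cc dd h x y /andP[ax xb] /andP[cy yd]; apply: h; apply/andP; split.
- exact: le_trans ax.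
- exact: le_trans bb.
- exact: le_trans cy.
- exact: le_trans dd.
Qed.

Lemma rcont_h f a b c d y : rcont f a b c d -> c <= y <= d ->
  cintble a b (fun x => f (pt x y)).
Proof.
move=> fc yd; have := @cintble_continuous R a b f (y%:C%C * 'i%C) 1.
rewrite (_ : (fun _ => _) = (fun x => f (pt x y))); last first.
  by apply/funext => x; rewrite ptxE.
by apply => t tab; rewrite -ptxE; exact: fc.
Qed.

Lemma rcont_v f a b c d x : rcont f a b c d -> a <= x <= b ->
  cintble c d (fun y => f (pt x y)).
Proof.
move=> fc yd; have := @cintble_continuous R c d f (x%:C%C) 'i%C.
rewrite (_ : (fun _ => _) = (fun y => f (pt x y))); last first.
  by apply/funext => y; rewrite ptE.
by apply => t tab; rewrite -ptE; exact: fc.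
Qed.

Lemma rint_catx f a m b c d : rcont f a b c d -> a <= m -> m <= b -> c <= d ->
  rint f a b c d = rint f a m c d + rint f m b c d.
Proof.
move=> fc am mb cd; rewrite /rint.
rewrite (cint_cat am mb (rcont_h fc _)) ?lexx ?cd//.
rewrite (cint_cat am mb (rcont_h fc _)) ?lexx ?cd//.
by rewrite !mulrBr !opprD; ring.
Qed.

Lemma rint_caty f a b c m d : rcont f a b c d -> a <= b -> c <= m -> m <= d ->
  rint f a b c d = rint f a b c m + rint f a b m d.
Proof.
move=> fc ab cm md; rewrite /rint.
rewrite (cint_cat cm md (rcont_v fc _)) ?lexx ?ab//.
rewrite (cint_cat cm md (rcont_v fc _)) ?lexx ?ab//.
by rewrite !mulrBr; ring.
Qed.

Lemma cnorm_pt x y : cnorm (pt x y) <= `|x| + `|y|.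
Proof. exact: cnorm_le_ReIm. Qed.

(** Continuity at the points of the four sides only, since the Cauchy kernel is singular inside. *)
Definition bcont f a b c d := forall x y, a <= x <= b -> c <= y <= d ->
  x = a \/ x = b \/ y = c \/ y = d -> {for (pt x y : K), continuous f}.

Lemma rcont_bcont f a b c d : rcont f a b c d -> bcont f a b c d.
Proof. by move=> h x y hx hy _; exact: h. Qed.

Lemma bcont_int f a b c d : a <= b -> c <= d -> bcont f a b c d ->
  [/\ cintble a b (fun x => f (pt x c)), cintble a b (fun x => f (pt x d)),
      cintble c d (fun y => f (pt a y)) & cintble c d (fun y => f (pt b y))].
Proof.
move=> ab cd fc.
have fh y : c <= y <= d -> y = c \/ y = d -> cintble a b (fun x => f (pt x y)).
  move=> yd ycd; have := @cintble_continuous R a b f (y%:C%C * 'i%C) 1.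
  rewrite (_ : (fun _ => _) = (fun x => f (pt x y))); last first.
    by apply/funext => x; rewrite ptxE.
  by apply => t tab; rewrite -ptxE; apply: fc => //; right; right.
have fv x : a <= x <= b -> x = a \/ x = b -> cintble c d (fun y => f (pt x y)).
  move=> xb xab; have := @cintble_continuous R c d f (x%:C%C) 'i%C.
  rewrite (_ : (fun _ => _) = (fun y => f (pt x y))); last first.
    by apply/funext => y; rewrite ptE.
  by apply => t tab; rewrite -ptE; apply: fc => //; case: xab; [left|right; left].
by split; [apply: fh; [rewrite lexx|left]|apply: fh; [rewrite cd lexx|right]|
  apply: fv; [rewrite lexx|left]|apply: fv; [rewrite ab lexx|right]].
Qed.

Lemma bcontM f g a b c d : bcont f a b c d -> bcont g a b c d ->
  bcont (fun z => f z * g z) a b c d.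
Proof. by move=> fc gc x y hx hy h; apply: fcontM; [exact: fc|exact: gc]. Qed.

Lemma bcontD f g a b c d : bcont f a b c d -> bcont g a b c d ->
  bcont (fun z => f z + g z) a b c d.
Proof. by move=> fc gc x y hx hy h; apply: fcontD; [exact: fc|exact: gc]. Qed.

Lemma bcont_cst (k : R[i]) a b c d : bcont (fun=> k) a b c d.
Proof. by move=> x y hx hy h; exact: fcont_cst. Qed.
Arguments bcont_cst k a b c d : clear implicits.

Lemma bcont_sum (h : nat -> K -> K) n a b c d : (forall k, bcont (h k) a b c d) ->
  bcont (fun z => \sum_(k < n) h k z) a b c d.
Proof.
move=> hc; elim: n => [|n IH].
  rewrite (_ : (fun _ => _) = (fun z => 0)); last first.
    by apply/funext => z; rewrite big_ord0.
  exact: bcont_cst.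
rewrite (_ : (fun _ => _) = (fun z => \sum_(k < n) h k z + h n z)); last first.
  by apply/funext => z; rewrite big_ord_recr.
exact: (bcontD IH (hc n)).
Qed.

Lemma brintD f g a b c d : a <= b -> c <= d -> bcont f a b c d -> bcont g a b c d ->
  rint (fun z => f z + g z) a b c d = rint f a b c d + rint g a b c d.
Proof.
move=> ab cd /bcont_int[]// f1 f2 f3 f4 /bcont_int[]// g1 g2 g3 g4.
by rewrite /rint (cintD f1 g1) (cintD f2 g2) (cintD f3 g3) (cintD f4 g4); ring.
Qed.

Lemma brint_bound f a b c d M : a <= b -> c <= d -> bcont f a b c d ->
  (forall x y, a <= x <= b -> c <= y <= d ->
    x = a \/ x = b \/ y = c \/ y = d -> cnorm (f (pt x y)) <= M) ->
  cnorm (rint f a b c d) <= 4 * M * ((b - a) + (d - c)).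
Proof.
move=> ab cd /bcont_int[]// f1 f2 f3 f4 fM.
rewrite /rint; apply: (le_trans (cnormD _ _)).
rewrite cnormM cnormi mul1r.
have h1 : cnorm (cint a b (fun x => f (pt x c))) <= 2 * M * (b - a).
  by apply: cint_bound => // t tab; apply: fM; rewrite ?lexx//; tauto.
have h2 : cnorm (cint a b (fun x => f (pt x d))) <= 2 * M * (b - a).
  by apply: cint_bound => // t tab; apply: fM; rewrite ?lexx ?cd//; tauto.
have h3 : cnorm (cint c d (fun y => f (pt a y))) <= 2 * M * (d - c).
  by apply: cint_bound => // t tab; apply: fM; rewrite ?lexx//; tauto.
have h4 : cnorm (cint c d (fun y => f (pt b y))) <= 2 * M * (d - c).
  by apply: cint_bound => // t tab; apply: fM; rewrite ?lexx ?ab//; tauto.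
have := lerD (le_trans (cnormB _ _) (lerD h1 h2))
  (le_trans (cnormB _ _) (lerD h4 h3)).
by clear; move=> /le_trans; apply; lra.
Qed.

Lemma pt_sub x y x' y' : pt x y - pt x' y' = pt (x - x') (y - y').
Proof. by []. Qed.

(** Opposite sides differ by a constant: the horizontal pair gives -l i (d - c)(b - a), the vertical
    pair the opposite. *)
Lemma cint_affine a b c d x0 y0 (k l : R[i]) : a <= b -> c <= d ->
  rint (fun z => k + l * (z - pt x0 y0)) a b c d = 0.
Proof.
move=> ab cd; pose f := (fun z : K => k + l * (z - pt x0 y0)).
have fc : rcont f a b c d.
  move=> x y _ _; apply: fcontD; first exact: fcont_cst.
  apply: fcontM; first exact: fcont_cst.
  by apply: fcontB; [exact: fcont_id|exact: fcont_cst].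
rewrite /rint.
have cc : c <= c <= d by rewrite lexx.
have dd : c <= d <= d by rewrite lexx cd.
have aa : a <= a <= b by rewrite lexx.
have bb : a <= b <= b by rewrite lexx ab.
rewrite -(cintB (rcont_h fc cc) (rcont_h fc dd)).
rewrite -(cintB (rcont_v fc bb) (rcont_v fc aa)).
rewrite (@eq_cint _ _ _ _ (fun=> - l * 'i%C * (d - c)%:C%C)); last first.
  by move=> t _; rewrite /f !ptE rmorphB/=; ring.
rewrite (@eq_cint _ c d _ (fun=> l * (b - a)%:C%C)); last first.
  by move=> t _; rewrite /f !ptE rmorphB/=; ring.
by rewrite !cint_cst//; ring.
Qed.

Definition rderiv f a b c d := forall x y, a <= x <= b -> c <= y <= d ->
  derivable f (pt x y : K) 1.

Lemma rderiv_cont f a b c d : rderiv f a b c d -> rcont f a b c d.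
Proof. by move=> fd x y hx hy; apply: fderiv_cont; exact: fd. Qed.

(** Bisection is applied to the bound 4 e t^2, where t is half the perimeter. Four quarters of half
    the size add up to the same bound, and near a point differentiability leaves an error of size e
    |z - z0| after an affine function whose integral vanishes. *)
Theorem goursat f a b c d : a <= b -> c <= d -> rderiv f a b c d ->
  rint f a b c d = 0.
Proof.
move=> ab cd fd; have fc := rderiv_cont fd.
apply/eqP; rewrite -cnorm_eq0 eq_le cnorm_ge0 andbT.
apply/ler_addgt0Pr => e0 e00; rewrite add0r.
pose s := (b - a) + (d - c).
have s0 : 0 <= s by rewrite /s; lra.
(* Chosen so that 4 e s^2 stays below [e0]. *)
pose e := e0 / (4 * (s ^+ 2 + 1)).
have s1 : 0 < s ^+ 2 + 1 by rewrite ltr_wpDl// sqr_ge0.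
have e1 : 0 < e by rewrite divr_gt0// mulr_gt0.
suff : a <= a /\ b <= b /\ c <= c /\ d <= d -> cnorm (rint f a b c d) <= 4 * e * s ^+ 2.
  move=> /(_ (conj (lexx _) (conj (lexx _) (conj (lexx _) (lexx _))))).
  move/le_trans; apply.
  have -> : 4 * e * s ^+ 2 = e0 * (s ^+ 2 / (s ^+ 2 + 1)).
    by rewrite /e; field; rewrite gt_eqF.
  rewrite ler_piMr ?(ltW e00)// ler_pdivrMr// mul1r lerDl//.
rewrite /s.
apply: (@bisection2 R (fun a' b' c' d' => a <= a' /\ b' <= b /\ c <= c' /\ d' <= d ->
  cnorm (rint f a' b' c' d') <= 4 * e * ((b' - a') + (d' - c')) ^+ 2)) => //.
- move=> a' b' c' d' ab' cd' m n h1 h2 h3 h4 [aa [bb [cc dd]]].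
  have [am mb] : a' <= m /\ m <= b' by rewrite /m !midf_le.
  have [cn nd] : c' <= n /\ n <= d' by rewrite /n !midf_le.
  have fc' : rcont f a' b' c' d' by exact: rcontS fc.
  rewrite (rint_caty fc' ab' cn nd).
  rewrite (rint_catx _ am mb cn); last by apply: rcontS fc'.
  rewrite (rint_catx _ am mb nd); last by apply: rcontS fc'.
  have k1 := h1 (conj aa (conj (le_trans mb bb) (conj cc (le_trans nd dd)))).
  have k2 := h2 (conj (le_trans aa am) (conj bb (conj cc (le_trans nd dd)))).
  have k3 := h3 (conj aa (conj (le_trans mb bb) (conj (le_trans cc cn) dd))).
  have k4 := h4 (conj (le_trans aa am) (conj bb (conj (le_trans cc cn) dd))).
  have := lerD (le_trans (cnormD _ _) (lerD k1 k2)) (le_trans (cnormD _ _) (lerD k3 k4)).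
  move/(le_trans (cnormD _ _))/le_trans; apply.
  rewrite /m /n le_eqVlt; apply/orP; left; apply/eqP.
  by field.
- move=> x y hx hy; pose l := 'D_1 f (pt x y : K).
  have H := cderivP ((derivableP (fd x y hx hy)) : is_derive (pt x y : K) 1 f l).
  have [dl dl0 h1] := H e e1.
  exists (dl / 2); first by rewrite divr_gt0.
  move=> a' b' c' d' aa bb cc dd /andP[ax xb] /andP[cy yd] ba dc _.
  have ab' : a' <= b' by exact: le_trans xb.
  have cd' : c' <= d' by exact: le_trans yd.
  have fc' : rcont f a' b' c' d' by exact: rcontS fc.
  pose A := (fun z : K => f (pt x y) + l * (z - pt x y)).
  have Ac : rcont A a' b' c' d'.
    move=> u v _ _; apply: fcontD; first exact: fcont_cst.
    apply: fcontM; first exact: fcont_cst.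
    by apply: fcontB; [exact: fcont_id|exact: fcont_cst].
  pose E := (fun z : K => f z - A z).
  have Ec : rcont E a' b' c' d'.
    by move=> u v hu hv; apply: fcontB; [exact: fc'|exact: Ac].
  have -> : rint f a' b' c' d' = rint E a' b' c' d'.
    have := brintD ab' cd' (rcont_bcont Ec) (rcont_bcont Ac).
    rewrite (cint_affine x y (f (pt x y)) l ab' cd') addr0 => <-.
    by rewrite (_ : (fun z => E z + A z) = f)//; apply/funext => z; rewrite /E subrK.
  set t := (b' - a') + (d' - c').
  (* On the boundary the error is at most e t, because every point lies within t of the centre; the
     second factor t is half the perimeter. *)
  have -> : 4 * e * t ^+ 2 = 4 * (e * t) * t by ring.
  apply: brint_bound => // [|u v /andP[au ub] /andP[cv vd] _].
    exact: rcont_bcont.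
  have := h1 (pt u v - pt x y).
  rewrite [pt x y + _]addrC subrK.
  have nt : cnorm (pt u v - pt x y) <= t.
    have dist_itv (p q r w : R) : p <= r -> r <= q -> p <= w -> w <= q ->
        `|r - w| <= q - p.
      by clear; move=> *; rewrite ler_norml; lra.
    rewrite pt_sub; apply: (le_trans (cnorm_pt _ _)); rewrite /t lerD//.
      exact: dist_itv.
    exact: dist_itv.
  have -> : E (pt u v) = f (pt u v) - f (pt x y) - l * (pt u v - pt x y).
    by rewrite /E /A opprD addrA.
  move=> h2; apply: (le_trans (h2 _)).
    by apply: (le_lt_trans nt); rewrite (splitr dl) ltrD.
  by rewrite ler_wpM2l// ltW.
Qed.

End Goursat.

Section FieldDerive.
Variable F : numFieldType.

Lemma is_derive_norm (f : F -> F) (z d : F) :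
  (forall e, 0 < e -> exists2 dl, 0 < dl &
     forall h, `|h| < dl -> `|f (z + h) - f z - d * h| <= e * `|h|) ->
  is_derive z 1 f d.
Proof.
move=> H.
have L : h^-1 *: ((f \o shift z) (h *: 1) - f z) @[h --> 0^'] --> d.
  apply/cvgrPdist_le => e e0; have [dl dl0 h1] := H e e0.
  apply/dnear_normP; exists dl => // h h0; rewrite subr0 => hd.
  rewrite -(ler_pM2r (_ : 0 < `|h|)) ?normr_gt0// -normrM mulrBl /=.
  rewrite [h *: 1]mulr1 [_ *: _]mulrC mulfVK// distrC (addrC h).
  exact: h1.
apply: DeriveDef; first by apply/cvg_ex; exists d.
by apply: cvg_lim L.
Qed.

Lemma derivable_shift (f : F -> F) (c z : F) : derivable f (c + z) 1 ->
  derivable (fun x => f (c + x)) z 1.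
Proof.
move=> H; rewrite /derivable (_ : (fun h => _) =
  (fun h : F => h^-1 *: ((f \o shift (c + z)) (h *: 1) - f (c + z))))//.
by apply/funext => h /=; rewrite addrCA.
Qed.

End FieldDerive.

(** * Removable singularities and primitives along segments *)

Section Cauchy.
Variable R : realType.
Local Notation K := (R[i] : numClosedFieldType).
Local Notation mu := (@lebesgue_measure R).
Implicit Types (f g : K -> K) (a b c d : R).

Lemma brintZ f (k : R[i]) a b c d : a <= b -> c <= d -> bcont f a b c d ->
  rint (fun z => k * f z) a b c d = k * rint f a b c d.
Proof.
move=> ab cd /bcont_int[]// f1 f2 f3 f4.
by rewrite /rint (cintZ k f1) (cintZ k f2) (cintZ k f3) (cintZ k f4); ring.
Qed.

Lemma brint_sum (h : nat -> K -> K) n a b c d : a <= b -> c <= d ->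
  (forall k, bcont (h k) a b c d) ->
  rint (fun z => \sum_(k < n) h k z) a b c d = \sum_(k < n) rint (h k) a b c d.
Proof.
move=> ab cd hc; elim: n => [|n IH].
  rewrite big_ord0 (_ : (fun _ => _) = (fun z => 0 * 0)); last first.
    by apply/funext => z; rewrite big_ord0 mul0r.
  by rewrite brintZ ?mul0r//; exact: bcont_cst.
rewrite big_ord_recr/= -IH -brintD//.
  rewrite (_ : (fun z => \sum_(k < n.+1) h k z) = (fun z => \sum_(k < n) h k z + h n z))//.
  by apply/funext => z; rewrite big_ord_recr.
exact: bcont_sum.
Qed.

Lemma eq_rint f g a b c d : a <= b -> c <= d ->
  (forall x y, a <= x <= b -> c <= y <= d ->
    x = a \/ x = b \/ y = c \/ y = d -> f (pt x y) = g (pt x y)) ->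
  rint f a b c d = rint g a b c d.
Proof.
move=> ab cd fg; rewrite /rint.
by congr (_ - _ + 'i%C * (_ - _)); apply: eq_cint => t ht; apply: fg => //;
  rewrite ?lexx ?ab ?cd//; tauto.
Qed.

(** Four rectangles around a small square centred at the exceptional point contribute zero by
    [goursat]. On the square f is bounded by continuity, and the perimeter tends to 0. *)
Lemma goursat_removable f a b c d x0 y0 : a < x0 < b -> c < y0 < d ->
  rcont f a b c d ->
  (forall x y, a <= x <= b -> c <= y <= d -> pt x y != pt x0 y0 ->
    derivable f (pt x y : K) 1) ->
  rint f a b c d = 0.
Proof.
move=> /andP[ax xb] /andP[cy yd] fc fd.
have ab : a <= b by rewrite ltW// (lt_trans ax).
have cd : c <= d by rewrite ltW// (lt_trans cy).
have ptN x y : x != x0 \/ y != y0 -> pt x y != pt x0 y0.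
  by rewrite eq_complex negb_and => -[->//|->]; rewrite orbT.
have small dl : 0 < dl -> dl < x0 - a -> dl < b - x0 -> dl < y0 - c -> dl < d - y0 ->
    rint f a b c d = rint f (x0 - dl) (x0 + dl) (y0 - dl) (y0 + dl).
  move=> dl0 h1 h2 h3 h4.
  have [e1 e2] : a <= x0 - dl /\ x0 - dl <= x0 + dl.
    by clear -dl0 h1; split; lra.
  have [e3 e4] : x0 + dl <= b /\ c <= y0 - dl.
    by clear -dl0 h2 h3; split; lra.
  have [e5 e6] : y0 - dl <= y0 + dl /\ y0 + dl <= d.
    by clear -dl0 h4; split; lra.
  have [l1 l2] : (x0 - dl < x0 /\ x0 < x0 + dl) by clear -dl0; split; lra.
  have [l3 l4] : (y0 - dl < y0 /\ y0 < y0 + dl) by clear -dl0; split; lra.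
  rewrite (rint_catx fc e1 (le_trans e2 e3) cd).
  rewrite (@goursat R f a) ?add0r//; last first.
    move=> x y /andP[p q] hy; apply: fd => //.
      by rewrite p/= (le_trans q)// (le_trans e2).
    by apply: ptN; left; rewrite lt_eqF// (le_lt_trans q).
  have fc1 : rcont f (x0 - dl) b c d by exact: rcontS fc.
  rewrite (rint_catx fc1 e2 e3 cd).
  rewrite (@goursat R f (x0 + dl)) ?addr0//; last first.
    move=> x y /andP[p q] hy; apply: fd => //.
      by rewrite q andbT (le_trans _ p)// (le_trans e1).
    by apply: ptN; left; rewrite gt_eqF// (lt_le_trans _ p).
  have fc2 : rcont f (x0 - dl) (x0 + dl) c d by exact: rcontS fc1.
  have e7 : forall x, x0 - dl <= x <= x0 + dl -> a <= x <= b.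
    by move=> x /andP[p q]; rewrite (le_trans e1)// (le_trans q).
  rewrite (rint_caty fc2 e2 e4 (le_trans e5 e6)).
  rewrite (@goursat R f (x0 - dl) (x0 + dl) c) ?add0r//; last first.
    move=> x y hx /andP[p q]; apply: fd => //; first exact: e7.
      by rewrite p/= (le_trans q)// (le_trans e5).
    by apply: ptN; right; rewrite lt_eqF// (le_lt_trans q).
  have fc3 : rcont f (x0 - dl) (x0 + dl) (y0 - dl) d by exact: rcontS fc2.
  rewrite (rint_caty fc3 e2 e5 e6).
  rewrite (@goursat R f (x0 - dl) (x0 + dl) (y0 + dl)) ?addr0//.
  move=> x y hx /andP[p q]; apply: fd => //; first exact: e7.
    by rewrite q andbT (le_trans _ p)// (le_trans e4).
  by apply: ptN; right; rewrite gt_eqF// (lt_le_trans _ p).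
have [dl0 dl00 H] := ccontP (fc x0 y0 (introT andP (conj (ltW ax) (ltW xb)))
  (introT andP (conj (ltW cy) (ltW yd)))) (ltr01 : 0 < (1 : R)).
pose M := cnorm (f (pt x0 y0)) + 1.
have M0 : 0 < M by rewrite ltr_wpDl// cnorm_ge0.
apply/eqP; rewrite -cnorm_eq0 eq_le cnorm_ge0 andbT.
apply/ler_addgt0Pr => e e0; rewrite add0r.
pose m := Num.min (Num.min (x0 - a) (b - x0)) (Num.min (y0 - c) (d - y0)).
(* The three bounds keep the square inside the rectangle, keep its points within [dl0] of the centre
   (the modulus is at most 2 [dl]), and make the boundary estimate 16 M [dl] at most [e]. *)
pose dl := Num.min (Num.min (m / 2) (dl0 / 3)) (e / (16 * M)).
have m0 : 0 < m by rewrite !lt_min !subr_gt0 ax xb cy yd.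
have dlp : 0 < dl by rewrite !lt_min !divr_gt0// mulr_gt0.
have dlm : dl < m.
  rewrite (@le_lt_trans _ _ (m / 2))//; first by rewrite !ge_min lexx.
  by clear -m0; lra.
have dld : dl <= dl0 / 3 by rewrite !ge_min lexx orbT.
have dle : dl <= e / (16 * M) by rewrite !ge_min lexx orbT.
have := dlm; rewrite !lt_min => /andP[/andP[k1 k2] /andP[k3 k4]].
rewrite (small dl)//.
apply: (@le_trans _ _ (4 * M * ((x0 + dl - (x0 - dl)) + (y0 + dl - (y0 - dl))))).
  apply: brint_bound.
  - by clear -dlp; lra.
  - by clear -dlp; lra.
  - by apply: rcont_bcont; apply: rcontS fc; clear -dlp k1 k2 k3 k4; lra.
  move=> x y /andP[p1 p2] /andP[q1 q2] _.
  have := H (pt x y - pt x0 y0); rewrite [pt x0 y0 + _]addrC subrK => H1.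
  have : cnorm (f (pt x y) - f (pt x0 y0)) < 1.
    apply: H1; rewrite pt_sub; apply: (le_lt_trans (cnorm_pt _ _)).
    have p3 : `|x - x0| <= dl by rewrite ler_norml; clear -p1 p2; lra.
    have q3 : `|y - y0| <= dl by rewrite ler_norml; clear -q1 q2; lra.
    apply: (le_lt_trans (lerD p3 q3)); clear -dld dl00; lra.
  move=> H2; have -> : f (pt x y) = (f (pt x y) - f (pt x0 y0)) + f (pt x0 y0).
    by rewrite subrK.
  by rewrite (le_trans (cnormD _ _))// /M addrC lerD2l ltW.
rewrite (_ : 4 * M * _ = dl * (16 * M)); last by ring.
by rewrite -ler_pdivlMr// mulr_gt0.
Qed.

(** [p] is the real or the imaginary part, which is linear over the reals only; hence the scalars
    [k%:C]. *)
Lemma is_derive_path (p : R[i] -> R) f (z v l : R[i]) (t : R) :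
  (forall x y, p (x + y) = p x + p y) -> (forall x y, p (x - y) = p x - p y) ->
  (forall (k : R) x, p (x * k%:C%C) = p x * k) ->
  (forall x, `|p x| <= cnorm x) ->
  (forall e : R, 0 < e -> exists2 dl : R, 0 < dl &
   forall h, cnorm h < dl ->
   cnorm (f (z + t%:C%C * v + h) - f (z + t%:C%C * v) - l * h) <= e * cnorm h) ->
  is_derive t 1 (fun u : R => p (f (z + u%:C%C * v))) (p (l * v)).
Proof.
move=> pD pB pZ p1 H; apply: is_derive_norm => e e0.
have v1 : 0 < cnorm v + 1 by rewrite ltr_wpDl// cnorm_ge0.
have [dl dl0 h1] := H _ (divr_gt0 e0 v1).
exists (dl / (cnorm v + 1)); first exact: divr_gt0.
move=> h hd; rewrite -pZ -!pB; apply: (le_trans (p1 _)).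
have -> : z + (t + h)%:C%C * v = z + t%:C%C * v + h%:C%C * v.
  by rewrite rmorphD/=; ring.
have := h1 (h%:C%C * v); rewrite cnormM cnormR.
have -> : l * v * h%:C%C = l * (h%:C%C * v) by ring.
have hv : `|h| * cnorm v <= `|h| * (cnorm v + 1) by rewrite ler_wpM2l// lerDl.
move=> h2; apply: (le_trans (h2 _)).
  by apply: (le_lt_trans hv); rewrite -ltr_pdivlMr.
rewrite -mulrA ler_pM2l// mulrC ler_pdivrMr//.
Qed.

Lemma cint_FTC f f' (z v : R[i]) a b : a < b ->
  (forall t, a <= t <= b -> {for (z + t%:C%C * v : K), continuous f'}) ->
  (forall t, a <= t <= b -> is_derive (z + t%:C%C * v : K) (1 : K) f (f' (z + t%:C%C * v))) ->
  cint a b (fun t => f' (z + t%:C%C * v) * v) = f (z + b%:C%C * v) - f (z + a%:C%C * v).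
Proof.
move=> ab f'c fd.
have H t (tab : a <= t <= b) := cderivP (fd t tab).
have D (p : R[i] -> R) : (forall x y, p (x + y) = p x + p y) -> (forall x y, p (x - y) = p x - p y) ->
  (forall (k : R) x, p (x * k%:C%C) = p x * k) ->
  (forall x, `|p x| <= cnorm x) ->
  (forall a b (g : R -> R[i]), cintble a b g -> mu.-integrable `[a, b] (EFin \o (p \o g))) ->
  \int[mu]_(t in `[a, b]) p (f' (z + t%:C%C * v) * v) =
    p (f (z + b%:C%C * v)) - p (f (z + a%:C%C * v)).
  move=> pD pB pZ p1 pint.
  have dp t : a <= t <= b ->
     is_derive t 1 (fun u : R => p (f (z + u%:C%C * v))) (p (f' (z + t%:C%C * v) * v)).
    by move=> tab; exact: (is_derive_path pD pB pZ p1 (H t tab)).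
  have pc t : a <= t <= b -> {for t, continuous (fun u : R => p (f (z + u%:C%C * v)))}.
    by move=> tab; apply: fderiv_cont; have [] := dp t tab.
  rewrite /Rintegral (continuous_FTC2 (F := fun u : R => p (f (z + u%:C%C * v))) ab) //.
  - apply: (@path_continuous R a b (fun w : K => f' w * v) z v p).
      by move=> x y; rewrite -pB.
    by move=> t tab; apply: (fcontM (f'c t tab)); exact: fcont_cst.
  - split.
    + move=> t; rewrite in_itv/= => /andP[at_ tb].
      have tab : a <= t <= b by rewrite (ltW at_) (ltW tb).
      by have [] := dp t tab.
    + by apply: cvg_at_right_filter; apply: pc; rewrite lexx ltW.
    + by apply: cvg_at_left_filter; apply: pc; rewrite lexx ltW.
  - move=> t; rewrite in_itv/= => /andP[at_ tb].
    have tab : a <= t <= b by rewrite (ltW at_) (ltW tb).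
    by have [_ <-] := dp t tab; rewrite derive1E.
apply/eqP; rewrite eq_complex /=; apply/andP; split; apply/eqP.
  rewrite D ?raddfB//.
  - by move=> x y; rewrite ReD.
  - by move=> x y; rewrite raddfB.
  - by move=> k x; rewrite ReM/= mulr0 subr0.
  - exact: cnorm_Re.
  - by move=> ? ? ? [].
rewrite D ?raddfB//.
- by move=> x y; rewrite ImD.
- by move=> x y; rewrite raddfB.
- by move=> k x; rewrite ImM/= mulr0 add0r.
- exact: cnorm_Im.
- by move=> ? ? ? [].
Qed.

End Cauchy.

(** * Power series of holomorphic functions *)

Section CauchySeries.
Variable R : realType.
Local Notation K := (R[i] : numClosedFieldType).
Local Notation mu := (@lebesgue_measure R).
Implicit Types (f g : K -> K) (a b c d : R).

Lemma is_derive_invX (F : numFieldType) (k : nat) (z : F) : z != 0 ->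
  is_derive z 1 (fun x : F => x ^- k) (- k%:R * z ^- k.+1).
Proof.
move=> z0.
have zk : ((fun x : F => x) ^+ k) z != 0 by rewrite exprfctE expf_neq0.
have h1 : is_derive z (1 : F) ((fun x : F => x) ^+ k) ((k%:R * z ^+ k.-1) *: 1).
  exact: is_deriveX.
have -> : (fun x : F => x ^- k) = (fun x : F => (((fun x : F => x) ^+ k) x)^-1).
  by apply/funext => x; rewrite exprfctE.
have [h2 h3] := h1.
apply: DeriveDef; first exact: derivableV.
rewrite deriveV// h3 exprfctE.
case: k {zk h1 h2 h3} => [|k].
  by rewrite mulr0n oppr0 !mul0r scale0r scaler0.
rewrite [_ *: 1]mulr1 [_ *: _]mulNr mulNr; congr (- _) => /=.
rewrite !exprS; have : z ^+ k != 0 by rewrite expf_neq0.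
by move: (z ^+ k) => u u0; rewrite expr0; field; rewrite z0 u0.
Qed.

Lemma bcont_bounded f a b c d : a <= b -> c <= d -> bcont f a b c d ->
  exists2 M, 0 <= M & forall x y, a <= x <= b -> c <= y <= d ->
    x = a \/ x = b \/ y = c \/ y = d -> cnorm (f (pt x y)) <= M.
Proof.
move=> ab cd fc.
have side (z v : R[i]) (p q : R) : p <= q ->
    (forall t, p <= t <= q -> {for (z + t%:C%C * v : K), continuous f}) ->
    exists2 M, 0 <= M & forall t, p <= t <= q -> cnorm (f (z + t%:C%C * v)) <= M.
  move=> pq h; have [m _ hm] := EVT_max pq (path_continuous (@cnorm_lip R) h).
  exists (cnorm (f (z + m%:C%C * v))); first exact: cnorm_ge0.
  by move=> t tpq; apply: hm; rewrite in_itv.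
have [|M1 M10 h1] := side (c%:C%C * 'i%C) 1 a b ab.
  by move=> t tab; rewrite -ptxE; apply: fc; rewrite ?lexx ?cd//; tauto.
have [|M2 M20 h2] := side (d%:C%C * 'i%C) 1 a b ab.
  by move=> t tab; rewrite -ptxE; apply: fc; rewrite ?lexx ?cd//; tauto.
have [|M3 M30 h3] := side a%:C%C 'i%C c d cd.
  by move=> t tab; rewrite -ptE; apply: fc; rewrite ?lexx ?ab//; tauto.
have [|M4 M40 h4] := side b%:C%C 'i%C c d cd.
  by move=> t tab; rewrite -ptE; apply: fc; rewrite ?lexx ?ab//; tauto.
exists (M1 + M2 + M3 + M4); first by rewrite !addr_ge0.
move=> x y hx hy [->|[->|[->|->]]].
- by have := h3 y hy; rewrite -ptE; move: M10 M20 M40; clear; lra.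
- by have := h4 y hy; rewrite -ptE; move: M10 M20 M30; clear; lra.
- by have := h1 x hx; rewrite -ptxE; move: M20 M30 M40; clear; lra.
- by have := h2 x hx; rewrite -ptxE; move: M10 M30 M40; clear; lra.
Qed.

(** Each side contributes a difference of values of f at two corners, and these cancel around the
    rectangle. The primitive lives on the boundary alone, so f' may have a pole inside. *)
Lemma rint_primitive f f' a b c d : a < b -> c < d -> bcont f' a b c d ->
  (forall x y, a <= x <= b -> c <= y <= d ->
    x = a \/ x = b \/ y = c \/ y = d ->
    is_derive (pt x y : K) (1 : K) f (f' (pt x y))) ->
  rint f' a b c d = 0.
Proof.
move=> ab cd fc fd; have [i1 i2 i3 i4] := bcont_int (ltW ab) (ltW cd) fc.
have h y : c <= y <= d -> y = c \/ y = d ->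
    cint a b (fun x => f' (pt x y)) = f (pt b y) - f (pt a y).
  move=> yd ycd; rewrite !ptxE.
  have h1 t : a <= t <= b -> {for (y%:C%C * 'i%C + t%:C%C * 1 : K), continuous f'}.
    by move=> tab; rewrite -ptxE; apply: fc => //; tauto.
  have h2 t : a <= t <= b -> is_derive (y%:C%C * 'i%C + t%:C%C * 1 : K) (1 : K) f
      (f' (y%:C%C * 'i%C + t%:C%C * 1)).
    by move=> tab; rewrite -ptxE; apply: fd => //; tauto.
  have <- := cint_FTC ab h1 h2.
  by apply: eq_cint => t _; rewrite [RHS]mulr1 ptxE.
have v x : a <= x <= b -> x = a \/ x = b -> cintble c d (fun y => f' (pt x y)) ->
    'i%C * cint c d (fun y => f' (pt x y)) = f (pt x d) - f (pt x c).
  move=> xb xab ii; rewrite -cintZ// !ptE.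
  have h1 t : c <= t <= d -> {for (x%:C%C + t%:C%C * 'i%C : K), continuous f'}.
    by move=> tab; rewrite -ptE; apply: fc => //; tauto.
  have h2 t : c <= t <= d -> is_derive (x%:C%C + t%:C%C * 'i%C : K) (1 : K) f
      (f' (x%:C%C + t%:C%C * 'i%C)).
    by move=> tab; rewrite -ptE; apply: fd => //; tauto.
  have <- := cint_FTC cd h1 h2.
  by apply: eq_cint => t _; rewrite [LHS]mulrC ptE.
rewrite /rint mulrBr.
rewrite (h c) ?(h d) ?(v a) ?(v b) ?lexx ?(ltW ab) ?(ltW cd)//; try tauto.
ring.
Qed.

Definition osq f (r : R) := rint f (- r) r (- r) r.

Lemma osq_norm (r x y : R) : 0 < r -> - r <= x <= r -> - r <= y <= r ->
  x = - r \/ x = r \/ y = - r \/ y = r -> r <= cnorm (pt x y).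
Proof.
move=> r0 _ _ H.
have hx : x = - r \/ x = r -> r <= cnorm (pt x y).
  move=> h; apply: (le_trans _ (cnorm_Re _)) => /=.
  by case: h => ->; rewrite ?normrN gtr0_norm.
have hy : y = - r \/ y = r -> r <= cnorm (pt x y).
  move=> h; apply: (le_trans _ (cnorm_Im _)) => /=.
  by case: h => ->; rewrite ?normrN gtr0_norm.
by tauto.
Qed.

Lemma osq_neq (r x y : R) (w : R[i]) : 0 < r -> cnorm w < r ->
  - r <= x <= r -> - r <= y <= r ->
  x = - r \/ x = r \/ y = - r \/ y = r -> pt x y - w != 0.
Proof.
move=> r0 wr hx hy h; rewrite subr_eq0; apply/eqP => e.
by have := osq_norm r0 hx hy h; rewrite e leNgt wr.
Qed.

Lemma bcont_inv (r : R) (w : R[i]) : 0 < r -> cnorm w < r ->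
  bcont (fun z => (z - w)^-1) (- r) r (- r) r.
Proof.
move=> r0 wr x y hx hy h; apply: fcontV; first exact: osq_neq h.
by apply: fcontB; [exact: fcont_id|exact: fcont_cst].
Qed.

Lemma bcont_invX (r : R) n : 0 < r ->
  bcont (fun z => z ^- n) (- r) r (- r) r.
Proof.
move=> r0 x y hx hy h.
have z0 : (pt x y : K) != 0.
  have := @osq_neq r x y 0 r0; rewrite cnorm0 subr0; exact.
have : derivable (fun z : K => z ^- n) (pt x y) 1.
  by have [] := is_derive_invX n z0.
exact: fderiv_cont.
Qed.

Arguments bcont_inv {r} w.
Arguments bcont_invX {r} n.

(** For exponents from 2 on, z^-(k+1) is a primitive up to the factor -(k+1); the exponent 1 is the
    exception treated next. *)
Lemma osq_invX (r : R) k : 0 < r -> osq (fun z => z ^- k.+2) r = 0.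
Proof.
move=> r0; have rr : - r < r by clear -r0; lra.
have k0 : (- k.+1%:R : K) != 0 by rewrite oppr_eq0 pnatr_eq0.
have /eqP : osq (fun z => - k.+1%:R * z ^- k.+2) r = 0.
  apply: (@rint_primitive (fun z => z ^- k.+1)) => //.
    exact: bcontM (@bcont_cst R _ _ _ _ _) (bcont_invX _ r0).
  move=> x y hx hy h; apply: is_derive_invX.
  have := @osq_neq r x y 0 r0; rewrite cnorm0 subr0; exact.
rewrite /osq brintZ ?ltW//; last exact: bcont_invX.
by rewrite mulf_eq0 (negbTE k0)/= => /eqP.
Qed.

(** The value is 2 pi i, but it only serves as a normalising constant. Pairing opposite sides gives
    twice i times the integral of 2 r / (t^2 + r^2), whose integrand is at least 1 / r on the
    side. *)
Lemma osq_inv_neq0 (r : R) : 0 < r -> osq (fun z => z ^- 1) r != 0.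
Proof.
move=> r0; have rr : - r <= r by clear -r0; lra.
have [i1 i2 i3 i4] := bcont_int rr rr (bcont_invX 1 r0).
pose h (t : R) : R := 2 * r / (t ^+ 2 + r ^+ 2).
have h0 (t : R) : t ^+ 2 + r ^+ 2 != 0.
  by rewrite gt_eqF// ltr_wpDl ?sqr_ge0// exprn_gt0.
have E (z : R[i]) : z ^- 1 = z^-1 by rewrite expr1.
have e1 : cint (- r) r (fun x => (pt x (- r)) ^- 1) -
   cint (- r) r (fun x => (pt x r) ^- 1) = cint (- r) r (fun x => 'i%C * (h x)%:C%C).
  rewrite -cintB//; apply: eq_cint => t _; rewrite !E.
  apply/eqP; rewrite eq_complex /= /h; apply/andP; split; apply/eqP.
    by field; do ?[apply/andP; split]; first [exact: h0|rewrite addrC; exact: h0].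
  by field; do ?[apply/andP; split]; first [exact: h0|rewrite addrC; exact: h0].
have e2 : cint (- r) r (fun y => (pt r y) ^- 1) -
   cint (- r) r (fun y => (pt (- r) y) ^- 1) = cint (- r) r (fun x => (h x)%:C%C).
  rewrite -cintB//; apply: eq_cint => t _; rewrite !E.
  apply/eqP; rewrite eq_complex /= /h; apply/andP; split; apply/eqP.
    by field; do ?[apply/andP; split]; first [exact: h0|rewrite addrC; exact: h0].
  by rewrite sqrrN subrr.
rewrite /osq /rint e1 e2.
have ih : cintble (- r) r (fun x => (h x)%:C%C).
  have := cintbleD i4 (cintbleZ (-1) i3); rewrite /cintble; set u := fun t => _ + _.
  suff -> : u = (fun x => (h x)%:C%C) by [].
  apply/funext => t; rewrite /u !E.
  apply/eqP; rewrite eq_complex /= /h; apply/andP; split; apply/eqP.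
    by field; do ?[apply/andP; split]; first [exact: h0|rewrite addrC; exact: h0].
  by rewrite sqrrN oppr0 mul0r addr0 mulN1r opprK addNr.
rewrite cintZ// -mulrDl mulf_neq0//.
  by rewrite eq_complex /= addr0 eqxx/= -[1 + 1]/(2%:R) pnatr_eq0.
rewrite eq_complex negb_and; apply/orP; left => /=; rewrite gt_eqF//.
apply: (@lt_le_trans _ _ (\int[mu]_(t in `[- r, r]) r^-1)).
  rewrite Rintegral_cst//= fine_mu_itv//; apply: mulr_gt0; first by rewrite invr_gt0.
  by rewrite opprK addr_gt0.
apply: le_Rintegral => //; [exact: itv_integrable_cst|by have [] := ih|].
move=> t; rewrite /= in_itv/= => /andP[t1 t2].
rewrite /h -div1r ler_pdivlMr//; last by rewrite ltr_wpDl ?sqr_ge0// exprn_gt0.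
rewrite mulrAC mul1r ler_pdivrMr// -[2 * r * r]mulrA -expr2 mulr_natl mulr2n lerD2r.
by rewrite -subr_ge0 subr_sqr mulr_ge0//; move: t1 t2; clear; lra.
Qed.

Lemma geom_inv (z w : R[i]) n : z != 0 -> z - w != 0 ->
  (z - w)^-1 = \sum_(k < n) w ^+ k * z ^- k.+1 + w ^+ n * (z ^- n * (z - w)^-1).
Proof.
move=> z0 zw; elim: n => [|n IH].
  by rewrite big_ord0 expr0 invr1 !mul1r add0r.
rewrite {1}IH big_ord_recr/= -addrA; congr (_ + _).
rewrite !exprS; have : z ^+ n != 0 by rewrite expf_neq0.
move: (z ^+ n) (w ^+ n) => u v u0; field.
by rewrite zw z0 u0.
Qed.

Lemma osq_series g (r : R) (w : R[i]) : 0 < r -> cnorm w < r / 2 ->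
  bcont g (- r) r (- r) r ->
  series (fun k => osq (fun z => z ^- k.+1 * g z) r * w ^+ k : K) @ \oo -->
    (osq (fun z => (z - w)^-1 * g z) r : K).
Proof.
move=> r0 wr2 gc.
have wr : cnorm w < r by apply: (lt_trans wr2); clear -r0; lra.
have rr : - r <= r by clear -r0; lra.
have [M M0 gM] := bcont_bounded rr rr gc.
have iz n := bcont_invX n r0.
have iw := bcont_inv w r0 wr.
have key n : osq (fun z => (z - w)^-1 * g z) r =
    series (fun k => osq (fun z => z ^- k.+1 * g z) r * w ^+ k) n +
    w ^+ n * osq (fun z => z ^- n * ((z - w)^-1 * g z)) r.
  have c1 k : bcont (fun z => w ^+ k * (z ^- k.+1 * g z)) (- r) r (- r) r.
    exact: bcontM (@bcont_cst R _ _ _ _ _) (bcontM (iz _) gc).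
  have c2 : bcont (fun z => z ^- n * ((z - w)^-1 * g z)) (- r) r (- r) r.
    exact: bcontM (iz n) (bcontM iw gc).
  rewrite /osq -(brintZ _ rr rr c2) /series /= big_mkord.
  rewrite (eq_bigr (fun k : 'I_n => rint (fun z => w ^+ k * (z ^- k.+1 * g z)) (- r) r (- r) r)); last first.
    by move=> k _; rewrite (brintZ _ rr rr (bcontM (iz k.+1) gc)) mulrC.
  rewrite -(brint_sum n rr rr c1).
  have c3 : bcont (fun z => \sum_(k < n) w ^+ k * (z ^- k.+1 * g z)) (- r) r (- r) r.
    exact: (@bcont_sum R (fun k z => w ^+ k * (z ^- k.+1 * g z)) n _ _ _ _ c1).
  rewrite -(brintD rr rr c3 (bcontM (@bcont_cst R _ _ _ _ _) c2)).
  apply: eq_rint => // x y hx hy h.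
  have n0 : pt x y != 0.
    have := @osq_neq r x y 0 r0; rewrite cnorm0 subr0; exact.
  rewrite {1}(@geom_inv (pt x y) w n n0 (osq_neq r0 wr hx hy h)).
  rewrite mulrDl mulr_suml !mulrA; congr (_ + _).
  by apply: eq_bigr => k _; rewrite mulrA.
pose C := 4 * (2 / r * M) * ((r - - r) + (r - - r)).
have C0 : 0 <= C.
  rewrite /C; apply: mulr_ge0; last by clear -r0; lra.
  by rewrite !mulr_ge0// invr_ge0 ltW.
have rem n : cnorm (osq (fun z => (z - w)^-1 * g z) r -
   series (fun k => osq (fun z => z ^- k.+1 * g z) r * w ^+ k) n) <= C * (2^-1) ^+ n.
  rewrite {1}(key n) addrAC subrr add0r cnormM cnormX.
  have c2 : bcont (fun z => z ^- n * ((z - w)^-1 * g z)) (- r) r (- r) r.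
    exact: bcontM (iz n) (bcontM iw gc).
  have : cnorm (osq (fun z => z ^- n * ((z - w)^-1 * g z)) r) <=
     4 * (r^-1 ^+ n * (2 / r * M)) * ((r - - r) + (r - - r)).
    apply: brint_bound => // x y hx hy h.
    have n1 := osq_norm r0 hx hy h.
    have n1' := lt_le_trans r0 n1.
    rewrite !cnormM !cnormV cnormX -exprVn; apply: ler_pM.
    - by rewrite exprn_ge0// invr_ge0 cnorm_ge0.
    - by rewrite mulr_ge0 ?invr_ge0 ?cnorm_ge0.
    - by apply: lerXn2r; rewrite ?nnegrE ?invr_ge0 ?cnorm_ge0 ?(ltW r0)// lef_pV2.
    apply: ler_pM; rewrite ?invr_ge0 ?cnorm_ge0//; last exact: gM.
    rewrite -[2 / r]invf_div lef_pV2 ?posrE ?divr_gt0//; last first.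
      by rewrite cnorm_gt0; exact: osq_neq h.
    have : cnorm (pt x y) <= cnorm (pt x y - w) + cnorm w.
      by rewrite -{1}(subrK w (pt x y)) cnormD.
    by move: n1 wr2; clear; lra.
  move=> h; apply: (@le_trans _ _ (cnorm w ^+ n * (4 * (r^-1 ^+ n * (2 / r * M)) * (r - - r + (r - - r))))).
    by rewrite ler_wpM2l// exprn_ge0// cnorm_ge0.
  have -> : cnorm w ^+ n * (4 * (r^-1 ^+ n * (2 / r * M)) * (r - - r + (r - - r))) = C * (cnorm w / r) ^+ n.
    by rewrite exprMn /C; ring.
  rewrite ler_wpM2l//; apply: lerXn2r; rewrite ?nnegrE ?invr_ge0 ?divr_ge0 ?cnorm_ge0 ?(ltW r0)//.
  by rewrite ler_pdivrMr// mulrC ltW.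
apply/ccvgnP => e e0.
have : (C * (2^-1) ^+ n) @[n --> \oo] --> (0 : R).
  rewrite -(mulr0 C); apply: cvgM; first exact: cvg_cst.
  by apply: cvg_expr; rewrite ger0_norm// invf_lt1// ltr1n.
move=> /cvgn_normP/(_ e e0)[N hN]; exists N => n Nn; rewrite cnormC.
apply: (le_lt_trans (rem n)); have := hN n Nn; rewrite subr0.
by apply: le_lt_trans; exact: ler_norm.
Qed.

(** Cauchy's formula, normalised by the integral [e0] of 1 / z. The difference quotient [Q] of g at
    w, completed by the derivative, is continuous at w and differentiable elsewhere, so its integral
    vanishes; hence the Cauchy integral of g is g(w) times that of 1. *)
Lemma cauchy_series g (r : R) : 0 < r ->
  (forall x y, - r <= x <= r -> - r <= y <= r -> derivable g (pt x y : K) 1) ->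
  exists A : nat -> R[i], forall w, cnorm w < r / 2 ->
    series (fun k => A k * w ^+ k : K) @ \oo --> (g w : K).
Proof.
move=> r0 gd.
have rr : - r <= r by clear -r0; lra.
have gc : bcont g (- r) r (- r) r by apply: rcont_bcont; exact: rderiv_cont.
pose e0 := osq (fun z => z ^- 1) r.
have e00 : e0 != 0 by exact: osq_inv_neq0.
exists (fun k => e0^-1 * osq (fun z => z ^- k.+1 * g z) r) => w wr2.
have wr : cnorm w < r by apply: (lt_trans wr2); clear -r0; lra.
have S1 := osq_series r0 wr2 gc.
have iw := bcont_inv w r0 wr.
(* Expanding the kernel against the constant 1, every term but the first vanishes by [osq_invX]; the
   integral is therefore independent of w. *)
have E1 : osq (fun z => (z - w)^-1 * 1) r = e0.
  have := osq_series r0 wr2 (@bcont_cst R 1 _ _ _ _).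
  move/ccvgnP => H; apply/eqP; rewrite -subr_eq0 -cnorm_eq0 eq_le cnorm_ge0 andbT.
  apply/ler_addgt0Pr => e eps0; rewrite add0r.
  have [N hN] := H e eps0; have := hN N.+1 (leqnSn N).
  rewrite cnormC => /ltW; congr (_ <= _); congr (cnorm (_ - _)).
  rewrite /series /= big_nat_recl//= expr0 mulr1 big1 ?addr0.
    by rewrite /e0 /osq; apply: eq_rint => // x y *; rewrite mulr1.
  move=> k _; rewrite (_ : osq _ _ = 0) ?mul0r//.
  rewrite -(osq_invX k r0); apply: eq_rint => // x y *; exact: mulr1.
have [x0 y0 ew] : exists2 x0, True & exists y0, w = pt x0 y0.
  by case: w {wr2 wr S1 iw E1} => a b; exists a => //; exists b.
have [y0' ew'] := ew.
have hx0 : - r < x0 < r.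
  by rewrite -ltr_norml; apply: le_lt_trans wr; rewrite ew'; exact: (cnorm_Re (pt x0 y0')).
have hy0 : - r < y0' < r.
  by rewrite -ltr_norml; apply: le_lt_trans wr; rewrite ew'; exact: (cnorm_Im (pt x0 y0')).
have gw : derivable g (w : K) 1.
  by rewrite ew'; apply: gd; [move: hx0|move: hy0] => /andP[/ltW-> /ltW->].
pose d := 'D_1 g (w : K).
have hd := cderivP (derivableP gw : is_derive (w : K) 1 g d).
pose Q : K -> K := (fun z : K => if z == w then d else (g z - g w) * (z - w)^-1).
have Qd x y : - r <= x <= r -> - r <= y <= r -> pt x y != w -> derivable Q (pt x y : K) 1.
  move=> hx hy zw.
  apply: (@near_eq_derivable _ (fun z => (g z - g w) * (z - w)^-1)).
    apply/near_complexP; exists (cnorm (pt x y - w)).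
      by rewrite cnorm_gt0 subr_eq0.
    move=> z hz; rewrite /Q; case: eqP => // zw'.
    by move: hz; rewrite zw' cnormC ltxx.
  apply: fderivM.
    by apply: fderivB; [exact: gd|exact: fderiv_cst].
  apply: fderivV; first by rewrite subr_eq0.
  by apply: fderivB; [exact: fderiv_id|exact: fderiv_cst].
have Qw : {for (w : K), continuous Q}.
  apply: fcont_near => e /gt0_complex[e' e'0 ->].
  have e2 : 0 < e' / 2 by rewrite divr_gt0.
  have [dl dl0 h1] := hd _ e2.
  apply/near_complexP; exists dl => // z hz.
  rewrite cnorm_lt /Q eqxx; case: eqP => [_|/eqP zw]; first by rewrite subrr cnorm0.
  have zw0 : z - w != 0 by rewrite subr_eq0.
  have := h1 _ hz; rewrite [w + _]addrC subrK => h2.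
  rewrite cnormC -(ltr_pM2r (_ : 0 < cnorm (z - w))) ?cnorm_gt0// -cnormM mulrBl mulfVK//.
  apply: (le_lt_trans h2); rewrite ltr_pM2r ?cnorm_gt0//; clear -e'0; lra.
have Qc : rcont Q (- r) r (- r) r.
  move=> x y hx hy; have [e|zw] := eqVneq (pt x y) w; first by rewrite e.
  by apply: fderiv_cont; exact: Qd.
have Q0 : osq Q r = 0.
  apply: (goursat_removable hx0 hy0 Qc) => x y hx hy; rewrite -ew'; exact: Qd.
have E2 : osq (fun z => (z - w)^-1 * g z) r = g w * e0.
  apply/eqP; rewrite -subr_eq0; apply/eqP; rewrite -[RHS]Q0.
  have c1 : bcont (fun z => (z - w)^-1 * g z) (- r) r (- r) r by exact: bcontM.
  have c2 : bcont (fun z => (z - w)^-1 * 1) (- r) r (- r) r.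
    exact: bcontM iw (@bcont_cst R _ _ _ _ _).
  rewrite -E1 -mulNr /osq -(brintZ _ rr rr c2).
  rewrite -(brintD rr rr c1 (bcontM (@bcont_cst R _ _ _ _ _) c2)).
  apply: eq_rint => // x y hx hy h; rewrite /Q.
  have := osq_neq r0 wr hx hy h; rewrite subr_eq0 => /negbTE->.
  by rewrite mulr1 mulrBl mulNr mulrC.
apply/ccvgnP => e eps0.
have e1 : 0 < cnorm e0 by rewrite cnorm_gt0.
have /ccvgnP/(_ (e * cnorm e0))[|N hN] := S1; first exact: mulr_gt0.
exists N => n Nn; rewrite -(ltr_pM2r e1) -cnormM.
have := hN n Nn; rewrite E2; congr (cnorm _ < _).
rewrite mulrBl; congr (_ - _).
rewrite /series /= mulr_suml; apply: eq_bigr => k _.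
by rewrite [RHS]mulrC !mulrA mulfV// mul1r.
Qed.

Theorem holo_pseries g (c : K) : holomorphic_at g c ->
  exists A : nat -> R[i], \forall z \near c,
    series (fun k => A k * (z - c) ^+ k : K) @ \oo --> (g z : K).
Proof.
move=> /near_complexP[e e0 H].
(* A point of the square of half side r has modulus at most 2 r, which is less than e. *)
pose r := e / 4.
have r0 : 0 < r by exact: divr_gt0.
have [A hA] : exists A : nat -> R[i], forall w, cnorm w < r / 2 ->
    series (fun k => A k * w ^+ k : K) @ \oo --> (g (c + w) : K).
  apply: (@cauchy_series (fun w => g (c + w)) r r0) => x y hx hy.
  apply: derivable_shift; apply: H; rewrite addrAC subrr add0r.
  apply: (le_lt_trans (cnorm_pt _ _)).
  apply: (@le_lt_trans _ _ (r + r)); first by rewrite lerD// ler_norml.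
  by rewrite /r; clear -e0; lra.
exists A; apply/near_complexP; exists (r / 2); first exact: divr_gt0.
by move=> z hz; have := hA _ hz; rewrite [c + _]addrC subrK.
Qed.

End CauchySeries.

(** * Germs on the real axis *)

Section Germs.
Variable R : realType.
Local Notation K := (R[i] : numClosedFieldType).
Implicit Types (A B : nat -> R[i]) (phi : R -> R[i]).

Definition psum A (h : R) (l : R[i]) : Prop := forall e : R, 0 < e ->
  exists N, forall n, (N <= n)%N ->
    cnorm (\sum_(k < n) A k * h%:C%C ^+ k - l) < e.

Lemma psum_cvg A h l :
  (series (fun k => A k * h%:C%C ^+ k : K) @ \oo --> (l : K)) <-> psum A h l.
Proof.
apply: (iff_trans (ccvgnP _ _)).
by split=> H e /H[N hN]; exists N => n /hN; rewrite /series /= big_mkord.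
Qed.

Lemma psumP A h l : psum A h l <-> forall e : R, 0 < e ->
  exists N, forall n, (N <= n)%N ->
    cnorm (\sum_(k < n) A k * h%:C%C ^+ k - l) < e.
Proof. by []. Qed.

Lemma psumD A B h l m : psum A h l -> psum B h m ->
  psum (fun k => A k + B k) h (l + m).
Proof.
move=> /psumP hA /psumP hB; apply/psumP => e e0.
have e2 : 0 < e / 2 by rewrite divr_gt0.
have [N1 h1] := hA _ e2; have [N2 h2] := hB _ e2.
exists (maxn N1 N2) => n; rewrite geq_max => /andP[/h1 k1 /h2 k2].
under eq_bigr do rewrite mulrDl.
rewrite big_split/= opprD addrACA (le_lt_trans (cnormD _ _))//.
by rewrite (splitr e) ltrD.
Qed.

(** Multiplication of the power series by its variable. *)
Definition cshift A (k : nat) : R[i] := if k is j.+1 then A j else 0.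

Lemma psum0 h : psum (fun=> 0) h 0.
Proof.
apply/psumP => e e0; exists 0%N => n _.
by rewrite big1 ?subrr ?cnorm0// => k _; rewrite mul0r.
Qed.

Lemma psumZ (c : R[i]) A h l : psum A h l -> psum (fun k => c * A k) h (c * l).
Proof.
move=> /psumP hA; apply/psumP => e e0.
have c1 : 0 < cnorm c + 1 by rewrite ltr_wpDl// cnorm_ge0.
have [N h1] := hA _ (divr_gt0 e0 c1); exists N => n /h1 k1.
under eq_bigr do rewrite -mulrA.
rewrite -mulr_sumr -mulrBr cnormM.
move: k1; rewrite ltr_pdivlMr//; apply: le_lt_trans.
by rewrite mulrC ler_wpM2l ?cnorm_ge0// lerDl.
Qed.
Arguments psumZ c {A h l}.

Lemma psum_shift A h l : psum A h l -> psum (cshift A) h (h%:C%C * l).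
Proof.
move=> /(psumZ h%:C%C)/psumP H; apply/psumP => e /H[N hN].
exists N.+1 => -[//|n]; rewrite ltnS => /hN; congr (cnorm (_ - _) < _).
rewrite big_ord_recl/= mul0r add0r; apply: eq_bigr => k _.
by rewrite /bump/= add1n exprS mulrCA mulrA.
Qed.

Lemma psum_unique A h l m : psum A h l -> psum A h m -> l = m.
Proof. by move=> /psum_cvg h1 /psum_cvg h2; exact: (cvg_unique _ h1 h2). Qed.

Lemma psum_bounded A h l : psum A h l ->
  exists2 M, 0 <= M & forall k, cnorm (A k) * `|h| ^+ k <= M.
Proof.
move=> /psumP/(_ 1 ltr01)[N hN].
have t k : (N <= k)%N -> cnorm (A k) * `|h| ^+ k <= 2.
  move=> Nk; have := hN _ (leqW Nk); rewrite big_ord_recr/=.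
  have := hN _ Nk; move: (\sum_(i < k) _) => S h1 h2.
  rewrite -cnormR -cnormX -cnormM.
  have -> : A k * h%:C%C ^+ k = (S + A k * h%:C%C ^+ k - l) - (S - l) by ring.
  apply: (le_trans (cnormB _ _)); move: h1 h2; clear; lra.
exists (2 + \sum_(k < N) cnorm (A k) * `|h| ^+ k).
  by rewrite addr_ge0// sumr_ge0// => k _; rewrite mulr_ge0 ?cnorm_ge0// exprn_ge0.
move=> k; have [/t|kN] := leqP N k.
  move=> /le_trans; apply; rewrite lerDl sumr_ge0// => j _.
  by rewrite mulr_ge0 ?cnorm_ge0// exprn_ge0.
rewrite (bigD1 (Ordinal kN))//= addrCA lerDl addr_ge0// sumr_ge0// => j _.
by rewrite mulr_ge0 ?cnorm_ge0// exprn_ge0.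
Qed.

(** The identity theorem, by strong induction. When the coefficients before [A k] vanish, every zero
    h yields |A k| <= C h, and the zeros h tend to 0. *)
Lemma psum_zero A (e : R) : 0 < e ->
  (forall h, 0 < h -> h < e -> exists l, psum A h l) ->
  (forall d, 0 < d -> exists2 h, 0 < h < d & psum A h 0) ->
  forall k, A k = 0.
Proof.
move=> e0 cA zA.
have e20 : 0 < e / 2 by rewrite divr_gt0.
have [|l cl] := cA _ e20; first by rewrite gtr_pMr// invf_lt1// ltr1n.
have [M M0 hM] := psum_bounded cl; rewrite (gtr0_norm e20) in hM.
set r := e / 2 in e20 hM.
elim/ltn_ind => k IH.
apply/eqP; rewrite -cnorm_eq0 eq_le cnorm_ge0 andbT.
apply/ler_addgt0Pr => d d0; rewrite add0r.
(* For h <= r / 2 the tail after [A k] is at most M (h / r)^(k+1) times the geometric series of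
   ratio 1/2, whose sum is 2. *)
pose C := 2 * M * r^-1 ^+ k.+1.
have C0 : 0 <= C by rewrite !mulr_ge0// exprn_ge0// invr_ge0 ltW.
have d1 : 0 < Num.min (r / 2) (d / (C + 1)).
  by rewrite lt_min !divr_gt0// ltr_wpDl.
have [h /andP[h0]] := zA _ d1; rewrite lt_min => /andP[hr hd] /psumP hz.
have hk0 : 0 < h ^+ k by rewrite exprn_gt0.
have tail n : cnorm (\sum_(i < n) A (k.+1 + i)%N * h%:C%C ^+ (k.+1 + i)) <=
    C * h ^+ k.+1.
  have q1 : h / r <= 2^-1 by rewrite ler_pdivrMr// mulrC ltW.
  have q0 : 0 <= h / r by rewrite divr_ge0// ltW.
  have : cnorm (\sum_(i < n) A (k.+1 + i)%N * h%:C%C ^+ (k.+1 + i)) <=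
      \sum_(i < n) M * (h / r) ^+ k.+1 * 2^-1 ^+ i.
    elim: n => [|n IHn]; first by rewrite !big_ord0 cnorm0.
    rewrite !big_ord_recr/= (le_trans (cnormD _ _))// lerD//.
    rewrite cnormM cnormX cnormR (gtr0_norm h0).
    have -> : h ^+ (k.+1 + n) = r ^+ (k.+1 + n) * (h / r) ^+ (k.+1 + n).
      by rewrite -exprMn mulrCA mulfV ?mulr1// gt_eqF.
    rewrite mulrA -[leRHS]mulrA ler_pM ?mulr_ge0 ?exprn_ge0 ?cnorm_ge0 ?(ltW e20)//.
    by rewrite exprD ler_wpM2l ?exprn_ge0// lerXn2r// nnegrE.
  move=> /le_trans; apply; rewrite -mulr_sumr.
  have -> : C * h ^+ k.+1 = M * (h / r) ^+ k.+1 * 2.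
    by rewrite /C exprMn; ring.
  rewrite ler_wpM2l ?mulr_ge0 ?exprn_ge0//.
  have -> : \sum_(i < n) (2^-1 : R) ^+ i = 2 - 2 * 2^-1 ^+ n.
    elim: n => [|n IHn]; first by rewrite big_ord0 expr0; ring.
    by rewrite big_ord_recr/= IHn exprS; field.
  by rewrite lerBlDr lerDl mulr_ge0// exprn_ge0.
have main : cnorm (A k) * h ^+ k <= C * h ^+ k.+1.
  apply/ler_addgt0Pr => ep ep0; have [N hN] := hz _ ep0.
  have := hN (k.+1 + N)%N (leq_addl _ _).
  rewrite subr0 big_split_ord/= big_ord_recr/= big1 ?add0r; last first.
    by move=> i _; rewrite IH ?mul0r//.
  set S := \sum_(i < N) _ => hS.
  rewrite -{1}(gtr0_norm h0) -cnormR -cnormX -cnormM.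
  have -> : A k * h%:C%C ^+ k = (A k * h%:C%C ^+ k + S) - S by ring.
  rewrite (le_trans (cnormB _ _))// addrC lerD// ?(ltW hS)//.
  exact: tail.
move: main; rewrite exprS mulrA ler_pM2r// => /le_trans; apply.
have : C * h <= C * (d / (C + 1)) by rewrite ler_wpM2l// ltW.
move=> /le_trans; apply.
rewrite mulrCA ger_pMr// ler_pdivrMr ?mul1r ?lerDl//.
by rewrite ltr_wpDl.
Qed.

(* A Laurent expansion of phi at c, read on the real axis only: the pole has order
   at most m and A k is the coefficient of h^(k - m). *)
Definition rgerm phi (c : R) (m : nat) A := exists2 e : R, 0 < e &
  forall h, h != 0 -> `|h| < e -> psum A h (h%:C%C ^+ m * phi (c + h)).

Lemma rgermS phi c m A : rgerm phi c m A -> rgerm phi c m.+1 (cshift A).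
Proof.
move=> [e e0 H]; exists e => // h h0 he.
rewrite exprS -[h%:C%C * _ * _]mulrA; exact: (psum_shift (H h h0 he)).
Qed.

Lemma rgermSn phi c m n A : rgerm phi c m A ->
  rgerm phi c (n + m) (iter n cshift A).
Proof. by move=> H; elim: n => // n; exact: rgermS. Qed.

Lemma rgermD phi psi c m A B : rgerm phi c m A -> rgerm psi c m B ->
  rgerm (fun x => phi x + psi x) c m (fun k => A k + B k).
Proof.
move=> [e e0 H] [e' e'0 H']; exists (Num.min e e'); first by rewrite lt_min e0.
move=> h h0; rewrite lt_min => /andP[he he']; rewrite mulrDr.
by apply: psumD; [exact: H|exact: H'].
Qed.

(** The Cauchy product of a polynomial with a power series. *)
Definition pact (p : {poly R[i]}) A (k : nat) : R[i] :=
  \sum_(i < k.+1) p`_i * A (k - i)%N.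

Lemma pactD p q A : pact (p + q) A = (fun k => pact p A k + pact q A k).
Proof.
apply/funext => k; rewrite /pact -big_split/=; apply: eq_bigr => i _.
by rewrite coefD mulrDl.
Qed.

Lemma pactC a A : pact a%:P A = (fun k => a * A k).
Proof.
apply/funext => k; rewrite /pact big_ord_recl/= subn0 coefC/= big1 ?addr0// => i _.
by rewrite coefC mul0r.
Qed.

Lemma pactMX p A : pact (p * 'X) A = cshift (pact p A).
Proof.
apply/funext => -[|k]; rewrite /pact/=.
  by rewrite big_ord_recl big_ord0 coefMX mul0r addr0.
rewrite big_ord_recl coefMX mul0r add0r; apply: eq_bigr => i _.
by rewrite coefMX/= /bump/= add1n subSS.
Qed.

Lemma psum_pact p A h l : psum A h l -> psum (pact p A) h (p.[h%:C%C] * l).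
Proof.
move=> H; elim/poly_ind: p => [|p c IH].
  rewrite horner0 mul0r -(polyC0) pactC (_ : (fun _ => _) = (fun=> 0)).
    exact: psum0.
  by apply/funext => k; rewrite mul0r.
rewrite pactD pactMX pactC hornerMXaddC mulrDl; apply: psumD.
  by rewrite (mulrC _ h%:C%C) -mulrA; exact: psum_shift.
exact: psumZ.
Qed.

Lemma rgerm_pact (p : {poly R[i]}) phi c m A : rgerm phi c m A ->
  rgerm (fun x => p.[x%:C%C] * phi x) c m (pact (p \Po ('X + (c%:C%C)%:P)) A).
Proof.
move=> [e e0 H]; exists e => // h h0 he.
have := psum_pact (p \Po ('X + (c%:C%C)%:P)) (H h h0 he).
rewrite horner_comp hornerD hornerX hornerC.
by rewrite rmorphD/= [h%:C%C + _]addrC mulrCA.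
Qed.

(** The passage from the complex plane to the real axis: [holo_pseries] enters here, and afterwards
    the function is seen through real arguments. *)
Lemma meromorphic_rgerm (J : R[i] -> R[i]) (c : R) : meromorphic J ->
  exists m A, rgerm (fun x => J x%:C%C) c m A.
Proof.
move=> /(_ c%:C%C)[m [g [hg Jg]]].
have [A /near_complexP[e e0 hA]] := holo_pseries hg.
have /dnear_complexP[e' e'0 hJ] := Jg.
exists m, A, (Num.min e e'); first by rewrite lt_min e0.
move=> h h0; rewrite lt_min => /andP[he he'].
have E : (c + h)%:C%C - c%:C%C = h%:C%C by rewrite rmorphD/= addrAC subrr add0r.
have h0' : (h%:C%C : R[i]) != 0 by rewrite eq_complex negb_and h0.
have := hA (c + h)%:C%C; rewrite E cnormR => /(_ he).
move=> H; apply/psum_cvg; move: H; congr (_ --> _).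
rewrite hJ; last 2 first.
- by rewrite -subr_eq0 E.
- by rewrite E cnormR.
by rewrite E mulrC mulfVK// expf_neq0.
Qed.

(* A germ does not control the value at its centre. *)
Definition near_zero phi (c : R) := exists2 e : R, 0 < e &
  forall h, h != 0 -> `|h| < e -> phi (c + h) = 0.

Lemma rgerm_zero phi c m A : rgerm phi c m A ->
  (forall d, 0 < d -> exists2 h, 0 < h < d & phi (c + h) = 0) ->
  (forall k, A k = 0) /\ near_zero phi c.
Proof.
move=> [e e0 H] Z.
have A0 : forall k, A k = 0.
  apply: (psum_zero e0).
    move=> h h0 he; exists (h%:C%C ^+ m * phi (c + h)); apply: H.
      by rewrite gt_eqF.
    by rewrite gtr0_norm.
  move=> d d0; have [|h /andP[h0]] := Z (Num.min d e); first by rewrite lt_min d0.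
  rewrite lt_min => /andP[hd he] z; exists h; first by rewrite h0.
  by rewrite -[0](mulr0 (h%:C%C ^+ m)) -z; apply: H; rewrite ?gt_eqF// gtr0_norm.
split=> //; exists e => // h h0 he.
have h0' : (h%:C%C ^+ m : R[i]) != 0 by rewrite expf_neq0// eq_complex negb_and h0.
have : psum A h 0.
  by rewrite (_ : A = (fun=> 0)); [exact: psum0|apply/funext].
move=> /(psum_unique (H h h0 he))/eqP; rewrite mulf_eq0 (negbTE h0')/=.
by move=> /eqP.
Qed.

(** Continuation to the left. Let i be the infimum of the points at and after which phi is locally
    zero. Zeros accumulate at i from the right, so phi is locally zero at i by [rgerm_zero], hence
    also slightly before i, which is impossible unless i = c. *)
Lemma real_identity phi (X : R) : (forall c, exists m A, rgerm phi c m A) ->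
  (forall x, X < x -> phi x = 0) -> forall c, near_zero phi c.
Proof.
move=> G Z c.
(* The condition [c <= x] makes the set bounded below. *)
pose E := [set x | c <= x /\ forall y, x <= y -> near_zero phi y].
have nz y : X < y -> near_zero phi y.
  move=> Xy; exists (y - X); first by rewrite subr_gt0.
  move=> h _; rewrite ltr_norml => /andP[h1 h2]; apply: Z.
  by move: h1; clear; lra.
have E0 : E (Num.max c (X + 1)).
  split; first by rewrite le_max lexx.
  move=> y; rewrite ge_max => /andP[_ h]; apply: nz; apply: lt_le_trans h.
  by rewrite ltrDl.
have infE : has_inf E by split; [exists (Num.max c (X + 1))|exists c => x []].
pose i := inf E.
have ci : c <= i by apply: lb_le_inf; [case: infE|move=> x []].
have gti y : i < y -> near_zero phi y.
  by move=> /(inf_lt infE.1)[x [_ hx] xy]; apply: hx; exact: ltW.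
have nzi : near_zero phi i.
  have [m [A hA]] := G i; apply: (rgerm_zero hA _).2 => d d0.
  have [|e e0 he] := gti (i + d / 2); first by rewrite ltrDl divr_gt0.
  (* A germ says nothing about its centre i + d / 2, so the zero is taken slightly to the right of
     it, still before i + d. *)
  pose h := Num.min (e / 2) (d / 4).
  have h0 : 0 < h by rewrite lt_min !divr_gt0.
  have [h1 h2] : h <= e / 2 /\ h <= d / 4 by rewrite !ge_min !lexx orbT.
  exists (d / 2 + h).
    by move: h0 h1 h2 d0; clear; move=> *; apply/andP; split; lra.
  rewrite addrA; apply: he; first by rewrite gt_eqF.
  by rewrite gtr0_norm//; move: h1 e0; clear; lra.
have [e e0 he] := nzi.
have [ic|ci'] := leP i c.
  by have -> : c = i by apply/eqP; rewrite eq_le ci ic.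
exfalso; pose x := Num.max c (i - e / 2).
have xi : x < i by rewrite gt_max ci' gtrBl divr_gt0.
suff : E x by move=> /(ge_inf infE.2); rewrite leNgt xi.
split; first by rewrite le_max lexx.
move=> y; rewrite ge_max => /andP[_ yi].
have [iy|yi'|<-//] := ltgtP i y; first exact: gti.
exists (i - y); first by rewrite subr_gt0.
move=> h h0; rewrite ltr_norml => /andP[h1 h2].
have -> : y + h = i + (y + h - i) by ring.
apply: he; first by rewrite lt_eqF//; move: h2; clear; lra.
by rewrite ltr_norml; move: h1 h2 yi yi' e0; clear; move=> *; apply/andP; split; lra.
Qed.

End Germs.

(** * Descent of Laurent coefficients *)

Section Descent.
Variable R : realType.
Local Notation K := (R[i] : numClosedFieldType).
Implicit Types (A B : nat -> R[i]) (phi : R -> R[i]).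

Record qspace (V : R[i] -> Prop) : Prop := QSpace {
  qspace0 : V 0;
  qspaceD : forall x y, V x -> V y -> V (x + y);
  qspaceZ : forall (q : rat) x, V x -> V (ratr q * x) }.

Lemma qspace_sum V I (r : seq I) (P : pred I) (F : I -> R[i]) : qspace V ->
  (forall i, P i -> V (F i)) -> V (\sum_(i <- r | P i) F i).
Proof. by move=> Vq H; apply: big_ind => //; case: Vq. Qed.

Lemma qspaceN V x : qspace V -> V x -> V (- x).
Proof.
by move=> Vq Vx; have := qspaceZ Vq (-1) Vx; rewrite rmorphN1 mulN1r.
Qed.

Lemma iter_cshift A n k : iter n (@cshift R) A (n + k)%N = A k.
Proof. by elim: n => // n IH; rewrite addSn iterS. Qed.

Lemma iter_cshift_V V A n : qspace V -> (forall k, V (A k)) ->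
  forall k, V (iter n (@cshift R) A k).
Proof.
move=> Vq VA; elim: n => // n IH -[|k] /=; [exact: (qspace0 Vq)|exact: IH].
Qed.

Lemma psum_iter_cshift A h l n : psum A h l ->
  psum (iter n (@cshift R) A) h (h%:C%C ^+ n * l).
Proof.
move=> H; elim: n => [|n IH]; first by rewrite expr0 mul1r.
by rewrite exprS -mulrA; exact: psum_shift.
Qed.

Lemma psum_inj A B (e : R) : 0 < e ->
  (forall h, 0 < h -> h < e -> exists2 l, psum A h l & psum B h l) ->
  forall k, A k = B k.
Proof.
move=> e0 H k; apply/eqP; rewrite -subr_eq0; apply/eqP; move: k.
have D h l : psum A h l -> psum B h l -> psum (fun k => A k - B k) h 0.
  move=> h1 /(psumZ (-1)) h2; have := psumD h1 h2.
  rewrite mulN1r subrr; congr psum; apply/funext => k; by rewrite mulN1r.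
apply: (psum_zero e0).
  by move=> h h0 he; have [l h1 h2] := H h h0 he; exists 0; exact: D h1 h2.
move=> d d0; pose h := Num.min d e / 2.
have m0 : 0 < Num.min d e by rewrite lt_min d0.
have [hd he] : h < d /\ h < e.
  have : h < Num.min d e by rewrite gtr_pMr// invf_lt1// ltr1n.
  by rewrite lt_min => /andP[].
have h0 : 0 < h by rewrite divr_gt0.
exists h; first by rewrite h0.
by have [l h1 h2] := H h h0 he; exact: D h1 h2.
Qed.

(** Let e be the order of vanishing of [P 0] at the centre. The coefficient of index e + k of the
    relation is a nonzero rational times [A 0 k], plus rational multiples of earlier [A 0 i], plus
    elements of V; so [A 0] is solved for recursively inside V. *)
Lemma germ_solve V (P : nat -> {poly R[i]}) (A : nat -> nat -> R[i]) N :
  qspace V -> P 0%N != 0 ->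
  (forall j i, exists q : rat, (P j)`_i = ratr q) ->
  (forall k, \sum_(j < N.+1) pact (P j) (A j) k = 0) ->
  (forall j k, (0 < j)%N -> V (A j k)) -> forall k, V (A 0%N k).
Proof.
move=> Vq P0 Pq S VA.
have [e e0 emin] : exists2 e, (P 0%N)`_e != 0 & forall i, (i < e)%N -> (P 0%N)`_i = 0.
  have ex : exists e, (P 0%N)`_e != 0.
    by exists (size (P 0%N)).-1; rewrite -lead_coefE lead_coef_eq0.
  case: (ex_minnP ex) => e he hmin; exists e => // i ie.
  by apply/eqP; apply: contraTT ie => /hmin; rewrite -leqNgt.
have Vpact j k : (0 < j)%N -> V (pact (P j) (A j) k).
  move=> j0; apply: qspace_sum => // i _; have [q ->] := Pq j i.
  by apply: qspaceZ => //; exact: VA.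
elim/ltn_ind => k IH.
have := S (e + k)%N; rewrite big_ord_recl/= => /eqP.
rewrite addr_eq0 => /eqP.
set T := - _ => ET.
have VT : V T.
  by apply: qspaceN => //; apply: qspace_sum => // i _; exact: Vpact.
have ee : (e < (e + k).+1)%N by rewrite ltnS leq_addr.
move: ET; rewrite /pact (bigD1 (Ordinal ee))//= addKn => /eqP.
rewrite eq_sym -subr_eq => /eqP E.
have VE : V ((P 0%N)`_e * A 0%N k).
  rewrite -E; apply: qspaceD => //; apply: qspaceN => //.
  apply: qspace_sum => // i ie.
  have [lt_ie|] := ltnP i e; first by rewrite emin// mul0r; exact: qspace0.
  rewrite leq_eqVlt => /orP[/eqP ei|ei].
    by move: ie; rewrite -(inj_eq val_inj)/= eq_sym => /eqP.
  have [q ->] := Pq 0%N i; apply: qspaceZ => //; apply: IH.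
  have := ltn_ord i; rewrite ltnS => ik.
  by rewrite ltn_subLR// ltn_add2r.
have [q Eq] := Pq 0%N e.
have q0 : (ratr q : R[i]) != 0 by rewrite -Eq.
have := qspaceZ Vq q^-1 VE.
by rewrite Eq mulrA fmorphV mulVf// mul1r.
Qed.

Lemma rgerm_shift_arg phi (c d : R) m A : rgerm phi (c + d) m A ->
  rgerm (fun x => phi (x + d)) c m A.
Proof.
by move=> [e e0 H]; exists e => // h h0 he; rewrite addrAC; exact: H.
Qed.

Lemma rgerm_sum (psi : nat -> R -> R[i]) c m (A : nat -> nat -> R[i]) N :
  (forall j, (j < N)%N -> rgerm (psi j) c m (A j)) ->
  rgerm (fun x => \sum_(j < N) psi j x) c m (fun k => \sum_(j < N) A j k).
Proof.
elim: N => [|N IH] H.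
  exists 1 => // h _ _; rewrite big_ord0 mulr0.
  rewrite (_ : (fun _ => _) = (fun=> 0)); first exact: psum0.
  by apply/funext => k; rewrite big_ord0.
have := rgermD (IH (fun j jN => H j (ltnW jN))) (H N (ltnSn N)).
congr rgerm; apply/funext => x; by rewrite big_ord_recr.
Qed.

(** Padding with zeros brings finitely many germs to one pole order and does not leave V. [Q] marks
    the germs whose coefficients are already known to lie in V. *)
Lemma rgerm_common V (psi : nat -> R -> R[i]) c N (Q : nat -> Prop) : qspace V ->
  (forall j, exists m A, rgerm (psi j) c m A /\ (Q j -> forall k, V (A k))) ->
  exists m (A : nat -> nat -> R[i]), forall j, (j < N)%N ->
    rgerm (psi j) c m (A j) /\ (Q j -> forall k, V (A j k)).
Proof.
move=> Vq /choice[m] /choice[A H].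
pose M := (\sum_(j < N) m j)%N.
have mM j : (j < N)%N -> (m j <= M)%N.
  by move=> jN; rewrite /M (bigD1 (Ordinal jN))//= leq_addr.
exists M, (fun j => iter (M - m j) (@cshift R) (A j)) => j jN.
have [h1 h2] := H j; split.
  by have := rgermSn (M - m j) h1; rewrite subnK// mM.
by move=> /h2; exact: iter_cshift_V.
Qed.

(** One step of the descent. The recurrence is known for large x only; [real_identity] carries it to
    a punctured neighbourhood of s, where it becomes a relation between germs to which [germ_solve]
    applies. *)
Lemma rgerm_rec (J : R[i] -> R[i]) (V : R[i] -> Prop) N (P : nat -> {poly R[i]})
    (X : R) :
  meromorphic J -> qspace V -> P 0%N != 0 ->
  (forall j i, exists q : rat, (P j)`_i = ratr q) ->
  (forall x : R, X < x ->
    \sum_(j < N.+1) (P j).[x%:C%C] * J (x + j%:R)%:C%C = 0) ->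
  forall s : int,
  (forall j : nat, (0 < j)%N -> exists m A,
    rgerm (fun x => J x%:C%C) (s + j%:Z)%:~R m A /\ forall k, V (A k)) ->
  exists m A, rgerm (fun x => J x%:C%C) s%:~R m A /\ forall k, V (A k).
Proof.
move=> mJ Vq P0 Pq rec s IH.
pose psi j (x : R) := J (x + j%:R)%:C%C.
have G0 c j : exists m A, rgerm (psi j) c m A.
  have [m [A h]] := meromorphic_rgerm (c + j%:R) mJ.
  by exists m, A; exact: rgerm_shift_arg h.
pose G (x : R) := \sum_(j < N.+1) (P j).[x%:C%C] * psi j x.
have GG c : exists m A, rgerm G c m A.
  have [||m [A H]] := @rgerm_common (fun=> True) psi c N.+1 (fun=> True).
  - by split.
  - by move=> j; have [m [A h]] := G0 c j; exists m, A; split.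
  exists m, (fun k => \sum_(j < N.+1) pact (P j \Po ('X + (c%:C%C)%:P)) (A j) k).
  apply: (rgerm_sum (psi := fun j x => (P j).[x%:C%C] * psi j x)
    (A := fun j k => pact (P j \Po ('X + (c%:C%C)%:P)) (A j) k)) => j jN.
  by apply: rgerm_pact; have [] := H j jN.
have Z := real_identity GG rec.
set c : R := s%:~R.
have [|m [A H]] := @rgerm_common V psi c N.+1 (fun j => (0 < j)%N) Vq.
  case=> [|j].
    by have [m [A h]] := G0 c 0%N; exists m, A.
  have [m [A [h hV]]] := IH j.+1 isT; exists m, A; split=> //.
  by move: h; rewrite intrD -[j.+1%:Z%:~R]pmulrn => /rgerm_shift_arg.
exists m, (A 0%N); split.
  have [h _] := H 0%N isT; move: h; congr rgerm.
  by apply/funext => x; rewrite /psi addr0.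
(* Beyond N the germs are replaced by 0, so that all those of positive index lie in V. *)
pose A' j := if (j < N.+1)%N then A j else (fun=> 0).
have : forall k, V (A' 0%N k); last by [].
(* The centre is an integer, so recentring keeps the coefficients rational. *)
have Pq' j i : exists q : rat, (P j \Po ('X + (c%:C%C)%:P))`_i = ratr q.
  rewrite comp_polyE coef_sum.
  have -> : c%:C%C%:P = (s%:~R : {poly R[i]}).
    by rewrite /c rmorph_int/= rmorph_int.
  have : exists p : {poly rat}, P j = map_poly ratr p.
    have /choice[q hq] := Pq j.
    exists (\poly_(i < size (P j)) q i); apply/polyP => l.
    rewrite coef_map coef_poly; case: ltnP => [_|h]; first exact: hq.
    by rewrite nth_default// [RHS]rmorph0.
  move=> [p Ep]; exists (p \Po ('X + s%:~R))`_i.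
  rewrite -coef_map map_comp_poly rmorphD/= map_polyX rmorph_int -Ep.
  by rewrite comp_polyE coef_sum.
apply: (@germ_solve V (fun j => P j \Po ('X + (c%:C%C)%:P)) A' N Vq) => //.
- by rewrite comp_poly_eq0// size_XaddC.
- have gsum : rgerm G c m (fun k => \sum_(j < N.+1) pact (P j \Po ('X + (c%:C%C)%:P)) (A' j) k).
    apply: (rgerm_sum (psi := fun j x => (P j).[x%:C%C] * psi j x)
     (A := fun j k => pact (P j \Po ('X + (c%:C%C)%:P)) (A' j) k)) => j jN.
    by rewrite /A' jN; apply: rgerm_pact; have [] := H j jN.
  have [e e0 he] := Z c.
  apply: (rgerm_zero gsum _).1 => d d0.
  exists (Num.min d e / 2).
    have m0 : 0 < Num.min d e by rewrite lt_min d0.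
    rewrite divr_gt0//= (@lt_le_trans _ _ (Num.min d e))//.
      by rewrite gtr_pMr// invf_lt1// ltr1n.
    by rewrite ge_min lexx.
  have m0 : 0 < Num.min d e by rewrite lt_min d0.
  apply: he; first by rewrite gt_eqF// divr_gt0.
  rewrite gtr0_norm ?divr_gt0// (@lt_le_trans _ _ (Num.min d e))//.
    by rewrite gtr_pMr// invf_lt1// ltr1n.
  by rewrite ge_min lexx orbT.
- move=> j k j0; rewrite /A'; case: ifP => [jN|_]; last exact: qspace0.
  by have [_ h] := H j jN; exact: h.
Qed.

(** The positive integers are the base; each use of [rgerm_rec] reaches one integer further to the
    left. *)
Theorem laurent_descent (J : R[i] -> R[i]) (V : R[i] -> Prop) N
    (P : nat -> {poly R[i]}) (X : R) :
  meromorphic J -> qspace V -> P 0%N != 0 ->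
  (forall j i, exists q : rat, (P j)`_i = ratr q) ->
  (forall x : R, X < x ->
    \sum_(j < N.+1) (P j).[x%:C%C] * J (x + j%:R)%:C%C = 0) ->
  (forall l : nat, (0 < l)%N -> exists m A,
    rgerm (fun x => J x%:C%C) l%:R m A /\ forall k, V (A k)) ->
  forall s : int,
  exists m A, rgerm (fun x => J x%:C%C) s%:~R m A /\ forall k, V (A k).
Proof.
move=> mJ Vq P0 Pq rec base s.
have H n : forall s : int, 1 - n%:Z <= s ->
  exists m A, rgerm (fun x => J x%:C%C) s%:~R m A /\ forall k, V (A k).
  elim: n => [|n IH] {}s hs.
    case: s hs => [l hl|l]; last by lia.
    by apply: base; lia.
  apply: (rgerm_rec mJ Vq P0 Pq rec) => j j0; apply: IH.
  by lia.
apply: (H `|1 - s|%N); lia.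
Qed.

(** The given expansion and the germ describe the same function on the real axis near s; after
    multiplication by powers of h both are power series and agree by [psum_inj]. *)
Lemma laurent_coef (J : R[i] -> R[i]) (V : R[i] -> Prop) (s N : int) (a : int -> R[i]) m A :
  qspace V -> @laurent_expansion R[i] J s%:~R N a ->
  rgerm (fun x => J x%:C%C) s%:~R m A -> (forall k, V (A k)) ->
  forall i, N <= i -> V (a i).
Proof.
move=> Vq /dnear_complexP[e e0 ha] [e' e'0 hA] VA.
pose b k := a (N + k%:Z).
suff Vb : forall k, V (b k).
  move=> i Ni; have := Vb `|i - N|%N; rewrite /b; congr (V (a _)); lia.
have hb h : h != 0 -> `|h| < e -> psum b h (h%:C%C ^ (- N) * J (s%:~R + h)%:C%C).
  move=> h0 he.
  have h0' : (h%:C%C : R[i]) != 0 by rewrite eq_complex negb_and h0.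
  have E : (s%:~R + h)%:C%C - s%:~R = h%:C%C :> R[i].
    by rewrite rmorphD/= rmorph_int addrAC subrr add0r.
  have := ha (s%:~R + h)%:C%C; rewrite -subr_eq0 E cnormR => /(_ h0' he).
  move=> /ccvgnP H ep ep0.
  have hN0 : 0 < cnorm (h%:C%C ^ N) by rewrite cnorm_gt0 expfz_neq0.
  have [M hM] := H _ (mulr_gt0 ep0 hN0); exists M => n /hM.
  rewrite -ltr_pdivrMr// -cnormV -cnormM mulrC mulrBr invr_expz.
  congr (cnorm (_ - _) < _).
  rewrite /series /= big_mkord mulr_sumr; apply: eq_bigr => k _.
  by rewrite mulrCA -expfzDr// addKr.
have e2 : 0 < Num.min e e' by rewrite lt_min e0.
(* Negative exponents are avoided by multiplying the expansion by h^(n + m) and the germ by h^n'. *)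
have [n [n' EN]] : exists n n' : nat, N = n%:Z - n'%:Z.
  by case: N {ha b hb} => k; [exists k, 0%N|exists 0%N, k.+1]; lia.
have key : forall k, iter (n + m) (@cshift R) b k = iter n' (@cshift R) A k.
  apply: (psum_inj e2) => h h0; rewrite lt_min => /andP[he he'].
  have hn0 : h != 0 by rewrite gt_eqF.
  have h0' : (h%:C%C : R[i]) != 0 by rewrite eq_complex negb_and hn0.
  exists (h%:C%C ^+ n' * (h%:C%C ^+ m * J (s%:~R + h)%:C%C)); last first.
    by apply: psum_iter_cshift; apply: hA; rewrite // gtr0_norm.
  have := psum_iter_cshift (n + m) (hb h hn0 _); rewrite gtr0_norm// => /(_ he).
  congr psum; rewrite EN opprB expfzDr// exprD.
  rewrite -!exprnP -exprnN; have : (h%:C%C ^+ n : R[i]) != 0 by rewrite expf_neq0.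
  move: (h%:C%C ^+ n) (h%:C%C ^+ n') (h%:C%C ^+ m) => u v w u0.
  by field.
by move=> k; rewrite -(iter_cshift b (n + m) k) key; exact: iter_cshift_V.
Qed.

End Descent.

(** * Polynomials in several variables *)

Section MPolyTools.

Lemma mpoly_ring_ind (n : nat) (A : comNzRingType) (P : mpoly n A -> Prop) :
  (forall c, P (mpolyC n c)) -> (forall i, P (mpolyX A (mnm1 i))) ->
  (forall p q, P p -> P q -> P (p + q)) -> (forall p q, P p -> P q -> P (p * q)) ->
  forall p, P p.
Proof.
move=> PC PX PD PM p; rewrite (mpolyE p).
apply: (big_ind P) => [| |m _]; [by rewrite -(mpolyC0 n A)|by []|].
rewrite -mul_mpolyC mpolyXE_id; apply: (PM _ _ (PC _)).
apply: (big_ind P) => [| |i _]; [by rewrite -(mpolyC1 n A)|by []|].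
elim: (m i) => [|k IH]; first by rewrite expr0 -(mpolyC1 n A).
by rewrite exprS; apply: (PM _ _ (PX i)).
Qed.

Lemma msize_mderiv n (A : nzRingType) (p : mpoly n A) i :
  (mmeasure mdeg (mderiv i p) <= mmeasure mdeg p)%N.
Proof.
rewrite [leqLHS]msizeE; apply/bigmax_leqP_seq => m mp _.
have : mcoeff (mnm_add m (mnm1 i)) p != 0.
  move: mp; rewrite mcoeff_msupp mcoeff_mderiv; apply: contra_neq => ->.
  by rewrite mul0rn.
rewrite -mcoeff_msupp => /msize_mdeg_lt; rewrite mdegD mdeg1 addn1.
exact: ltnW.
Qed.

Lemma card_bmultinom n d : (#|{: bmultinom n d}| <= d ^ n)%N.
Proof.
have [d0|d0] := posnP d.
  rewrite leqNgt; apply/negP => h.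
  have /card_gt0P[m _] : (0 < #|{: bmultinom n d}|)%N by exact: leq_ltn_trans h.
  by have := leq_ltn_trans (leq0n _) (bmdeg m); move: d0 => /eqP; rewrite lt0n => ->.
have hd (m : bmultinom n d) i : ((m : multinom n) i < d)%N.
  apply: leq_ltn_trans (bmdeg m).
  by rewrite mdegE (bigD1 i)//= leq_addr.
pose f (m : bmultinom n d) : {ffun 'I_n -> 'I_d} := [ffun i => Ordinal (hd m i)].
have finj : injective f.
  move=> m m' /ffunP E; apply/val_inj/mnmP => i.
  by have := E i; rewrite !ffunE => /(congr1 val).
have := leq_card f finj.
by rewrite card_ffun !card_ord.
Qed.

(** [mmeasure mdeg] is the degree plus one, so at most d^n monomials occur. The coefficient matrix
    has more rows than columns, and a nonzero row of its left kernel is the relation. *)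
Lemma mpoly_dependence (F : fieldType) n d (I : finType) (Q : I -> mpoly n F) :
  (forall i, (mmeasure mdeg (Q i) <= d)%N) -> (d ^ n < #|I|)%N ->
  exists c : I -> F, (exists i, c i != 0) /\ \sum_i c i *: Q i = 0.
Proof.
move=> Qd dI.
pose M : 'M[F]_(#|I|, #|{: bmultinom n d}|) :=
  \matrix_(i, m) mcoeff (enum_val m : bmultinom n d) (Q (enum_val i)).
have : kermx M != 0.
  rewrite kermx_eq0 /row_free neq_ltn (leq_ltn_trans (rank_leq_col _))//.
  exact: leq_ltn_trans (card_bmultinom _ _) dI.
move=> /matrix0Pn[i0 [j0 h0]].
pose c i := kermx M i0 (enum_rank i).
exists c; split; first by exists (enum_val j0); rewrite /c enum_valK.
apply/mpolyP => m; rewrite mcoeff0 raddf_sum/=.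
have [md|md] := leqP d (mdeg m).
  rewrite big1// => i _; rewrite [LHS]linearZ/=.
  have : m \notin msupp (Q i).
    by apply: msize_mdeg_ge; exact: leq_trans md.
  by move=> /memN_msupp_eq0->; rewrite mulr0.
have := mulmx_ker M; move=> /matrixP/(_ i0 (enum_rank (BMultinom md))).
rewrite !mxE (reindex (@enum_rank I)) /=; last first.
  by apply: onW_bij; exact: enum_rank_bij.
move=> E; rewrite -[RHS]E; apply: eq_bigr => i _.
have -> : M (enum_rank i) (enum_rank (BMultinom md)) = mcoeff m (Q i).
  by rewrite mxE !enum_rankK.
by rewrite [LHS]linearZ.
Qed.

End MPolyTools.

(** * Evaluation of polynomials at real points *)

Section MEval.
Variable R : realType.
Variable n : nat.
Implicit Types (p : mpoly n R) (v : 'I_n -> R).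

Definition upd v (i : 'I_n) (t : R) : 'I_n -> R := fun j => if j == i then t else v j.

Lemma is_derive_meval v i p (t : R) :
  is_derive t (1 : R) (fun t => meval (upd v i t) p) (meval (upd v i t) (mderiv i p)).
Proof.
elim/mpoly_ring_ind: p => [c|j|p q hp hq|p q hp hq].
- rewrite mderivC meval0.
  rewrite (_ : (fun _ => _) = (fun=> c)); first exact: is_derive_cst.
  by apply/funext => x; rewrite mevalC.
- rewrite mderivX mevalZ mnm1E.
  have [ij|ij] := eqVneq j i.
    rewrite ij mul1r (_ : mnm_sub (mnm1 i) (mnm1 i) = mnm0); last first.
      by apply/mnmP => k; rewrite mnmBE mnm0E subnn.
    rewrite mpolyX0 meval1 (_ : (fun _ => _) = id); first exact: is_derive_id.
    by apply/funext => x; rewrite mevalXU /upd eqxx.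
  rewrite mul0r (_ : (fun _ => _) = (fun=> v j)); first exact: is_derive_cst.
  by apply/funext => x; rewrite mevalXU /upd (negbTE ij).
- rewrite mderivD mevalD (_ : (fun _ => _) =
    (fun t => meval (upd v i t) p) + (fun t => meval (upd v i t) q)).
    exact: is_deriveD.
  by apply/funext => x; rewrite mevalD.
- rewrite mderivM mevalD !mevalM (_ : (fun _ => _) =
    (fun t => meval (upd v i t) p) * (fun t => meval (upd v i t) q)).
    have /is_derive_eq := @is_deriveM _ _ _ _ t 1 _ _ hp hq; apply.
    by rewrite /= addrC [_ *: _]mulrC; congr (_ + _).
  by apply/funext => x; rewrite mevalM.
Qed.

Lemma meval_bounded p (M : R) : exists2 B, 0 <= B &
  forall v, (forall i, `|v i| <= M) -> `|meval v p| <= B.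
Proof.
elim/mpoly_ring_ind: p => [c|j|p q [B B0 hp] [C C0 hq]|p q [B B0 hp] [C C0 hq]].
- by exists `|c| => // v _; rewrite mevalC.
- by exists `|M| => // v hv; rewrite mevalXU (le_trans (hv j))// ler_norm.
- exists (B + C); first exact: addr_ge0.
  move=> v hv; rewrite mevalD (le_trans (ler_normD _ _))// lerD//; [exact: hp|exact: hq].
- exists (B * C); first exact: mulr_ge0.
  move=> v hv; rewrite mevalM normrM ler_pM//; [exact: hp|exact: hq].
Qed.

Lemma measurable_meval p :
  measurable_fun [set: euclid R n] (fun u => meval (tnth u) p).
Proof.
elim/mpoly_ring_ind: p => [c|j|p q hp hq|p q hp hq].
- rewrite (_ : (fun _ => _) = (fun=> c)); first exact: measurable_cst.
  by apply/funext => x; rewrite mevalC.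
- rewrite (_ : (fun _ => _) = (fun u : euclid R n => tnth u j)).
    exact: measurable_tnth.
  by apply/funext => x; rewrite mevalXU.
- rewrite (_ : (fun _ => _) =
    (fun u : euclid R n => meval (tnth u) p + meval (tnth u) q)).
    exact: measurable_funD.
  by apply/funext => x; rewrite mevalD.
- rewrite (_ : (fun _ => _) =
    (fun u : euclid R n => meval (tnth u) p * meval (tnth u) q)).
    exact: measurable_funM.
  by apply/funext => x; rewrite mevalM.
Qed.

End MEval.

(** * Integration on the cube *)

Section Cube.
Variable R : realType.
Local Notation mu := (@lebesgue_measure R).
Local Notation L := (lebesgue R).

Definition ec n (x : R) (y : euclid R n) : euclid R n.+1 := [tuple of x :: y].

Lemma tnth_ec0 n x (y : euclid R n) : tnth (ec x y) ord0 = x.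
Proof. by []. Qed.

Lemma tnth_ecS n x (y : euclid R n) i : tnth (ec x y) (lift ord0 i) = tnth y i.
Proof. by rewrite !(tnth_nth 0). Qed.

Lemma measurable_ec n :
  measurable_fun setT (fun p : measurableTypeR R * euclid R n => ec p.1 p.2).
Proof. exact: measurable_euclid_cons. Qed.

Lemma measurable_ecl n x : measurable_fun [set: euclid R n] (fun y => ec x y).
Proof.
exact: (measurableT_comp (@measurable_ec n) (measurable_pair1 x)).
Qed.

Lemma measurable_ecr n (y : euclid R n) :
  measurable_fun [set: measurableTypeR R] (fun x => ec x y).
Proof.
exact: (measurableT_comp (@measurable_ec n) (measurable_pair2 y)).
Qed.

Lemma tonelli n (f : euclid R n.+1 -> \bar R) : measurable_fun setT f ->
  (forall u, 0 <= f u)%E ->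
  (\int[L n.+1]_u f u = \int[mu]_x \int[L n]_y f (ec x y))%E.
Proof.
move=> mf f0.
have := @ge0_integral_pushforward _ _ _ _ R _ (@measurable_euclid_cons R n)
  (mu \x L n)%E setT f measurableT mf (fun y _ => f0 y).
rewrite preimage_setT => E.
transitivity (\int[mu \x L n]_p (f \o @euclid_cons R n) p)%E; first exact: E.
rewrite fubini_tonelli1//; last by move=> p; exact: f0.
exact: measurableT_comp mf (@measurable_euclid_cons R n).
Qed.

Definition cube n : set (euclid R n) := [set u | forall i, 0 < tnth u i < 1].

Lemma cube_ec n x (y : euclid R n) : cube (ec x y) <-> (0 < x < 1) /\ cube y.
Proof.
split=> [H|[hx hy] i].
  split; first exact: (H ord0).
  by move=> i; have := H (lift ord0 i); rewrite tnth_ecS.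
by have [j ->|->] := unliftP ord0 i; [rewrite tnth_ecS; exact: hy|].
Qed.

Lemma measurable_cube n : measurable (@cube n).
Proof.
have -> : @cube n = \bigcap_(i in [set: 'I_n]) ((fun u => tnth u i) @^-1` `]0, 1[%classic).
  apply/seteqP; split => u.
    by move=> H i _; rewrite /= in_itv/=; exact: H.
  by move=> H i; have := H i I; rewrite /= in_itv.
apply: fin_bigcap_measurable => [|i _]; first exact: finite_finset.
rewrite -[X in measurable X]setTI.
exact: (@measurable_tnth _ _ n i measurableT _ (measurable_itv _)).
Qed.

Lemma lebesgue_cube n : (L n (@cube n) <= 1)%E.
Proof.
elim: n => [|n IH] /=.
  by rewrite diracE; case: (_ \in _).
rewrite /lebesgue_step /pushforward.
rewrite (_ : _ @^-1` _ = `]0, 1[%classic `*` @cube n); last first.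
  apply/seteqP; split => -[x y] /=; rewrite in_itv/=.
    by move=> /cube_ec.
  by move=> H; apply/cube_ec.
rewrite product_measure1E//; last exact: measurable_cube.
have E : (mu `]0%R, 1%R[%classic = 1)%E.
  by rewrite lebesgue_measure_itv/= lte_fin ltr01 -EFinD subr0.
by rewrite [X in (X * _)%E]E mul1e.
Qed.

(** Integrands supported in the cube: integrals are then taken over the whole space, and Fubini
    carries no domains along. *)
Definition bcs n (g : euclid R n -> R) := measurable_fun setT g /\
  exists M, forall u, (cube u -> `|g u| <= M) /\ (~ cube u -> g u = 0).

Lemma bcs_integrable n g : @bcs n g -> (L n).-integrable setT (EFin \o g).
Proof.
move=> [mg [M gM]].
have -> : EFin \o g = (EFin \o g) \_ (@cube n).
  apply/funext => u; rewrite patchE; case: ifPn => //.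
  by move/negP => h; rewrite /= (gM u).2// => hu; apply: h; exact: mem_set.
rewrite -integrable_mkcond; last exact: measurable_cube.
apply: measurable_bounded_integrable.
- exact: measurable_cube.
- exact: le_lt_trans (lebesgue_cube n) (ltry _).
- exact: measurable_funTS.
- exists `|M|; split; first exact: num_real.
  move=> y My u cu; apply: (le_trans ((gM u).1 cu)).
  by rewrite (le_trans (ler_norm _))// ltW.
Qed.

Lemma bcs_slice n g x : @bcs n.+1 g -> bcs (fun y => g (ec x y)).
Proof.
move=> [mg [M gM]]; split.
  exact: measurableT_comp mg (measurable_ecl x).
have [x01|x01] := boolP (0 < x < 1).
  exists M => y; split=> h.
    by apply: (gM _).1; apply/cube_ec.
  by apply: (gM _).2 => /cube_ec[].
exists 0 => y.
have E : g (ec x y) = 0 by apply: (gM _).2 => /cube_ec[]; rewrite (negbTE x01).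
by rewrite E normr0.
Qed.

Lemma bcs_prod_integrable n g : @bcs n.+1 g ->
  (mu \x L n)%E.-integrable setT (fun p => (g (ec p.1 p.2))%:E).
Proof.
move=> bg; have := bcs_integrable bg.
have [mg _] := bg.
move=> /integrableP[_ fin]; apply/integrableP; split.
  apply/measurable_EFinP; exact: measurableT_comp mg (@measurable_ec n).
apply: le_lt_trans fin; rewrite tonelli//; last first.
  apply: measurableT_comp => //; exact/measurable_EFinP.
by rewrite fubini_tonelli1//; apply: measurableT_comp => //;
  apply/measurable_EFinP; exact: measurableT_comp mg (@measurable_ec n).
Qed.

Lemma bcs_fubini_aux n g : @bcs n.+1 g ->
  (\int[L n.+1]_u (g u)%:E = \int[mu \x L n]_p (g (ec p.1 p.2))%:E)%E.
Proof.
move=> bg.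
have mg : measurable_fun setT (EFin \o g) by apply/measurable_EFinP; case: bg.
have := @integral_pushforward _ _ _ _ R _ (@measurable_euclid_cons R n)
  (mu \x L n)%E setT (EFin \o g) mg (bcs_prod_integrable bg) measurableT.
by rewrite preimage_setT.
Qed.

Lemma bcs_fubini1 n g : @bcs n.+1 g ->
  \int[L n.+1]_u g u = \int[mu]_x \int[L n]_y g (ec x y).
Proof.
move=> bg; rewrite /Rintegral bcs_fubini_aux//.
rewrite -integral12_prod_meas1; last exact: bcs_prod_integrable.
congr fine; apply: eq_integral => x _ /=.
rewrite fineK//; apply: integrable_fin_num => //.
exact: bcs_integrable (bcs_slice x bg).
Qed.

Lemma bcs_slicer n g y : @bcs n.+1 g ->
  mu.-integrable setT (fun x => (g (ec x y))%:E).
Proof.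
move=> [mg [M gM]].
have mgy : measurable_fun setT (fun x => g (ec x y)).
  exact: measurableT_comp mg (measurable_ecr y).
have -> : (fun x => (g (ec x y))%:E) = (fun x => (g (ec x y))%:E) \_ `]0, 1[.
  apply/funext => x; rewrite patchE; case: ifPn => //.
  rewrite notin_setE/= in_itv/= => h; congr EFin.
  by apply: (gM _).2 => /cube_ec[].
rewrite -integrable_mkcond//.
apply: measurable_bounded_integrable => //.
- suff : (mu `]0%R, 1%R[%classic < +oo)%E by [].
  by rewrite lebesgue_measure_itv/= lte_fin ltr01 -EFinD ltry.
- exact: measurable_funTS.
- exists `|M|; split; first exact: num_real.
  move=> z Mz x _ /=.
  have [h|h] := pselect (cube (ec x y)).
    by rewrite (le_trans ((gM _).1 h))// (le_trans (ler_norm _))// ltW.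
  by rewrite (gM _).2// normr0 (le_trans _ (ltW Mz)).
Qed.

Lemma bcs_fubini2 n g : @bcs n.+1 g ->
  \int[L n.+1]_u g u = \int[L n]_y \int[mu]_x g (ec x y).
Proof.
move=> bg; rewrite /Rintegral bcs_fubini_aux//.
rewrite -integral21_prod_meas1; last exact: bcs_prod_integrable.
congr fine; apply: eq_integral => y _ /=.
rewrite fineK//; apply: integrable_fin_num => //.
exact: bcs_slicer.
Qed.

Lemma bcsD n (g h : euclid R n -> R) : @bcs n g -> @bcs n h -> bcs (fun u => g u + h u).
Proof.
move=> [mg [M gM]] [mh [N hN]]; split; first exact: measurable_funD.
exists (M + N) => u; split=> hu.
  by rewrite (le_trans (ler_normD _ _))// lerD//; [exact: (gM u).1|exact: (hN u).1].
by rewrite (gM u).2// (hN u).2// addr0.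
Qed.

Lemma bcsM n (g h : euclid R n -> R) : @bcs n g -> measurable_fun setT h ->
  (exists M, forall u, cube u -> `|h u| <= M) -> bcs (fun u => g u * h u).
Proof.
move=> [mg [M gM]] mh [N hN]; split; first exact: measurable_funM.
exists (`|M| * `|N|) => u; split=> hu.
  rewrite normrM ler_pM//.
    by rewrite (le_trans ((gM u).1 hu))// ler_norm.
  by rewrite (le_trans (hN u hu))// ler_norm.
by rewrite (gM u).2// mul0r.
Qed.

Definition updt n (u : euclid R n) (i : 'I_n) (t : R) : euclid R n :=
  [tuple upd (tnth u) i t j | j < n].

Lemma tnth_updt n (u : euclid R n) i t : tnth (updt u i t) = upd (tnth u) i t.
Proof. by apply/funext => j; rewrite tnth_mktuple. Qed.

(** Fubini for an arbitrary coordinate. The measure splits off the first coordinate only, so those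
    preceding i are sliced away by induction. *)
Lemma bcs_partial0 n (g : euclid R n -> R) (i : 'I_n) : bcs g ->
  (forall u, \int[mu]_t g (updt u i t) = 0) -> \int[L n]_u g u = 0.
Proof.
elim: n g i => [|n IH] g i bg H; first by case: i {H} => [].
have [j ij|i0] := unliftP ord0 i.
  rewrite bcs_fubini1//; under eq_Rintegral => x _.
    rewrite (IH _ j (bcs_slice x bg)); last first.
      move=> u; rewrite -[RHS](H (ec x u)); apply: eq_Rintegral => t _.
      congr g; apply: eq_from_tnth => k; rewrite tnth_updt ij.
      have [l ->|->] := unliftP ord0 k.
        by rewrite tnth_ecS tnth_updt /upd (inj_eq lift_inj) tnth_ecS.
      by rewrite tnth_ec0 /upd (negbTE (neq_lift _ _)) tnth_ec0.
    over.
  by rewrite /Rintegral integral0.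
rewrite bcs_fubini2//; under eq_Rintegral => y _.
  have -> : \int[mu]_x g (ec x y) = 0.
    rewrite -[RHS](H (ec 0 y)); apply: eq_Rintegral => t _.
    congr g; apply: eq_from_tnth => k; rewrite tnth_updt i0.
    have [l ->|->] := unliftP ord0 k.
      by rewrite tnth_ecS /upd eq_sym (negbTE (neq_lift _ _)) tnth_ecS.
    by rewrite tnth_ec0 /upd eqxx.
  over.
by rewrite /Rintegral integral0.
Qed.

End Cube.

(** * Real powers and the weights *)

Section Psi.
Variable R : realType.
Implicit Types (s v t : R).

Lemma derM (f g : R -> R) (x a b : R) : is_derive x (1 : R) f a ->
  is_derive x (1 : R) g b ->
  is_derive x (1 : R) (fun t => f t * g t) (a * g x + f x * b).
Proof.
move=> hf hg; have /is_derive_eq := @is_deriveM _ _ _ _ x 1 _ _ hf hg; apply.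
by rewrite addrC [X in X + _ = _]mulrC; congr (_ + _).
Qed.

Lemma der_cst (k x : R) : is_derive x (1 : R) (fun=> k) 0.
Proof. exact: (is_derive_cst k x (1 : R)). Qed.

Lemma derZ (k : R) (g : R -> R) (x b : R) : is_derive x (1 : R) g b ->
  is_derive x (1 : R) (fun t => k * g t) (k * b).
Proof.
move=> hg; have /is_derive_eq := derM (is_derive_cst k x (1 : R)) hg; apply.
by rewrite mul0r add0r.
Qed.

Lemma derD (f g : R -> R) (x a b : R) : is_derive x (1 : R) f a ->
  is_derive x (1 : R) g b -> is_derive x (1 : R) (fun t => f t + g t) (a + b).
Proof. by move=> hf hg; exact: is_deriveD. Qed.

Lemma der_near (f g : R -> R) (x a : R) : (\forall z \near x, f z = g z) ->
  is_derive x (1 : R) f a -> is_derive x (1 : R) g a.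
Proof.
move=> fg [df fa]; apply: DeriveDef; first exact: (near_eq_derivable fg).
rewrite -fa; apply/esym; apply: near_eq_derive => //.
Qed.

Lemma der_comp (f g : R -> R) (x a b : R) : is_derive (g x) (1 : R) f a ->
  is_derive x (1 : R) g b -> is_derive x (1 : R) (fun t => f (g t)) (a * b).
Proof. by move=> hf hg; exact: is_derive1_comp. Qed.

(** The power v^s cut off at v <= 0. For s > 1 it is C^1 on the whole line, so its composite with a
    polynomial can be differentiated along a full line, whatever the sign of the polynomial
    there. *)
Definition psi s v : R := if 0 < v then expR (s * ln v) else 0.

Lemma psi_powR s v : s != 0 -> 0 <= v -> psi s v = v `^ s.
Proof.
move=> s0; rewrite le_eqVlt /psi => /orP[/eqP<-|v0]; first by rewrite ltxx powR0.
by rewrite v0 /powR gt_eqF.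
Qed.

Lemma psi_ge0 s v : 0 <= psi s v.
Proof. by rewrite /psi; case: ifP => // _; exact: expR_ge0. Qed.

Lemma psiS s v : psi (s + 1) v = v * psi s v.
Proof.
rewrite /psi; case: ifP => [v0|_]; last by rewrite mulr0.
by rewrite mulrDl mul1r expRD lnK// mulrC.
Qed.

Lemma psiDn s k v : psi (s + k%:R) v = v ^+ k * psi s v.
Proof.
elim: k => [|k IH]; first by rewrite addr0 expr0 mul1r.
by rewrite -natr1 addrA psiS IH exprS mulrA.
Qed.

Lemma psi_bound s v M : 0 <= s -> 1 <= M -> v <= M -> psi s v <= expR (s * ln M).
Proof.
move=> s0 M1 vM; rewrite /psi; case: ifP => [v0|_]; last exact: expR_ge0.
by rewrite ler_expR ler_wpM2l// ler_ln// posrE (lt_le_trans _ M1).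
Qed.

Lemma psi_small s (e : R) : 0 < s -> 0 < e ->
  exists2 dl : R, 0 < dl & forall v, v < dl -> psi s v < e.
Proof.
move=> s0 e0; exists (expR (ln e / s)); first exact: expR_gt0.
move=> v vd; rewrite /psi; case: ifP => // v0.
rewrite -[ltRHS](lnK (_ : e \in Num.pos)) ?posrE// ltr_expR mulrC -ltr_pdivlMr//.
by rewrite -ltr_expR lnK.
Qed.

Lemma psi_derive s v : 1 < s -> is_derive v (1 : R) (psi s) (s * psi (s - 1) v).
Proof.
move=> s1; have [v0|v0|->] := ltgtP v 0.
- rewrite /psi ltNge (ltW v0)/= mulr0.
  apply: (@der_near (fun=> 0) _ _ _ _ (der_cst _ _)).
  apply/nbhs_normP; exists (- v) => /=; first by rewrite oppr_gt0.
  move=> z /=; rewrite ltr_norml opprK => /andP[h1 _].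
  by case: ifP => // z0; move: h1 z0; clear; lra.
- rewrite {2}/psi v0.
  apply: (@der_near (fun x => expR (s * ln x))).
    apply/nbhs_normP; exists v => //= z /=; rewrite ltr_norml /psi => /andP[_ h1].
    by case: ifP => //; move: h1; clear; lra.
  have h1 : is_derive v (1 : R) (fun x => s * ln x) (s * v^-1).
    by apply: derZ; exact: is_derive1_ln.
  have /is_derive_eq := @der_comp expR (fun x => s * ln x) v _ _ (is_derive_expR (s * ln v)) h1; apply.
  rewrite mulrBl mul1r expRB lnK//.
  by rewrite mulrCA.
rewrite {2}/psi ltxx mulr0; apply: is_derive_norm => e e0.
have s10 : 0 < s - 1 by rewrite subr_gt0.
have [dl dl0 H] := psi_small s10 e0; exists dl => // h hd.
rewrite add0r {2}/psi ltxx subr0 mul0r subr0.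
have -> : psi s h = h * psi (s - 1) h by rewrite -psiS subrK.
rewrite normrM mulrC ler_wpM2r// ger0_norm ?psi_ge0// ltW// H//.
exact: le_lt_trans (ler_norm h) hd.
Qed.

Lemma psi_continuous s v : 0 < s -> {for v, continuous (psi s)}.
Proof.
move=> s0; have [v0|v0|->] := ltgtP v 0.
- apply: (@near_eq_continuous _ (fun=> 0)); last exact: fcont_cst.
  apply/nbhs_normP; exists (- v) => /=; first by rewrite oppr_gt0.
  move=> z /=; rewrite ltr_norml opprK /psi => /andP[h1 _].
  by case: ifP => // z0; move: h1 z0; clear; lra.
- apply: (@near_eq_continuous _ (fun x => expR (s * ln x))).
    apply/nbhs_normP; exists v => //= z /=; rewrite ltr_norml /psi => /andP[_ h1].
    by case: ifP => //; move: h1; clear; lra.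
  have h1 : is_derive v (1 : R) (fun x => s * ln x) (s * v^-1).
    by apply: derZ; exact: is_derive1_ln.
  by apply: fderiv_cont; have [] := @der_comp expR (fun x => s * ln x) v _ _ (is_derive_expR (s * ln v)) h1.
apply: fcont_near => e e0; have [dl dl0 H] := psi_small s0 e0.
apply/nbhs_normP; exists dl => //= z /=; rewrite sub0r normrN => hz.
rewrite {1}/psi ltxx sub0r normrN ger0_norm ?psi_ge0//; apply: H.
exact: le_lt_trans (ler_norm z) hz.
Qed.

Lemma measurable_psi s : 0 < s -> measurable_fun [set: R] (psi s).
Proof.
by move=> s0; apply: continuous_measurable_fun => v; exact: psi_continuous.
Qed.

Lemma ler_exp_expR (x : R) a : 0 <= x -> x ^+ a / a`!%:R <= expR x.
Proof.
move=> x0; case: a => [|a].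
  by rewrite expr0 fact0 divr1 -expR0 ler_expR.
by apply: le_trans (expR_ge1Dxn a x0); rewrite lerDr.
Qed.

Definition logit t : R := ln t - ln (1 - t).

(* The factorial makes integration by parts send kap a to kap (a - 1): see
   rho_derive. *)
Definition kap a t : R :=
  if 0 < t < 1 then (t * (1 - t)) ^+ 2 * (logit t ^+ a / a`!%:R) else 0.

(** From |x|^a / a! <= exp |x| and exp |logit t| <= 1 / (t (1 - t)): one of the two factors t (1 -
    t) absorbs the logarithms, uniformly in a. *)
Lemma kap_bound a t : 0 < t < 1 -> `|kap a t| <= t * (1 - t).
Proof.
move=> t01; rewrite /kap t01; move: t01 => /andP[t0 t1].
have t1' : 0 < 1 - t by rewrite subr_gt0.
have b0 : 0 < t * (1 - t) by exact: mulr_gt0.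
rewrite expr2 -mulrA normrM (gtr0_norm b0) ger_pMr// normrM (gtr0_norm b0).
have h1 : `|logit t ^+ a / a`!%:R| <= expR `|logit t|.
  rewrite normrM normrX [`|_^-1|]ger0_norm ?invr_ge0//.
  exact: ler_exp_expR.
have h2 : expR `|logit t| <= (t * (1 - t))^-1.
  rewrite /logit; have [h|h] := ger0P (ln t - ln (1 - t)).
    rewrite expRB !lnK ?posrE// invfM ler_pM2r ?invr_gt0//.
    by rewrite (le_trans (ltW t1))// invf_ge1 ?ltW.
  rewrite expRN expRB !lnK ?posrE// invf_div invfM mulrC ler_pM2l ?invr_gt0//.
  by rewrite (@le_trans _ _ 1)// ?invf_ge1 ?gerBl ?(ltW t0)// ltW.
apply: (@le_trans _ _ (t * (1 - t) * (t * (1 - t))^-1)).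
  by rewrite ler_pM2l// (le_trans h1).
by rewrite mulfV// gt_eqF.
Qed.

Lemma kap_out a t : ~~ (0 < t < 1) -> kap a t = 0.
Proof. by rewrite /kap => /negbTE->. Qed.

Lemma kap_boundl a t : `|kap a t| <= `|t|.
Proof.
have [t01|t01] := boolP (0 < t < 1); last by rewrite kap_out// normr0.
apply: (le_trans (kap_bound a t01)); case/andP: t01 => t0 t1.
by rewrite (gtr0_norm t0) ger_pMr// gerBl ltW.
Qed.

Lemma kap_boundr a t : `|kap a t| <= `|1 - t|.
Proof.
have [t01|t01] := boolP (0 < t < 1); last by rewrite kap_out// normr0.
apply: (le_trans (kap_bound a t01)); case/andP: t01 => t0 t1.
by rewrite [leRHS]gtr0_norm ?subr_gt0// ger_pMl ?subr_gt0// ltW.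
Qed.

Lemma kap_bound1 a t : `|kap a t| <= 1.
Proof.
have [t01|t01] := boolP (0 < t < 1); last by rewrite kap_out// normr0.
apply: (le_trans (kap_boundl a t)); case/andP: t01 => t0 t1.
by rewrite gtr0_norm// ltW.
Qed.

(** The convention that the weight of index -1 is 0, the derivative of the constant logit^0. *)
Definition kap_pred a t : R := if a is b.+1 then kap b t else 0.

Lemma near01 t : 0 < t < 1 -> \forall z \near t, 0 < z < 1.
Proof.
move=> /andP[t0 t1]; apply/nbhs_normP; exists (Num.min t (1 - t)) => /=.
  by rewrite lt_min t0 subr_gt0.
move=> z /=; rewrite lt_min !ltr_norml => /andP[/andP[h1 h2] /andP[h3 h4]].
by move: h1 h2 h3 h4; clear => *; apply/andP; split; lra.
Qed.

Lemma is_derive_id1 t : is_derive t (1 : R) (fun x : R => x) 1.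
Proof. exact: is_derive_id. Qed.

Lemma is_derive_1B t : is_derive t (1 : R) (fun x : R => 1 - x) (-1).
Proof.
have /is_derive_eq := derD (is_derive_cst (1 : R) t (1 : R)) (is_deriveN (is_derive_id1 t)).
by apply; rewrite add0r.
Qed.

Lemma logit_derive t : 0 < t < 1 ->
  is_derive t (1 : R) logit (t * (1 - t))^-1.
Proof.
move=> /andP[t0 t1]; have t1' : 0 < 1 - t by rewrite subr_gt0.
have h1 := @der_comp (@ln R) (fun x => 1 - x) t _ _ (is_derive1_ln t1') (is_derive_1B t).
have /is_derive_eq := derD (is_derive1_ln t0) (is_deriveN h1); apply.
by field; rewrite !gt_eqF.
Qed.

(** The first term comes from (t (1 - t))^3; the second from logit^a / a!, whose derivative is
    logit^(a-1) / (a-1)! divided by t (1 - t). *)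
Lemma rho_derive a t : 0 < t < 1 ->
  is_derive t (1 : R) (fun x => x * (1 - x) * kap a x)
    (3 * (1 - 2 * t) * kap a t + kap_pred a t).
Proof.
move=> t01; have [t0 t1] := andP t01.
have t1' : 0 < 1 - t by rewrite subr_gt0.
apply: (@der_near (fun x => (x * (1 - x)) ^+ 3 * (logit x ^+ a / a`!%:R))).
  apply: filterS (near01 t01) => z z01; rewrite /kap z01; ring.
have hb := derM (is_derive_id1 t) (is_derive_1B t).
have hb3 : is_derive t (1 : R) (fun x => (x * (1 - x)) ^+ 3)
    (3 * (t * (1 - t)) ^+ 2 * (1 - 2 * t)).
  have -> : (fun x : R => (x * (1 - x)) ^+ 3) =
      (fun x => x * (1 - x) * (x * (1 - x) * (x * (1 - x)))).
    by apply/funext => x; ring.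
  by have /is_derive_eq := derM hb (derM hb hb); apply; ring.
have hl : is_derive t (1 : R) (fun x => logit x ^+ a / a`!%:R)
    (if a is b.+1 then logit t ^+ b / b`!%:R / (t * (1 - t)) else 0).
  case: a => [|b]; first by under eq_fun do rewrite expr0; exact: der_cst.
  have h1 (y : R) : is_derive y (1 : R) (fun x => x ^+ b.+1 : R) (b.+1%:R * y ^+ b).
    have -> : (fun x => x ^+ b.+1 : R) = (fun x : R => x) ^+ b.+1.
      by apply/funext => x; rewrite exprfctE.
    have /is_derive_eq := @is_deriveX _ _ (fun x : R => x) b.+1 y 1 1 (is_derive_id1 y).
    by apply; rewrite [_ *: _]mulr1.
  have h2 := @der_comp (fun x => x ^+ b.+1) logit t _ _ (h1 (logit t)) (logit_derive t01).
  have /is_derive_eq := derM h2 (is_derive_cst (b.+1`!%:R^-1 : R) t (1 : R)).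
  apply; rewrite /cst mulr0 addr0 factS natrM.
  have f0 : b`!%:R != 0 :> R by rewrite pnatr_eq0 -lt0n fact_gt0.
  have b0 : b.+1%:R != 0 :> R by rewrite pnatr_eq0.
  have u0 : t * (1 - t) != 0 by rewrite mulf_neq0// gt_eqF.
  move: f0 b0 u0; move: (b`!%:R) (b.+1%:R) (t * (1 - t)) (logit t ^+ b) => p q u l p0 q0 u0.
  by field; rewrite p0 q0 u0.
have /is_derive_eq := derM hb3 hl; apply.
rewrite /kap_pred /kap t01; case: a {hl} => [|b].
  by ring.
rewrite ?t01; congr (_ + _); first by ring.
have f0 : b`!%:R != 0 :> R by rewrite pnatr_eq0 -lt0n fact_gt0.
by field; rewrite f0 !gt_eqF.
Qed.

(** Inside the interval, divide the differentiable function of [rho_derive] by t (1 - t); elsewhere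
    the value is 0, and the bounds by |t| and |1 - t| give the limit. *)
Lemma kap_continuous a t : {for t, continuous (kap a)}.
Proof.
have [t01|] := boolP (0 < t < 1).
  have [t0 t1] := andP t01.
  have b0 : t * (1 - t) != 0 by rewrite mulf_neq0// gt_eqF// subr_gt0.
  apply: (@near_eq_continuous _ (fun x => (x * (1 - x) * kap a x) * (x * (1 - x))^-1)).
    apply: filterS (near01 t01) => z /andP[z0 z1].
    by rewrite mulrAC mulfV ?mul1r// mulf_neq0// gt_eqF// subr_gt0.
  apply: fcontM; first by apply: fderiv_cont; have [] := rho_derive a t01.
  apply: fcontV => //; apply: fcontM; first exact: fcont_id.
  by apply: fcontB; [exact: fcont_cst|exact: fcont_id].
rewrite negb_and -!leNgt => t01; apply: fcont_near => e e0.
have -> : kap a t = 0 by apply: kap_out; rewrite negb_and -!leNgt.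
apply/nbhs_normP; exists e => //= z /=; rewrite sub0r normrN => hz.
have [z01|z01] := boolP (0 < z < 1); last by rewrite kap_out// normr0.
move: z01 => /andP[z0 z1].
case/orP: t01 => t01.
  apply: (le_lt_trans (kap_boundl a z)); rewrite gtr0_norm//.
  apply: le_lt_trans hz; rewrite distrC; apply: le_trans (ler_norm _).
  by move: t01; clear; lra.
apply: (le_lt_trans (kap_boundr a z)); rewrite gtr0_norm ?subr_gt0//.
apply: le_lt_trans hz; apply: le_trans (ler_norm _).
by move: t01; clear; lra.
Qed.

Lemma measurable_kap a : measurable_fun [set: R] (kap a).
Proof. by apply: continuous_measurable_fun => t; exact: kap_continuous. Qed.

End Psi.

(** * Integration by parts on the cube *)

Section IBP.
Variable R : realType.
Local Notation mu := (@lebesgue_measure R).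
Local Notation L := (lebesgue R).

Lemma kap_pred_continuous a (t : R) : {for t, continuous (@kap_pred R a)}.
Proof. by case: a => [|a]; [exact: fcont_cst|exact: kap_continuous]. Qed.

Lemma kap_pred_out a (t : R) : ~~ (0 < t < 1) -> kap_pred a t = 0.
Proof. by case: a => [|a]//; exact: kap_out. Qed.

(** The integrand is the derivative of t (1 - t) [kap a t] h(t), which vanishes at 0 and at 1. *)
Lemma ibp1 a (h h' : R -> R) :
  (forall t, is_derive t (1 : R) h (h' t)) -> (forall t, {for t, continuous h'}) ->
  \int[mu]_t (kap a t * (3 * (1 - 2 * t) * h t + t * (1 - t) * h' t) +
              kap_pred a t * h t) = 0.
Proof.
move=> hd h'c.
pose g t := kap a t * (3 * (1 - 2 * t) * h t + t * (1 - t) * h' t) +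
  kap_pred a t * h t.
rewrite -[LHS]/(\int[mu]_t g t).
have hc t : {for t, continuous h} by apply: fderiv_cont; have [] := hd t.
have gc t : {for t, continuous g}.
  have l2 : {for t, continuous (fun x : R => 3 * (1 - 2 * x))}.
    apply: fcontM; first exact: fcont_cst.
    apply: fcontB; first exact: fcont_cst.
    by apply: fcontM; [exact: fcont_cst|exact: fcont_id].
  have b2 : {for t, continuous (fun x : R => x * (1 - x))}.
    apply: fcontM; first exact: fcont_id.
    by apply: fcontB; [exact: fcont_cst|exact: fcont_id].
  have c1 : {for t, continuous (fun x : R => 3 * (1 - 2 * x) * h x + x * (1 - x) * h' x)}.
    exact: (fcontD (fcontM l2 (hc t)) (fcontM b2 (h'c t))).
  have c2 := fcontM (@kap_pred_continuous a t) (hc t).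
  have c3 := fcontM (@kap_continuous R a t) c1.
  exact: (fcontD c3 c2).
have gout (t : R) : ~~ (0 < t < 1) -> g t = 0.
  by move=> t01; rewrite /g kap_out// kap_pred_out// !mul0r addr0.
have -> : \int[mu]_t g t = \int[mu]_(t in `[0, 1]) g t.
  rewrite [RHS]Rintegral_mkcond; congr (Rintegral _ _ _).
  apply/funext => t; rewrite patchE; case: ifPn => //.
  rewrite notin_setE/= in_itv/= => /negP; rewrite negb_and -!ltNge => t01.
  apply: gout; rewrite negb_and -!leNgt; apply/orP.
  by case/orP: t01 => /ltW; [left|right].
pose G (t : R) := t * (1 - t) * kap a t * h t.
have Gd (t : R) : 0 < t < 1 -> is_derive t (1 : R) G (g t).
  move=> t01; have /is_derive_eq := derM (rho_derive a t01) (hd t); apply.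
  by rewrite /g; ring.
have Gc t : {for t, continuous G}.
  have b2 : {for t, continuous (fun x : R => x * (1 - x))}.
    apply: fcontM; first exact: fcont_id.
    by apply: fcontB; [exact: fcont_cst|exact: fcont_id].
  exact: (fcontM (fcontM b2 (@kap_continuous R a t)) (hc t)).
rewrite /Rintegral (@continuous_FTC2 R g G 0 1 ltr01).
- by rewrite /G !mul0r subrr mulr0 !mul0r -EFinB subr0.
- by apply: continuous_in_subspaceT => t _; exact: gc.
- split.
  + by move=> t; rewrite in_itv/= => t01; have [] := Gd t t01.
  + by apply: cvg_at_right_filter; exact: Gc.
  + by apply: cvg_at_left_filter; exact: Gc.
- move=> t; rewrite in_itv/= => t01.
  by rewrite derive1E; have [_ ->] := Gd t t01.
Qed.

Variables (n : nat) (F : mpoly n R).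

Definition KAP (al : 'I_n -> nat) (u : euclid R n) : R :=
  \prod_i kap (al i) (tnth u i).

Lemma KAP_out al u : ~ cube u -> KAP al u = 0.
Proof.
move=> /existsNP[i /negP hi]; rewrite /KAP (bigD1 i)//= kap_out//.
by rewrite mul0r.
Qed.

Lemma KAP_bound al u : `|KAP al u| <= 1.
Proof.
suff /andP[] : 0 <= `|KAP al u| <= 1 by [].
rewrite /KAP normr_prod; apply: (big_ind (fun x => 0 <= x <= 1)) => //.
- by rewrite ler01 lexx.
- move=> x y /andP[x0 x1] /andP[y0 y1].
  by rewrite mulr_ge0//= mulr_ile1.
- by move=> i _; rewrite normr_ge0 kap_bound1.
Qed.

Lemma measurable_KAP al : measurable_fun setT (KAP al).
Proof.
rewrite /KAP.
have H (s : seq 'I_n) : measurable_fun [set: euclid R n]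
    (fun u => \prod_(i <- s) kap (al i) (tnth u i)).
  elim: s => [|i s IH].
    rewrite (_ : (fun _ => _) = (fun=> 1)); first exact: measurable_cst.
    by apply/funext => u; rewrite big_nil.
  rewrite (_ : (fun _ => _) = (fun u : euclid R n => kap (al i) (tnth u i) *
     \prod_(j <- s) kap (al j) (tnth u j))); last first.
    by apply/funext => u; rewrite big_cons.
  apply: measurable_funM => //.
  exact: measurableT_comp (measurable_kap (al i)) (measurable_tnth i).
exact: H.
Qed.

Lemma KAP_bcs al : bcs (KAP al).
Proof.
split; first exact: measurable_KAP.
by exists 1 => u; split=> h; [exact: KAP_bound|exact: KAP_out].
Qed.

Lemma meval_cube_bounded (p : mpoly n R) :
  exists B, forall u : euclid R n, cube u -> `|meval (tnth u) p| <= B.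
Proof.
have [B _ hB] := meval_bounded p 1; exists B => u cu; apply: hB => i.
by have /andP[h1 h2] := cu i; rewrite gtr0_norm// ltW.
Qed.

Definition hpsi (Q : mpoly n R) (s : R) (u : euclid R n) : R :=
  meval (tnth u) Q * psi s (meval (tnth u) F).

Definition itg al Q s (u : euclid R n) : R := KAP al u * hpsi Q s u.

Definition Lam al Q s : R := \int[L n]_u itg al Q s u.

Lemma itg_bcs al Q s : 0 < s -> bcs (itg al Q s).
Proof.
move=> s0; apply: (bcsM (KAP_bcs al)).
  apply: measurable_funM; first exact: measurable_meval.
  exact: measurableT_comp (measurable_psi s0) (measurable_meval F).
have [B hB] := meval_cube_bounded Q; have [C hC] := meval_cube_bounded F.
pose M := Num.max 1 C.
exists (B * expR (s * ln M)) => u cu; rewrite normrM ler_pM//; first exact: hB.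
rewrite ger0_norm ?psi_ge0//; apply: psi_bound; first exact: ltW.
  by rewrite le_max lexx.
by rewrite le_max (le_trans (ler_norm _) (hC u cu)) orbT.
Qed.

(** The operator d_i o t_i (1 - t_i) conjugated by the weight (t_i (1 - t_i))^2: [Dp i s Q] times
    F^(s-1) is 3 (1 - 2 t_i) Q F^s + t_i (1 - t_i) d_i (Q F^s). One power of F is given up to remain
    polynomial. *)
Definition Dp i (s : R) (Q : mpoly n R) : mpoly n R :=
  mpolyC n 3 * (1 - mpolyC n 2 * mpolyX R (mnm1 i)) * Q * F +
  mpolyX R (mnm1 i) * (1 - mpolyX R (mnm1 i)) *
    (mderiv i Q * F + mpolyC n s * Q * mderiv i F).

Definition apred (al : 'I_n -> nat) i : 'I_n -> nat :=
  fun j => if j == i then (al j).-1 else al j.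

(** Integration by parts in t_i alone: the transposed operator takes one power off the i-th
    logarithm and changes the sign. The condition 1 < s makes the integrand C^1 along lines. *)
Lemma Lam_ibp al i Q s : 1 < s ->
  Lam al (Dp i s Q) (s - 1) = if al i == 0%N then 0 else - Lam (apred al i) Q s.
Proof.
move=> s1; have s0 : 0 < s by apply: lt_trans s1.
have s10 : 0 < s - 1 by rewrite subr_gt0.
(* [apred] leaves the exponent 0 unchanged, whereas the corresponding term of the derivative
   vanishes; the factor 0 or 1 makes up for this. *)
pose g u := itg al (Dp i s Q) (s - 1) u +
  (if al i == 0%N then 0 else 1) * itg (apred al i) Q s u.
have b1 := itg_bcs al (Dp i s Q) s10.
have b2 := itg_bcs (apred al i) Q s0.
have b2' : bcs (fun u => (if al i == 0%N then 0 else 1) * itg (apred al i) Q s u).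
  have := bcsM b2 (h := fun=> if al i == 0%N then 0 else 1).
  rewrite (_ : (fun u => _ * (fun=> _) u) = (fun u => (if al i == 0%N then 0 else 1) * itg (apred al i) Q s u)).
    apply; first exact: measurable_cst.
    by exists 1 => u _; case: ifP; rewrite ?normr0 ?normr1.
  by apply/funext => u; rewrite mulrC.
have bg : bcs g by exact: bcsD.
have : \int[L n]_u g u = 0.
  apply: (bcs_partial0 (i := i) bg) => u.
  pose c := \prod_(j | j != i) kap (al j) (tnth u j).
  pose v (t : R) := meval (upd (tnth u) i t) F.
  pose h (t : R) := c * (meval (upd (tnth u) i t) Q * psi s (v t)).
  pose h' (t : R) := c * (meval (upd (tnth u) i t) (mderiv i Q) * psi s (v t) +
    meval (upd (tnth u) i t) Q * ((s * psi (s - 1) (v t)) * meval (upd (tnth u) i t) (mderiv i F))).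
  have dm p t := is_derive_meval (tnth u) i p t.
  have cm p t : {for t, continuous (fun t : R => meval (upd (tnth u) i t) p)}.
    by apply: fderiv_cont; have [] := dm p t.
  have hd (t : R) : is_derive t (1 : R) h (h' t).
    have d1 := @der_comp R (psi s) v t _ _ (psi_derive (v t) s1) (dm F t).
    exact: (derZ c (derM (dm Q t) d1)).
  have h'c t : {for t, continuous h'}.
    have cv : {for t, continuous v} by exact: cm.
    have cp r : 0 < r -> {for t, continuous (fun t : R => psi r (v t))}.
      move=> r0; apply: (@continuous_comp _ _ _ v (psi r)) => //.
      exact: psi_continuous.
    apply: fcontM; first exact: fcont_cst.
    apply: fcontD; first exact: fcontM (cm _ t) (cp _ s0).
    apply: fcontM (cm _ t) _; apply: fcontM _ (cm _ t).
    by apply: fcontM (cp _ s10); exact: fcont_cst.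
  have E (t : R) : g (updt u i t) = kap (al i) t * (3 * (1 - 2 * t) * h t + t * (1 - t) * h' t) +
              kap_pred (al i) t * h t.
    have e0 : tnth (updt u i t) i = t by rewrite tnth_updt /upd eqxx.
    have ej j : j != i -> tnth (updt u i t) j = tnth u j.
      by move=> ji; rewrite tnth_updt /upd (negbTE ji).
    have K1 : KAP al (updt u i t) = kap (al i) t * c.
      rewrite /KAP (bigD1 i)//= e0; congr (_ * _); apply: eq_bigr => j ji.
      by rewrite ej.
    have K2 : (if al i == 0%N then 0 else 1) * KAP (apred al i) (updt u i t) =
        kap_pred (al i) t * c.
      rewrite /KAP (bigD1 i)//= e0 /apred eqxx /kap_pred.
      case: (al i) => [|b]; first by rewrite !mul0r.
      rewrite mul1r; congr (_ * _); apply: eq_bigr => j ji.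
      by rewrite ej// (negbTE ji).
    rewrite /g /itg mulrA K2 K1.
    rewrite /hpsi !tnth_updt -/(v t).
    have -> : psi s (v t) = v t * psi (s - 1) (v t) by rewrite -psiS subrK.
    rewrite /h' /h.
    have -> : psi s (v t) = v t * psi (s - 1) (v t) by rewrite -psiS subrK.
    rewrite /Dp !(mevalD, mevalM, mevalB, mevalN, mevalC, meval1, mevalXU) -/(v t).
    rewrite (_ : upd (tnth u) i t i = t); last by rewrite /upd eqxx.
    move: (psi (s - 1) (v t)) => x4; move: (v t) => x5.
    move: (meval _ Q) (meval _ (mderiv i Q)) (meval _ (mderiv i F)) => x1 x2 x3.
    by ring.
  under eq_Rintegral do rewrite E.
  exact: ibp1.
rewrite /g RintegralD//; [|exact: bcs_integrable b1|exact: bcs_integrable b2'].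
rewrite RintegralZl//; last exact: bcs_integrable b2.
move=> /eqP; rewrite addr_eq0 => /eqP E; rewrite [LHS]E; case: ifP => _.
  by rewrite mul0r oppr0.
by rewrite mul1r.
Qed.

End IBP.

(** * The recurrence *)

Section CubeRecurrence.
Variable R : realType.
Local Notation L := (lebesgue R).
Variable n : nat.

Lemma mderiv_comp_spec (A : comNzRingType) (lq : n.+1.-tuple (mpoly n A)) (i : 'I_n)
    (P : mpoly n.+1 A) :
  (forall j, mderiv i (tnth lq j) = if j == lift ord0 i then 1 else 0) ->
  mderiv i (comp_mpoly lq P) = comp_mpoly lq (mderiv (lift ord0 i) P).
Proof.
move=> Hl; elim/mpoly_ring_ind: P => [c|j|p q hp hq|p q hp hq].
- by rewrite comp_mpolyC !mderivC comp_mpoly0.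
- rewrite comp_mpolyXU mderivX -tnth_nth Hl mnm1E.
  have [->|ji] := eqVneq j (lift ord0 i).
    rewrite (_ : mnm_sub _ _ = mnm0); last first.
      by apply/mnmP => k; rewrite mnmBE mnm0E subnn.
    by rewrite mpolyX0 scale1r comp_mpoly1.
  by rewrite scale0r comp_mpoly0.
- by rewrite comp_mpolyD !mderivD comp_mpolyD hp hq.
- by rewrite rmorphM/= !mderivM rmorphD/= !rmorphM/= hp hq.
Qed.

Lemma mderiv_map (A B : comNzRingType) (f : {rmorphism A -> B}) m (i : 'I_m)
    (P : mpoly m A) :
  mderiv i (map_mpoly f P) = map_mpoly f (mderiv i P).
Proof.
elim/mpoly_ring_ind: P => [c|j|p q hp hq|p q hp hq].
- by rewrite map_mpolyC ?raddf0// !mderivC raddf0.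
- by rewrite map_mpolyX !mderivX map_mpolyZ map_mpolyX rmorph_nat.
- by rewrite raddfD/= !mderivD raddfD/= hp hq.
- by rewrite rmorphM/= !mderivM rmorphD/= !rmorphM/= hp hq.
Qed.

(* In n + 1 variables over rat, variable 0 stands for the exponent s. *)
Definition spec_tuple (s : R) : n.+1.-tuple (mpoly n R) :=
  [tuple if unlift ord0 j is Some i then mpolyX R (mnm1 i) else mpolyC n s | j < n.+1].

Definition spec (s : R) (P : mpoly n.+1 rat) : mpoly n R :=
  comp_mpoly (spec_tuple s) (map_mpoly ratr P).

Lemma specD s P Q : spec s (P + Q) = spec s P + spec s Q.
Proof. by rewrite /spec rmorphD/= rmorphD. Qed.

Lemma specN s P : spec s (- P) = - spec s P.
Proof. by rewrite /spec rmorphN/= rmorphN. Qed.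

Lemma specM s P Q : spec s (P * Q) = spec s P * spec s Q.
Proof. by rewrite /spec rmorphM/= rmorphM. Qed.

Lemma specXn s P k : spec s (P ^+ k) = spec s P ^+ k.
Proof. by rewrite /spec rmorphXn/= rmorphXn. Qed.

Lemma spec1 s : spec s 1 = 1.
Proof. by rewrite /spec rmorph1/= rmorph1. Qed.

Lemma specC s c : spec s (mpolyC n.+1 c) = mpolyC n (ratr c).
Proof. by rewrite /spec map_mpolyC ?raddf0// comp_mpolyC. Qed.

Lemma specX0 s : spec s (mpolyX rat (mnm1 ord0)) = mpolyC n s.
Proof.
by rewrite /spec map_mpolyX comp_mpolyXU -tnth_nth tnth_mktuple unlift_none.
Qed.

Lemma specXS s i : spec s (mpolyX rat (mnm1 (lift ord0 i))) = mpolyX R (mnm1 i).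
Proof.
by rewrite /spec map_mpolyX comp_mpolyXU -tnth_nth tnth_mktuple liftK.
Qed.

Lemma spec_deriv s i P : mderiv i (spec s P) = spec s (mderiv (lift ord0 i) P).
Proof.
rewrite /spec mderiv_comp_spec ?mderiv_map// => j.
rewrite tnth_mktuple; have [k ->|->] := unliftP ord0 j.
  rewrite mderivX mnm1E (inj_eq lift_inj).
  have [->|ki] := eqVneq k i.
    rewrite (_ : mnm_sub _ _ = mnm0) ?mpolyX0 ?scale1r//.
    by apply/mnmP => l; rewrite mnmBE mnm0E subnn.
  by rewrite scale0r.
by rewrite mderivC (negbTE (neq_lift _ _)).
Qed.

Definition mlift (P : mpoly n rat) : mpoly n.+1 rat :=
  comp_mpoly [tuple mpolyX rat (mnm1 (lift ord0 i)) | i < n] P.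

Lemma spec_mlift s P : spec s (mlift P) = map_mpoly ratr P.
Proof.
elim/mpoly_ring_ind: P => [c|j|p q hp hq|p q hp hq].
- by rewrite /mlift comp_mpolyC specC map_mpolyC// raddf0.
- by rewrite /mlift comp_mpolyXU -tnth_nth tnth_mktuple specXS map_mpolyX.
- by rewrite /mlift rmorphD/= specD hp hq rmorphD.
- by rewrite /mlift rmorphM/= specM hp hq rmorphM.
Qed.

Variables (W F : mpoly n rat).
Let Fr : mpoly n R := map_mpoly ratr F.
Let F1 := mlift F.
Let W1 := mlift W.
Let X0 := mpolyX rat (mnm1 (ord0 : 'I_n.+1)).

(** [Dp] with a symbolic exponent: after k operators the power of F is s - k. *)
Definition DpQ (i : 'I_n) (k : nat) (Q : mpoly n.+1 rat) : mpoly n.+1 rat :=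
  let Xi := mpolyX rat (mnm1 (lift ord0 i)) in
  mpolyC n.+1 3 * (1 - mpolyC n.+1 2 * Xi) * Q * F1 +
  Xi * (1 - Xi) * (mderiv (lift ord0 i) Q * F1 +
    (X0 - mpolyC n.+1 k%:R) * Q * mderiv (lift ord0 i) F1).

Lemma spec_DpQ s i k Q : spec s (DpQ i k Q) = Dp Fr i (s - k%:R) (spec s Q).
Proof.
rewrite /DpQ /Dp !(specD, specM, specN, specC, spec1, specX0, specXS).
by rewrite -!spec_deriv spec_mlift -/Fr !ratr_nat mpolyCB (ratr_nat _ 1) mpolyC1.
Qed.

Fixpoint DwQ (k : nat) (w : seq 'I_n) (Q : mpoly n.+1 rat) : mpoly n.+1 rat :=
  if w is i :: w' then DwQ k.+1 w' (DpQ i k Q) else Q.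

(** Each letter i uses up one power of the i-th logarithm, so only the number of occurrences counts.
    A word in which some letter exceeds the available power gives zero; this triangularity lets a
    test function isolate one word. *)
Lemma Lam_word (s : R) w k al Q : (k + size w)%:R < s ->
  Lam Fr al (spec s (DwQ k w Q)) (s - (k + size w)%:R) =
  if [forall i, (count_mem i w <= al i)%N] then
    (-1) ^+ size w * Lam Fr (fun i => (al i - count_mem i w)%N) (spec s Q) (s - k%:R)
  else 0.
Proof.
elim: w k al Q => [|i w IH] k al Q /= hs.
  case: ifP => [_|/negP[]]; last by apply/forallP.
  rewrite expr0 mul1r addn0; congr (Lam _ _ _ _).
  by apply/funext => j; rewrite subn0.
rewrite addnS -addSn IH; last by rewrite addSnnS.
have hk : 1 < s - k%:R.
  rewrite ltrBrDr; apply: le_lt_trans hs.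
  by rewrite addrC natr1 ler_nat; lia.
rewrite spec_DpQ -natr1 opprD addrA Lam_ibp//.
case: ifP => [/forallP h1|/negbT]; last first.
  rewrite negb_forall => /existsP[j hj]; case: ifP => // /forallP/(_ j) h2.
  by move: hj; rewrite (leq_trans _ h2)// leq_addl.
case: ifP => [h0|h0].
  case: ifP => [/forallP/(_ i)|_]; last by rewrite mulr0.
  rewrite eqxx add1n => h2; exfalso.
  by move: h0; rewrite subn_eq0 leqNgt h2.
case: ifP => [_|/negP[]]; last first.
  apply/forallP => j; case: eqVneq => [<-|_]; last exact: h1.
  by rewrite add1n ltnNge -subn_eq0 h0.
have -> : apred (fun j => (al j - count_mem j w)%N) i =
    (fun j => (al j - ((i == j) + count_mem j w))%N).
  apply/funext => j; rewrite /apred [j == i]eq_sym.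
  by case: eqVneq => [<-|_]; rewrite ?add0n// add1n subnS.
by rewrite exprS mulN1r mulrN mulNr.
Qed.

Lemma Lam0 al s : Lam Fr al 0 s = 0.
Proof.
rewrite /Lam /Rintegral integral0_eq// => u _.
by rewrite /itg /hpsi meval0 mul0r mulr0.
Qed.

Lemma LamD al P Q s : 0 < s -> Lam Fr al (P + Q) s = Lam Fr al P s + Lam Fr al Q s.
Proof.
move=> s0; rewrite /Lam -RintegralD//; try exact: bcs_integrable (itg_bcs _ _ _ s0).
by apply: eq_Rintegral => u _; rewrite /itg /hpsi mevalD mulrDl mulrDr.
Qed.

Lemma LamZ al (c : R) Q s : 0 < s -> Lam Fr al (mpolyC n c * Q) s = c * Lam Fr al Q s.
Proof.
move=> s0; rewrite /Lam -RintegralZl//; last exact: bcs_integrable (itg_bcs _ _ _ s0).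
by apply: eq_Rintegral => u _; rewrite /itg /hpsi mevalM mevalC -mulrA mulrCA.
Qed.

Lemma Lam_sum al (I : finType) (Q : I -> mpoly n R) s : 0 < s ->
  Lam Fr al (\sum_i Q i) s = \sum_i Lam Fr al (Q i) s.
Proof.
move=> s0; apply: (big_morph (fun Q => Lam Fr al Q s)); last exact: Lam0.
by move=> x y; exact: LamD.
Qed.

Lemma Lam_mulF al Q s k : Lam Fr al (Q * Fr ^+ k) s = Lam Fr al Q (s + k%:R).
Proof.
rewrite /Lam; apply: eq_Rintegral => u _; rewrite /itg /hpsi mevalM psiDn.
have -> : meval (tnth u) (Fr ^+ k) = meval (tnth u) Fr ^+ k by exact: rmorphXn.
by rewrite -[_ * _ * psi _ _]mulrA.
Qed.

Local Notation msz := (mmeasure (@mdeg _)).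

Let mszM m (p q : mpoly m rat) a b : (msz p <= a)%N -> (msz q <= b)%N ->
  (msz (p * q) <= (a + b).+1)%N.
Proof. by move=> ha hb; apply: (leq_trans (msizeM_le _ _)); rewrite ltnS leq_add. Qed.

Let mszD m (p q : mpoly m rat) a : (msz p <= a)%N -> (msz q <= a)%N ->
  (msz (p + q) <= a)%N.
Proof.
by move=> ha hb; apply: (leq_trans (msizeD_le _ _)); rewrite geq_max; apply/andP.
Qed.

Let mszB m (p q : mpoly m rat) a : (msz p <= a)%N -> (msz q <= a)%N ->
  (msz (p - q) <= a)%N.
Proof. by move=> ha hb; apply: mszD => //; rewrite msizeN. Qed.

Let mszC m (c : rat) : (msz (mpolyC m c) <= 1)%N.
Proof. by rewrite msizeC; case: (c != 0). Qed.

Let msz1 m : (msz (1 : mpoly m rat) <= 1)%N.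
Proof. by rewrite -(mpolyC1 m); exact: mszC. Qed.

Let mszX m i : (msz (mpolyX rat (mnm1 i : multinom m)) <= 2)%N.
Proof. by rewrite msizeX mdeg1. Qed.

Let mszW m (p : mpoly m rat) a b : (msz p <= a)%N -> (a <= b)%N -> (msz p <= b)%N.
Proof. exact: leq_trans. Qed.

Let msz_exp m (p : mpoly m rat) k : (msz (p ^+ k) <= (k * (msz p).+1).+1)%N.
Proof.
elim: k => [|k IH]; first by rewrite expr0 mul0n; exact: msz1.
by rewrite exprS (mszW (mszM (leqnn _) IH))//; lia.
Qed.

Let a := msz F1.

(** Linear growth of the degree along a word is what the counting argument rests on; the constant 20
    is generous. *)
Let msz_DpQ i k Q : (msz (DpQ i k Q) <= msz Q + a + 20)%N.
Proof.
rewrite /DpQ /=; set Xi := mpolyX _ _.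
have x2 : (msz Xi <= 2)%N by exact: mszX.
have h1 : (msz (1 - mpolyC n.+1 2 * Xi) <= 4)%N.
  apply: mszB; first exact: mszW (msz1 _) _.
  exact: mszW (mszM (mszC _ _) x2) _.
have h2 : (msz (1 - Xi) <= 2)%N by apply: mszB => //; exact: mszW (msz1 _) _.
have h3 : (msz (X0 - mpolyC n.+1 k%:R) <= 2)%N.
  by apply: mszB; [exact: mszX|exact: mszW (mszC _ _) _].
have d1 : (msz (mderiv (lift ord0 i) Q) <= msz Q)%N by exact: msize_mderiv.
have d2 : (msz (mderiv (lift ord0 i) F1) <= a)%N by exact: msize_mderiv.
apply: mszD.
  by apply: mszW (mszM (mszM (mszM (mszC _ 3) h1) (leqnn _)) (leqnn _)) _; rewrite -/a; lia.
apply: mszW (mszM (mszM x2 h2) (_ : (_ <= msz Q + a + 6)%N)) _; last by lia.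
apply: mszD; first by apply: mszW (mszM d1 (leqnn _)) _; rewrite -/a; lia.
by apply: mszW (mszM (mszM h3 (leqnn _)) d2) _; lia.
Qed.

Let msz_DwQ k w Q : (msz (DwQ k w Q) <= msz Q + size w * (a + 20))%N.
Proof.
elim: w k Q => [|i w IH] k Q /=; first by rewrite mul0n addn0.
apply: leq_trans (IH _ _) _; have := msz_DpQ i k Q.
by rewrite mulSn; lia.
Qed.

(** The monomial D^beta written with its letters in increasing order. *)
Definition word B (be : {ffun 'I_n -> 'I_B}) : seq 'I_n :=
  flatten [seq nseq (be i) i | i <- enum 'I_n].

Lemma count_word B (be : {ffun 'I_n -> 'I_B}) i : count_mem i (word be) = be i.
Proof.
rewrite /word count_flatten -map_comp sumnE big_map big_enum/= (bigD1 i)//=.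
rewrite count_nseq/= eqxx mul1n big1 ?addn0// => j ji.
by rewrite count_nseq/= (negbTE ji) mul0n.
Qed.

Lemma size_word B (be : {ffun 'I_n -> 'I_B}) : size (word be) = (\sum_i be i)%N.
Proof.
rewrite /word size_flatten /shape -map_comp sumnE big_map big_enum/=.
by apply: eq_bigr => i _; rewrite size_nseq.
Qed.

Lemma size_word_le B (be : {ffun 'I_n -> 'I_B}) : (size (word be) <= n * B)%N.
Proof.
rewrite size_word; apply: (@leq_trans (\sum_(i < n) B)).
  by apply: leq_sum => i _; exact: ltnW.
by rewrite sum_nat_const card_ord.
Qed.

(** Every contribution to the degree is at most a constant times B, with a constant that does not
    involve B. *)
Let size_arith e j mw w B : (e < B)%N -> (j < B)%N -> (w <= n * B)%N ->
  (((e * 3 + 1 + (mw + j * a.+1 + 2 + w * (a + 20))).+1 +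
    ((n * B - w) * a.+1).+1).+1 <= (mw + 14 + a + n * (2 * a + 21) + a) * B)%N.
Proof.
clear => eB jB wB.
have k1 : ((n * B - w) * a.+1 <= n * B * a.+1)%N by rewrite leq_mul2r leq_subr orbT.
have k2 : (w * (a + 20) <= n * B * (a + 20))%N by rewrite leq_mul2r wB orbT.
have k3 : (j * a.+1 <= B * a.+1)%N by rewrite leq_mul2r (ltnW jB) orbT.
have B0 : (0 < B)%N by exact: leq_ltn_trans eB.
have k4 : (mw <= mw * B)%N by rewrite leq_pmulr.
have k6 : (n * (2 * a + 21) * B = n * B * a.+1 + n * B * (a + 20))%N.
  by rewrite -addn1; ring.
have k7 : (B * a.+1 = a * B + B)%N by rewrite mulnS mulnC addnC.
rewrite !mulnDl k6; move: k1 k2 k3 k4 k7.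
move: ((n * B - w) * _)%N (n * B * a.+1)%N (n * B * (a + 20))%N (w * _)%N.
move: (B * a.+1)%N (j * a.+1)%N (mw * B)%N (a * B)%N => x1 x2 x3 x4 x5 x6 x7 x8.
lia.
Qed.

(* Eliminating x: more operators s^e S^j D^beta than monomials of the degrees
   that occur, hence a relation between them that does not involve x. *)
Lemma cube_recurrence : exists B (c : 'I_B -> 'I_B -> rat),
  (exists e j, c e j != 0) /\ exists X : R, forall s, X < s ->
  \sum_(j < B) (\sum_(e < B) ratr (c e j) * s ^+ e) *
    Lam Fr (fun=> 0%N) (map_mpoly ratr W) (s + j%:R) = 0.
Proof.
pose C := (msz W1 + 14 + a + n * (2 * a + 21) + a)%N.
(* B^(n+2) operators stand against (C B)^(n+1) monomials in the n + 1 variables, and B exceeds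
   C^(n+1). *)
pose B := (C ^ n.+1).+1.
have B0 : (0 < B)%N by [].
pose K := (n * B)%N.
pose I : finType := ('I_B * 'I_B * {ffun 'I_n -> 'I_B})%type.
(* A word of length w leaves the power F^(s - w); the last factor brings all of them to the common
   power F^(s - K). *)
pose Q (i : I) : mpoly n.+1 rat :=
  X0 ^+ i.1.1 * DwQ 0 (word i.2) (W1 * F1 ^+ i.1.2) * F1 ^+ (K - size (word i.2)).
have Qd i : (msz (Q i) <= C * B)%N.
  rewrite /Q; case: i => [[e j] be] /=.
  have eB := ltn_ord e; have jB := ltn_ord j; have wB := size_word_le be.
  have h0 : (msz (X0 ^+ e) <= e * 3 + 1)%N.
    by apply: mszW (msz_exp _ _) _; have := mszX (ord0 : 'I_n.+1); rewrite -/X0; nia.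
  have h1 : (msz (DwQ 0 (word be) (W1 * F1 ^+ j)%R) <=
      mmeasure (@mdeg _) W1 + j * a.+1 + 2 + size (word be) * (a + 20))%N.
    apply: leq_trans (msz_DwQ _ _ _) _; rewrite leq_add2r.
    by apply: mszW (mszM (leqnn _) (@msz_exp _ F1 j)) _; rewrite -/a; lia.
  have h2 := @msz_exp _ F1 (K - size (word be)); rewrite -/a in h2.
  apply: mszW (mszM (mszM h0 h1) h2) _; rewrite /C /K.
  exact: size_arith.
have cI : ((C * B) ^ n.+1 < #|I|)%N.
  rewrite !card_prod card_ffun !card_ord expnMn /B.
  rewrite -mulnA -[X in (_ < _ * X)%N]expnS ltn_mul2r.
  by rewrite expn_gt0/= ltnS leqnn.
have [c [[i0 ci0] cQ]] := mpoly_dependence Qd cI.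
pose P i := c i != 0.
(* A shortest word that occurs in the relation; its letter counts become the exponents of the
   logarithms. *)
pose im := [arg min_(i < i0 | P i) size (word i.2)].
have [Pim imin] : P im /\ forall i, P i -> (size (word im.2) <= size (word i.2))%N.
  by rewrite /im; case: arg_minnP.
pose be := im.2.
pose al i : nat := be i.
exists B, (fun e j => c (e, j, be)); split.
  by exists im.1.1, im.1.2; rewrite -!surjective_pairing; exact: Pim.
exists (K%:R + 1) => s Ks.
have sK0 : 0 < s - K%:R.
  by rewrite subr_gt0 (lt_trans _ Ks)// ltrDl.
have s0 : 0 < s by apply: lt_trans Ks; rewrite ltr_wpDl.
have hKs w : (w <= K)%N -> w%:R < s :> R.
  by move=> wK; apply: le_lt_trans Ks; rewrite -[leLHS]addr0 lerD// ler_nat.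
pose T (i : I) : R := ratr (c i) * (s ^+ i.1.1 *
   Lam Fr al (spec s (DwQ 0 (word i.2) (W1 * F1 ^+ i.1.2))) (s - (0 + size (word i.2))%:R)).
have sumT : \sum_i T i = 0.
  have := Lam0 al (s - K%:R); rewrite -(_ : spec s 0 = 0); last first.
    by rewrite /spec rmorph0 rmorph0.
  rewrite -cQ (_ : spec s _ = \sum_i spec s (c i *: Q i)); last first.
    by apply: (big_morph (spec s)) => [x y|]; [exact: specD|rewrite /spec !rmorph0].
  rewrite Lam_sum// => H; rewrite -[RHS]H; apply: eq_bigr => -[[e j] b] _.
  rewrite /T /Q /= -mul_mpolyC !specM specC LamZ//; congr (_ * _).
  have -> : spec s (X0 ^+ e) = mpolyC n (s ^+ e).
    by rewrite specXn specX0 [RHS]rmorphXn.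
  rewrite -(mulrA (mpolyC n (s ^+ e))) (LamZ _ _ _ sK0); congr (_ * _).
  rewrite specXn spec_mlift Lam_mulF; congr (Lam _ _ _ _).
  have := size_word_le b; rewrite -/K => hb.
  by rewrite natrB// addrA subrK add0n.
have TE i : T i = if i.2 == be then ratr (c i) * (s ^+ i.1.1 *
    ((-1) ^+ size (word be) * Lam Fr (fun=> 0%N) (map_mpoly ratr W) (s + i.1.2%:R))) else 0.
  rewrite /T; case: i => [[e j] b] /=.
  rewrite Lam_word; last by rewrite add0n; apply: hKs; exact: size_word_le.
  have [->|bbe] := eqVneq b be.
    case: ifP => [_|/negP[]]; last by apply/forallP => i; rewrite count_word.
    do 3 congr (_ * _); rewrite specM specXn !spec_mlift subr0 Lam_mulF.
    by congr (Lam _ _ _ _); apply/funext => i; rewrite count_word subnn.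
  case: ifP => [/forallP hle|_]; last by rewrite !mulr0.
  have [cb0|cb0] := eqVneq (c (e, j, b)) 0; first by rewrite cb0 rmorph0 mul0r.
  (* A word that survives the pairing has no letter more often than [be]; being different from [be],
     it is strictly shorter, against minimality. *)
  exfalso; have := imin (e, j, b) cb0; rewrite /= -/be !size_word leqNgt => /negP; apply.
  have {}hle i : (b i <= be i)%N by have := hle i; rewrite count_word.
  have [i hi] : exists i, b i != be i.
    apply/existsP; apply: contraNT bbe; rewrite negb_exists => /forallP h.
    by apply/eqP/ffunP => i; apply/eqP; have := h i; rewrite negbK.
  rewrite (bigD1 i)//= [X in (_ < X)%N](bigD1 i)//= -addSn leq_add//.
    by rewrite ltn_neqAle hle andbT (inj_eq val_inj).
  by apply: leq_sum => k _; exact: hle.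
have N1 : ((-1) ^+ size (word be) : R) != 0 by rewrite expf_neq0// oppr_eq0 oner_eq0.
apply: (mulfI N1); rewrite mulr0 -[RHS]sumT.
have -> : \sum_i T i = \sum_(p : 'I_B * 'I_B) \sum_b T (p, b).
  by rewrite (pair_bigA _ (fun p b => T (p, b))) /=; apply: eq_bigr => -[].
have -> : \sum_(p : 'I_B * 'I_B) \sum_b T (p, b) = \sum_(j < B) \sum_(e < B) \sum_b T (e, j, b).
  by rewrite [RHS]exchange_big/= (pair_bigA _ (fun e j => \sum_b T (e, j, b))) /=; apply: eq_bigr => -[].
rewrite mulr_sumr.
apply: eq_bigr => j _; rewrite mulr_suml mulr_sumr; apply: eq_bigr => e _.
rewrite (bigD1 be)//= big1 ?addr0; last first.
  by move=> b /negbTE hb; rewrite TE/= hb.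
by rewrite TE/= eqxx -(mulrA (ratr _)) mulrCA; congr (_ * _); exact: mulrCA.
Qed.

End CubeRecurrence.

(** * From the simplex to the cube *)

Section Smoothstep.

(* sg' = 30 (u (1 - u))^2 vanishes to second order at 0 and 1, so that substituting
   sg produces a weight that leaves no boundary terms. *)
Definition sg (A : comNzRingType) (u : A) : A :=
  10%:R * u ^+ 3 - 15%:R * u ^+ 4 + 6%:R * u ^+ 5.

(* y_1 = r sg(u_1), and the remaining coordinates fill the simplex of size
   r (1 - sg(u_1)); the Jacobian is wm times the weight prod (u_i (1 - u_i))^2. *)
Fixpoint Tm (A : comNzRingType) (r : A) (us : seq A) : seq A :=
  if us is u :: us' then r * sg u :: Tm (r * (1 - sg u)) us' else [::].

Fixpoint wm (A : comNzRingType) (r : A) (us : seq A) : A :=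
  if us is u :: us' then 30%:R * r * wm (r * (1 - sg u)) us' else 1.

Section Morph.
Variables (A B : comNzRingType) (f : {rmorphism A -> B}).

Lemma rmorph_sg u : f (sg u) = sg (f u).
Proof.
have fM c k : f (c%:R * u ^+ k) = c%:R * f u ^+ k.
  by rewrite (rmorphM f c%:R) rmorph_nat rmorphXn.
by rewrite /sg rmorphD rmorphB !fM.
Qed.

Lemma map_Tm r us : [seq f x | x <- Tm r us] = Tm (f r) [seq f x | x <- us].
Proof.
elim: us r => //= u us IH r.
by rewrite IH !rmorphM/= rmorphB rmorph1 rmorph_sg.
Qed.

Lemma rmorph_wm r us : f (wm r us) = wm (f r) [seq f x | x <- us].
Proof.
elim: us r => [|u us IH] r /=; first by rewrite rmorph1.
by rewrite !rmorphM/= rmorph_nat IH rmorphM/= rmorphB rmorph1 rmorph_sg.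
Qed.

End Morph.

Variable R : realType.
Local Notation mu := (@lebesgue_measure R).

Lemma is_derive_pow (k : nat) (x : R) :
  is_derive x (1 : R) (fun t : R => t ^+ k) (k%:R * x ^+ k.-1).
Proof.
have -> : (fun x => x ^+ k : R) = (fun x : R => x) ^+ k.
  by apply/funext => y; rewrite exprfctE.
have /is_derive_eq := @is_deriveX _ _ (fun x : R => x) k x 1 1 (is_derive_id1 x).
by apply; rewrite [_ *: _]mulr1.
Qed.

Lemma sg_derive (t : R) : is_derive t (1 : R) (@sg R) (30 * (t * (1 - t)) ^+ 2).
Proof.
have h := derD (derD (derZ 10 (is_derive_pow 3 t)) (derZ (- 15) (is_derive_pow 4 t)))
  (derZ 6 (is_derive_pow 5 t)).
have -> : @sg R = (fun t => 10 * t ^+ 3 + - 15 * t ^+ 4 + 6 * t ^+ 5).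
  by apply/funext => x; rewrite /sg mulNr.
have /is_derive_eq := h; apply => /=.
by ring.
Qed.

Lemma sg0 : sg (0 : R) = 0. Proof. by rewrite /sg; ring. Qed.

Lemma sg1 : sg (1 : R) = 1. Proof. by rewrite /sg; ring. Qed.

Lemma sg_continuous (t : R) : {for t, continuous (@sg R)}.
Proof. by apply: fderiv_cont; have [] := sg_derive t. Qed.

(** The polynomial [p] is the divided difference of [sg]; by the mean value theorem it equals 30 (z
    (1 - z))^2 at some z strictly between 0 and 1. *)
Lemma sg_mono : {in `[0, 1] &, {homo @sg R : x y / x < y}}.
Proof.
move=> x y; rewrite !in_itv/= => /andP[x0 x1] /andP[y0 y1] xy.
rewrite -subr_gt0.
pose p := 10 * (x ^+ 2 + x * y + y ^+ 2) - 15 * (x + y) * (x ^+ 2 + y ^+ 2) +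
  6 * (x ^+ 4 + x ^+ 3 * y + x ^+ 2 * y ^+ 2 + x * y ^+ 3 + y ^+ 4).
have -> : sg y - sg x = (y - x) * p by rewrite /sg /p; ring.
rewrite mulr_gt0 ?subr_gt0//.
have [z [xz zy E]] : exists z, [/\ x < z, z < y & sg y - sg x = 30 * (z * (1 - z)) ^+ 2 * (y - x)].
  have [z zxy E] := @MVT R (@sg R) (fun t => 30 * (t * (1 - t)) ^+ 2) x y xy
    (fun t _ => sg_derive t) (continuous_subspaceT sg_continuous).
  by move: zxy; rewrite in_itv/= => /andP[xz zy]; exists z.
have -> : p = 30 * (z * (1 - z)) ^+ 2.
  have yx0 : y - x != 0 by rewrite subr_eq0 gt_eqF.
  apply: (mulIf yx0); rewrite -E /sg /p; ring.
have z0 : 0 < z by exact: le_lt_trans xz.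
have z1 : 0 < 1 - z by rewrite subr_gt0; exact: lt_le_trans y1.
by rewrite mulr_gt0// exprn_gt0// mulr_gt0.
Qed.

Lemma sg_itv (t : R) : 0 <= t <= 1 -> 0 <= sg t <= 1.
Proof.
move=> /andP[t0 t1].
have mono (x y : R) : 0 <= x -> x <= y -> y <= 1 -> sg x <= sg y.
  move=> x0; rewrite le_eqVlt => /orP[/eqP->//|xy] y1.
  apply/ltW/sg_mono => //; rewrite in_itv/=.
    by rewrite x0 (le_trans (ltW xy)).
  by rewrite y1 (le_trans x0)// ltW.
by rewrite -{1}sg0 -[X in _ && (_ <= X)]sg1 !mono.
Qed.

(** The substitution y = r sg t has derivative 30 r (t (1 - t))^2, and [kap 0] supplies both the
    square and the restriction to the interval. For r = 0 it is not increasing, hence the separate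
    case. *)
Lemma sg_substitution (phi : R -> R) (r : R) : 0 <= r ->
  {within `[0, r], continuous phi} ->
  (\int[mu]_(y in `[0%R, r]) (phi y)%:E =
   \int[mu]_t (kap 0 t * (30 * r * phi (r * sg t)))%:E)%E.
Proof.
rewrite le_eqVlt => /orP[/eqP<- _|r0 phic].
  rewrite set_itv1 integral_set1; apply/esym/integral0_eq => t _.
  by rewrite mulr0 mul0r mulr0.
have F0 : r * sg (0 : R) = 0 by rewrite sg0 mulr0.
have F1 : r * sg (1 : R) = r by rewrite sg1 mulr1.
have dF (t : R) := derZ r (sg_derive t).
have dFE : derive1 (fun t : R => r * sg t) = (fun t => r * (30 * (t * (1 - t)) ^+ 2)).
  by apply/funext => t; rewrite derive1E; have [_ ->] := dF t.
have cdF (t : R) : {for t, continuous (fun t : R => r * (30 * (t * (1 - t)) ^+ 2) : R)}.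
  have d := derM (is_derive_id1 t) (is_derive_1B t).
  by apply: fderiv_cont; have [] := derZ r (derZ 30 (derM d d)).
have cF (t : R) : {for t, continuous (fun t : R => r * sg t : R)}.
  by apply: fderiv_cont; have [] := dF t.
have := @integration_by_substitution_increasing R (fun t => r * sg t) phi 0 1 ler01.
rewrite F0 F1 => ->.
- rewrite [RHS](_ : _ = \int[mu]_(t in `[0%R, 1%R]) (kap 0 t * (30 * r * phi (r * sg t)))%:E)%E.
    apply: eq_integral => t; rewrite inE/= in_itv/= => t01; rewrite dFE/=; congr EFin.
    rewrite /kap; case: ifP => [_|t01'].
      rewrite expr0 fact0 divr1 mulr1 mulrfctE/=; ring.
    rewrite mulrfctE/=; suff -> : t * (1 - t) = 0 by rewrite expr0n/= !mulr0 mul0r.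
    move: t01 t01'; rewrite [0 < t]lt_def [t < 1]lt_def => /andP[-> ->].
    rewrite !andbT => /negbT; rewrite negb_and !negbK => /orP[/eqP->|/eqP<-].
      by rewrite mul0r.
    by rewrite subrr mulr0.
  rewrite [RHS]integral_mkcond; apply: eq_integral => t _.
  rewrite patchE; case: ifPn => //; rewrite notin_setE/= in_itv/= => t01.
  rewrite kap_out ?mul0r//; apply/negP => /andP[t0 t1]; apply: t01.
  by rewrite !ltW.
- move=> x y hx hy xy; rewrite ltr_pM2l//; exact: sg_mono.
- by rewrite dFE => t _; exact: cdF.
- by rewrite dFE; apply/cvg_ex; eexists; apply: cvg_at_right_filter; exact: cdF.
- by rewrite dFE; apply/cvg_ex; eexists; apply: cvg_at_left_filter; exact: cdF.
- split.
  + by move=> t _; have [] := dF t.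
  + by apply: cvg_at_right_filter; exact: cF.
  + by apply: cvg_at_left_filter; exact: cF.
- exact: phic.
Qed.

End Smoothstep.

(** * The iterated change of variables *)

Section SimplexCube.
Variable R : realType.
Local Notation mu := (@lebesgue_measure R).
Local Notation L := (lebesgue R).

Definition Xs (A : nzRingType) n : seq (mpoly n A) := [seq mpolyX A (mnm1 i) | i <- enum 'I_n].

Lemma map_Xs n (u : euclid R n) : [seq meval (tnth u) q | q <- Xs R n] = u.
Proof.
rewrite -map_comp -[RHS]map_tnth_enum; apply: eq_map => i /=.
by rewrite mevalXU.
Qed.

Definition sub_mpoly (A : nzRingType) n k (q : seq (mpoly n A)) (P : mpoly k A) : mpoly n A :=
  comp_mpoly [tuple nth 0 q i | i < k] P.

Lemma sub_mpoly_meval (A : comNzRingType) n k (q : seq (mpoly n A)) (P : mpoly k A) v :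
  meval v (sub_mpoly q P) = meval (nth 0 [seq meval v x | x <- q]) P.
Proof.
rewrite /sub_mpoly comp_mpoly_meval; apply: meval_eq => i.
rewrite tnth_mktuple; have [h|h] := ltnP i (size q); first by rewrite (nth_map 0).
by rewrite !nth_default ?size_map// meval0.
Qed.

Lemma ec_upd n x (y : euclid R n) x0 : tnth (ec x y) = upd (tnth (ec x0 y)) ord0 x.
Proof.
apply/funext => i; rewrite /upd; case: (unliftP ord0 i) => [j|] ->.
  by rewrite !tnth_ecS.
by rewrite eqxx.
Qed.

Section Param.
Variables (n : nat) (W Q : mpoly n.+1 R) (s : R).
Hypothesis s0 : 0 < s.

(** The integrand over the cube of the inner coordinates, polynomial data depending on the outer
    coordinate x as well. *)
Definition pitg x (u : euclid R n) : R :=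
  KAP (fun=> 0%N) u * (meval (tnth (ec x u)) W * psi s (meval (tnth (ec x u)) Q)).

Lemma pitg_bound M : exists C, forall x u, `|x| <= M ->
  `|pitg x u| <= C * `|KAP (fun=> 0%N) u|.
Proof.
have [B B0 hB] := meval_bounded W (Num.max M 1).
have [C _ hC] := meval_bounded Q (Num.max M 1).
pose D := Num.max 1 C.
exists (B * expR (s * ln D)) => x u xM; rewrite /pitg normrM mulrC.
have [cu|cu] := pselect (cube u); last by rewrite (KAP_out _ cu) normr0 !mulr0.
have hx i : `|tnth (ec x u) i| <= Num.max M 1.
  case: (unliftP ord0 i) => [j|] ->.
    rewrite tnth_ecS; have /andP[h1 h2] := cu j.
    by rewrite gtr0_norm// le_max (ltW h2) orbT.
  by rewrite tnth_ec0 le_max xM.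
rewrite ler_wpM2r// normrM ler_pM//; first exact: hB.
rewrite ger0_norm ?psi_ge0//; apply: psi_bound; first exact: ltW.
  by rewrite le_max lexx.
by rewrite le_max (le_trans (ler_norm _) (hC _ hx)) orbT.
Qed.

Lemma pitg_bcs x : bcs (pitg x).
Proof.
have mm (p : mpoly n.+1 R) : measurable_fun [set: euclid R n] (fun u => meval (tnth (ec x u)) p).
  exact: measurableT_comp (measurable_meval p) (measurable_ecl x).
split.
  apply: measurable_funM; first exact: measurable_KAP.
  apply: measurable_funM; first exact: mm.
  exact: measurableT_comp (measurable_psi s0) (mm Q).
have [C hC] := pitg_bound `|x|; exists `|C| => u; split=> h.
  apply: (le_trans (hC x u (lexx _))).
  apply: (@le_trans _ _ (`|C| * `|KAP (fun=> 0%N) u|)).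
    by rewrite ler_wpM2r// ler_norm.
  by rewrite ler_piMr// KAP_bound.
by rewrite /pitg KAP_out// mul0r.
Qed.

Lemma pitg_continuous u x : {for x, continuous (pitg ^~ u)}.
Proof.
have cm (p : mpoly n.+1 R) : {for x, continuous (fun x : R => meval (tnth (ec x u)) p)}.
  have -> : (fun x => meval (tnth (ec x u)) p) =
      (fun x => meval (upd (tnth (ec 0 u)) ord0 x) p).
    by apply/funext => z; rewrite (ec_upd _ _ 0).
  by apply: fderiv_cont; have [] := is_derive_meval (tnth (ec 0 u)) ord0 p x.
apply: continuousM; first exact: cst_continuous.
apply: continuousM; first exact: cm.
exact: (@continuous_comp _ _ _ (fun x : R => meval (tnth (ec x u)) Q) (psi s) x
  (cm Q) (@psi_continuous R s _ s0)).
Qed.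

(** Dominated convergence on a bounded interval of parameters, with a multiple of the weight as
    majorant; continuity is the hypothesis of the one-dimensional substitution. *)
Lemma pitg_int_continuous : continuous (fun x : R => \int[L n]_u pitg x u : R).
Proof.
move=> a.
pose M := `|a| + 1.
have [C hC] := pitg_bound M.
have := @continuity_under_integral R _ _ (L n) pitg setT measurableT (- M) M
  _ _ (fun u => `|C| * `|KAP (fun=> 0%N) u|).
apply.
- by move=> x _; exact: bcs_integrable (pitg_bcs x).
- by apply: aeW => u _ x _; exact: pitg_continuous.
- apply: (@bcs_integrable R n (fun u => `|C| * `|KAP (fun=> 0%N) u|)); split.
    apply: measurable_funM => //; apply: measurableT_comp => //.
    exact: measurable_KAP.
  exists `|C| => u; split=> h; last by rewrite KAP_out// normr0 mulr0.
  by rewrite normrM !normr_id ler_piMr// KAP_bound.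
- move=> x /=; rewrite in_itv/= => xM; apply: aeW => u _.
  apply: (@le_trans _ _ (C * `|KAP (fun=> 0%N) u|)).
    by apply: hC; rewrite ler_norml; case/andP: xM => /ltW-> /ltW->.
  by rewrite ler_wpM2r// ler_norm.
- by rewrite inE/= in_itv/= -ltr_norml ltrDl.
Qed.

End Param.

Definition simp r n : set (euclid R n) :=
  [set y | (forall i, 0 <= tnth y i) /\ \sum_i tnth y i <= r].
Arguments simp r {n}.

Lemma measurable_simp (r : R) n : measurable (@simp r n).
Proof.
have m0 (f : euclid R n -> R) (A : interval R) : measurable_fun setT f ->
    measurable (f @^-1` [set` A]).
  by move=> mf; rewrite -[X in measurable X]setTI; exact: mf.
have -> : simp r = (\bigcap_(i in [set: 'I_n]) ((fun u : euclid R n => tnth u i) @^-1` `[0, +oo[)) `&`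
    ((fun y : euclid R n => \sum_i tnth y i) @^-1` `]-oo, r]).
  apply/seteqP; split => y /=.
    move=> [h1 h2]; split; last by rewrite /= in_itv/= h2.
    by move=> i _; rewrite /= in_itv/= h1.
  move=> [h1]; rewrite in_itv/= => h2; split=> // i.
  by have := h1 i I; rewrite /= in_itv/= andbT.
apply: measurableI.
  apply: fin_bigcap_measurable => [|i _]; first exact: finite_finset.
  by apply: m0; exact: measurable_tnth.
apply: m0; apply: measurable_sum => i; exact: measurable_tnth.
Qed.

Lemma simp_ec r n x (y : euclid R n) : simp r (ec x y) <-> 0 <= x /\ simp (r - x) y.
Proof.
have E : \sum_i tnth (ec x y) i = x + \sum_i tnth y i.
  by rewrite big_ord_recl tnth_ec0; congr (_ + _); apply: eq_bigr => i _; rewrite tnth_ecS.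
rewrite /simp /= E -lerBrDl; split.
  move=> [h1 h2]; split; first exact: (h1 ord0).
  by split=> // i; rewrite -(tnth_ecS x).
move=> [h1 [h2 h3]]; split=> // i; case: (unliftP ord0 i) => [j|] ->.
  by rewrite tnth_ecS.
by rewrite tnth_ec0.
Qed.

Lemma KAP_ec n (x : R) (y : euclid R n) :
  KAP (fun=> 0%N) (ec x y) = kap 0 x * KAP (fun=> 0%N) y.
Proof.
rewrite /KAP big_ord_recl tnth_ec0; congr (_ * _).
by apply: eq_bigr => i _; rewrite tnth_ecS.
Qed.

Lemma KAP0_ge0 n (y : euclid R n) : 0 <= KAP (fun=> 0%N) y.
Proof.
apply: prodr_ge0 => i _; rewrite /kap; case: ifP => // /andP[h1 h2].
by rewrite expr0 fact0 divr1 mulr1 sqr_ge0.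
Qed.

Lemma wm_ge0 n (r : R) (u : euclid R n) : 0 <= r -> cube u -> 0 <= wm r u.
Proof.
elim: n r u => [|n IH] r u r0 cu; first by rewrite tuple0.
have [t [v uE]] : exists t v, u = ec t v.
  by exists (thead u), [tuple of behead u]; rewrite [LHS]tuple_eta; exact/val_inj.
move: cu; rewrite uE => /cube_ec[/andP[t0 t1] cv] /=.
have /andP[s0 s1] : 0 <= sg t <= 1 by apply: sg_itv; rewrite !ltW.
rewrite mulr_ge0//; first by rewrite mulr_ge0.
by apply: IH => //; rewrite mulr_ge0// subr_ge0.
Qed.

Variables (s : R) (k : nat) (P : mpoly k R).
Hypothesis s0 : 0 < s.

(** [ps] holds the values of the outer simplex coordinates, and [r] is the size of the simplex
    filled by the remaining ones. *)
Definition cubeg n r (ps : seq R) (u : euclid R n) : R :=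
  KAP (fun=> 0%N) u * (wm r u * psi s (meval (nth 0 (ps ++ Tm r u)) P)).

(** Moving x from the size to the fixed coordinates gives an expression polynomial in x and u
    jointly, so the continuity results on [pitg] apply to it. *)
Lemma cubeg_pitg n r (ps : seq R) : exists W Q, forall x (u : euclid R n),
  cubeg (r - x) (rcons ps x) u = pitg W Q s x u.
Proof.
pose X0 : mpoly n.+1 R := mpolyX R (mnm1 ord0).
pose XS := [seq mpolyX R (mnm1 (lift ord0 i)) | i <- enum 'I_n].
pose rX : mpoly n.+1 R := mpolyC n.+1 r - X0.
have XSE x (u : euclid R n) : [seq meval (tnth (ec x u)) q | q <- XS] = u.
  rewrite -map_comp -[RHS]map_tnth_enum; apply: eq_map => i /=.
  by rewrite mevalXU tnth_ecS.
have rE x (u : euclid R n) : meval (tnth (ec x u)) rX = r - x.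
  by rewrite /rX mevalB mevalC mevalXU tnth_ec0.
exists (wm rX XS), (sub_mpoly ([seq mpolyC _ p | p <- ps] ++ X0 :: Tm rX XS) P).
move=> x u; rewrite /cubeg /pitg; congr (_ * (_ * psi s _)).
  by rewrite (rmorph_wm (meval (tnth (ec x u))))/= XSE rE.
rewrite sub_mpoly_meval map_cat/= mevalXU tnth_ec0.
rewrite (map_Tm (meval (tnth (ec x u))))/= XSE rE cat_rcons -map_comp.
rewrite (_ : [seq _ | p <- ps] = ps)// -[RHS]map_id; apply: eq_map => p /=.
by rewrite mevalC.
Qed.

Lemma measurable_cubeg n r (ps : seq R) : measurable_fun setT (@cubeg n r ps).
Proof.
pose W : mpoly n R := wm (mpolyC n r) (Xs R n).
pose Q : mpoly n R := sub_mpoly ([seq mpolyC n p | p <- ps] ++ Tm (mpolyC n r) (Xs R n)) P.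
have -> : @cubeg n r ps = fun u => KAP (fun=> 0%N) u *
    (meval (tnth u) W * psi s (meval (tnth u) Q)).
  apply/funext => u; rewrite /cubeg; congr (_ * (_ * psi s _)).
    by rewrite (rmorph_wm (meval (tnth u)))/= map_Xs mevalC.
  rewrite sub_mpoly_meval map_cat (map_Tm (meval (tnth u)))/= map_Xs mevalC.
  rewrite -map_comp (_ : [seq _ | p <- ps] = ps)// -[RHS]map_id.
  by apply: eq_map => p /=; rewrite mevalC.
apply: measurable_funM; first exact: measurable_KAP.
apply: measurable_funM; first exact: measurable_meval.
exact: measurableT_comp (measurable_psi s0) (measurable_meval Q).
Qed.

Lemma cubeg_ge0 n r ps (u : euclid R n) : 0 <= r -> 0 <= cubeg r ps u.
Proof.
move=> r0; have [cu|cu] := pselect (cube u); last by rewrite /cubeg KAP_out// mul0r.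
by rewrite mulr_ge0// ?KAP0_ge0// mulr_ge0// ?psi_ge0//; exact: wm_ge0.
Qed.

Lemma measurable_simpg n r (ps : seq R) : measurable_fun setT
  (fun y : euclid R n => (\1_(simp r) y * psi s (meval (nth 0 (ps ++ y)) P))%:E).
Proof.
apply/measurable_EFinP; apply: measurable_funM.
  by apply: measurable_indic; exact: measurable_simp.
pose Q : mpoly n R := sub_mpoly ([seq mpolyC n p | p <- ps] ++ Xs R n) P.
rewrite (_ : (fun y => _) = fun u : euclid R n => psi s (meval (tnth u) Q)).
  exact: measurableT_comp (measurable_psi s0) (measurable_meval Q).
apply/funext => u; rewrite sub_mpoly_meval map_cat map_Xs -map_comp.
rewrite (_ : [seq _ | p <- ps] = ps)// -[RHS]map_id.
by apply: eq_map => p /=; rewrite mevalC.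
Qed.

(** Induction on the dimension: Tonelli, the induction hypothesis on the slice of size r - x, then
    the substitution x = r sg t in the outer coordinate. *)
Lemma simplex_cube n r (ps : seq R) : 0 <= r ->
  (\int[L n]_y (\1_(simp r) y * psi s (meval (nth 0 (ps ++ y)) P))%:E =
   \int[L n]_u (cubeg r ps u)%:E)%E.
Proof.
elim: n r ps => [|n IH] r ps r0.
  rewrite !integral_dirac//.
  - congr (mule _); congr EFin; rewrite /cubeg /KAP big_ord0 /= !mul1r.
    rewrite (_ : \1_(simp r) _ = 1) ?mul1r// indicE mem_set//.
    by split; [case|rewrite big_ord0].
  - by apply/measurable_EFinP; exact: measurable_cubeg.
  - exact: measurable_simpg.
rewrite [LHS]tonelli; last 2 first.
- exact: measurable_simpg.
- by move=> u; rewrite lee_fin mulr_ge0// psi_ge0.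
rewrite [RHS]tonelli; last 2 first.
- by apply/measurable_EFinP; exact: measurable_cubeg.
- by move=> u; rewrite lee_fin cubeg_ge0.
have [W [Q WQ]] := cubeg_pitg n r ps.
(* Being given by polynomials, [phi] is defined and continuous for all real x; it is compared with
   the integral over the slice for x in [0, r]. *)
pose phi x := \int[L n]_u pitg W Q s x u.
have phiE x : (\int[L n]_u (pitg W Q s x u)%:E = (phi x)%:E)%E.
  rewrite /phi /Rintegral fineK//; apply: integrable_fin_num => //.
  exact: bcs_integrable (pitg_bcs W Q s0 x).
transitivity (\int[mu]_(x in `[0%R, r]) (phi x)%:E)%E.
  rewrite [RHS]integral_mkcond; apply: eq_integral => x _.
  rewrite patchE; case: ifPn => hx.
    move: hx; rewrite inE/= in_itv/= => /andP[x0 xr].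
    rewrite -phiE.
    transitivity (\int[L n]_u (cubeg (r - x) (rcons ps x) u)%:E)%E; last first.
      by apply: eq_integral => u _; rewrite WQ.
    have xr0 : 0 <= r - x by rewrite subr_ge0.
    rewrite -(IH (r - x) (rcons ps x) xr0); apply: eq_integral => y _; congr EFin.
    rewrite cat_rcons; congr (_ * _); rewrite !indicE; congr (nat_of_bool _)%:R.
    apply/idP/idP; rewrite !inE; first by move=> /simp_ec[].
    by move=> hy; apply/simp_ec.
  apply: integral0_eq => y _; rewrite indicE memNset ?mul0r// => /simp_ec[x0 [h1 h2]].
  move: hx; rewrite notin_setE/= in_itv/= x0/=; apply.
  by rewrite -subr_ge0 (le_trans _ h2)// sumr_ge0.
rewrite sg_substitution//; last first.
  by apply: continuous_subspaceT; exact: pitg_int_continuous.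
apply: eq_integral => t _.
rewrite mulrA EFinM -phiE.
rewrite -integralZl//; last exact: bcs_integrable (pitg_bcs W Q s0 _).
apply: eq_integral => u _; rewrite -EFinM; congr EFin.
rewrite -WQ /cubeg KAP_ec /= cat_rcons.
have -> : r - r * sg t = r * (1 - sg t) by ring.
by ring.
Qed.

End SimplexCube.
Arguments simp {R} r {n}.

(** * The zeta integral as an integral over the cube *)

Section SimplexZeta.
Variable R : realType.
Local Notation L := (lebesgue R).

Definition rmeval n (v : 'I_n -> R) (p : mpoly n rat) : R := meval v (map_mpoly ratr p).

HB.instance Definition _ n (v : 'I_n -> R) := GRing.RMorphism.copy (@rmeval n v)
  (@meval n R v \o map_mpoly (@ratr R)).

Lemma rmevalX n (v : 'I_n -> R) i : rmeval v (mpolyX rat (mnm1 i)) = v i.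
Proof. by rewrite /rmeval map_mpolyX mevalXU. Qed.

Lemma rmevalC n (v : 'I_n -> R) c : rmeval v (mpolyC n c) = ratr c.
Proof. by rewrite /rmeval map_mpolyC ?mevalC// rmorph0. Qed.

Lemma map_rmeval_Xs n (u : euclid R n) : [seq rmeval (tnth u) q | q <- Xs rat n] = u.
Proof.
rewrite -map_comp -[RHS]map_tnth_enum; apply: eq_map => i /=.
exact: rmevalX.
Qed.

Lemma rmeval_sub n k (v : 'I_n -> R) (q : seq (mpoly n rat)) (P : mpoly k rat) :
  rmeval v (sub_mpoly q P) = rmeval (nth 0 [seq rmeval v x | x <- q]) P.
Proof.
rewrite /sub_mpoly; elim/mpoly_ring_ind: P => [c|j|p p' hp hq|p p' hp hq].
- by rewrite comp_mpolyC !rmevalC.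
- rewrite comp_mpolyXU rmevalX -tnth_nth tnth_mktuple.
  have [h|h] := ltnP j (size q); first by rewrite (nth_map 0).
  by rewrite !nth_default ?size_map// rmorph0.
- by rewrite comp_mpolyD (rmorphD (rmeval v)) (rmorphD (rmeval (nth _ _)))/= hp hq.
- rewrite (rmorphM (comp_mpoly [tuple nth 0 q i | i < k])) (rmorphM (rmeval v)).
  by rewrite (rmorphM (rmeval (nth 0 [seq rmeval v x | x <- q])))/= hp hq.
Qed.

Variables (n : nat) (f : mpoly n.+1 rat).

Definition chart_poly : mpoly n rat :=
  sub_mpoly (1 - \sum_(i < n) mpolyX rat (mnm1 i) :: Xs rat n) f.

Definition cubeF : mpoly n rat := sub_mpoly (Tm 1 (Xs rat n)) chart_poly.
Definition cubeW : mpoly n rat := wm 1 (Xs rat n).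

Lemma chart_polyE (y : euclid R n) :
  rmeval (tnth y) chart_poly = rmeval (tnth (simplex_chart y)) f.
Proof.
rewrite rmeval_sub /=; apply: meval_eq => i; rewrite (tnth_nth 0) /=.
rewrite map_rmeval_Xs; congr nth; congr cons.
rewrite (rmorphB (rmeval (tnth y))) (rmorph_sum (rmeval (tnth y))) rmorph1.
by congr (_ - _); apply: eq_bigr => j _; exact: rmevalX.
Qed.

Lemma cubeFE (u : euclid R n) :
  rmeval (tnth u) cubeF = rmeval (nth 0 (Tm 1 u)) chart_poly.
Proof.
rewrite rmeval_sub; congr (rmeval (nth 0 _) _).
by rewrite (map_Tm (rmeval (tnth u))) rmorph1 map_rmeval_Xs.
Qed.

Lemma cubeWE (u : euclid R n) : rmeval (tnth u) cubeW = wm 1 u.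
Proof.
by rewrite (rmorph_wm (rmeval (tnth u))) rmorph1 map_rmeval_Xs.
Qed.

Lemma simplex_chartE : @simplex_chart R n @^-1` @simplex R n = simp 1.
Proof.
have E0 (y : euclid R n) : tnth (simplex_chart y) ord0 = 1 - \sum_i tnth y i by [].
have ES (y : euclid R n) i : tnth (simplex_chart y) (lift ord0 i) = tnth y i.
  exact: (tnth_ecS (1 - _) y).
apply/seteqP; split => y /= [h1 h2].
  split=> [i|]; first by rewrite -ES.
  by rewrite -subr_ge0 -E0.
split=> [i|].
  by case: (unliftP ord0 i) => [j|] ->; rewrite ?ES// E0 subr_ge0.
rewrite big_ord_recl E0.
have -> : \sum_(i < n) tnth (simplex_chart y) (lift ord0 i) = \sum_i tnth y i.
  by apply: eq_bigr => i _; exact: ES.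
by rewrite subrK.
Qed.

Hypothesis hf : forall x : euclid R n.+1, simplex x ->
  0 <= meval (tnth x) (map_mpoly ratr f).

(** At a real exponent the sine vanishes, and non-negativity of f on the simplex makes the power
    agree with its truncation [psi]. *)
Lemma simplex_zetaE (x : R) : 0 < x ->
  simplex_zeta f x%:C%C =
  (Lam (map_mpoly ratr cubeF) (fun=> 0%N) (map_mpoly ratr cubeW) x)%:C%C.
Proof.
move=> x0; rewrite /simplex_zeta simplex_chartE /Lam.
have fsE (y : euclid R n) : simp 1 y -> cpow (meval (tnth (simplex_chart y)) (map_mpoly ratr f)) x%:C%C =
    (psi x (rmeval (tnth y) chart_poly))%:C%C.
  move=> hy; rewrite /cpow /= !mul0r cos0 sin0 mulr1 mulr0 chart_polyE.
  by rewrite psi_powR ?gt_eqF//; apply: hf; move: hy; rewrite -simplex_chartE.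
congr (_ +i* _)%C.
  rewrite /Rintegral; congr fine.
  transitivity (\int[L n]_y (\1_(simp 1) y * psi x (meval (nth 0 ([::] ++ y)) (map_mpoly ratr chart_poly)))%:E)%E.
    rewrite integral_mkcond; apply: eq_integral => y _; rewrite patchE indicE.
    case: ifPn => hy.
      rewrite fsE; last by rewrite inE in hy.
      rewrite mul1r; congr (psi x _)%:E.
      by apply: meval_eq => i; rewrite (tnth_nth 0).
    by rewrite mul0r.
  rewrite (@simplex_cube R x _ (map_mpoly ratr chart_poly) x0 n 1 [::] ler01).
  apply: eq_integral => u _; congr EFin.
  have EF : psi x (meval (nth 0 ([::] ++ Tm 1 u)) (map_mpoly ratr chart_poly)) =
    psi x (meval (tnth u) (map_mpoly ratr cubeF)) by congr psi; exact/esym/cubeFE.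
  have EW : wm 1 u = meval (tnth u) (map_mpoly ratr cubeW) by exact/esym/cubeWE.
  by rewrite /cubeg /itg /hpsi EF EW.
by rewrite /Rintegral integral0_eq// => y hy; rewrite fsE.
Qed.

End SimplexZeta.

(** * Taylor expansion at positive integers *)

Section Taylor.
Variable R : realType.
Local Notation L := (lebesgue R).

Definition expS (y : R) N : R := \sum_(k < N) y ^+ k / k`!%:R.

Lemma expS_cvg (y : R) : expS y @ \oo --> expR y.
Proof.
have := is_cvg_series_exp_coeff y; rewrite -/(expR y).
have -> : series (exp_coeff y) = expS y; last by [].
by apply/funext => N; rewrite /series /expS /= big_mkord.
Qed.

Lemma expS_le (z : R) N : 0 <= z -> expS z N <= expR z.
Proof.
move=> z0; have nd : nondecreasing_seq (expS z).
  apply/nondecreasing_seqP => m; rewrite /expS big_ord_recr/= lerDl.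
  by rewrite divr_ge0// exprn_ge0.
have cv := @expS_cvg z.
have := nondecreasing_cvgn_le nd (cvgP _ cv) N.
by rewrite (cvg_lim _ cv).
Qed.

Lemma expS_sub (y : R) N M : (N <= M)%N ->
  expS y M - expS y N = \sum_(N <= k < M) y ^+ k / k`!%:R.
Proof.
move=> NM; rewrite /expS -!(big_mkord predT (fun k => y ^+ k / k`!%:R)).
by rewrite (big_cat_nat _ (n := N))//= addrAC subrr add0r.
Qed.

(* With q = 2 |h| < 1 and z = |ln F| / 2 the error is uniform on the cube, since
   F^l exp (|ln F| / 2) is bounded for l >= 1. *)
Lemma expR_partial (y z q : R) N : 0 <= q <= 1 -> 0 <= z -> `|y| <= q * z ->
  `|expS y N - expR y| <= q ^+ N * expR z.
Proof.
move=> /andP[q0 q1] z0 yz.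
have cv : (fun M => `|expS y N - expS y M|) @ \oo --> `|expS y N - expR y|.
  by apply: cvg_norm; apply: cvgB; [exact: cvg_cst|exact: expS_cvg].
apply: (cvgr_to_le cv); exists N => // M /= NM.
rewrite distrC expS_sub//; apply: (le_trans (ler_norm_sum _ _ _)).
apply: (@le_trans _ _ (q ^+ N * \sum_(N <= k < M) z ^+ k / k`!%:R)).
  rewrite mulr_sumr !big_nat; apply: ler_sum => k /andP[Nk _].
  rewrite normrM normrV ?unitfE// normr_nat mulrA ler_wpM2r//.
  rewrite normrX; apply: (@le_trans _ _ ((q * z) ^+ k)).
    by apply: lerXn2r => //; rewrite nnegrE// mulr_ge0.
  rewrite exprMn ler_wpM2r ?exprn_ge0//.
  exact: ler_wiXn2l.
rewrite ler_wpM2l ?exprn_ge0// -expS_sub//.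
apply: le_trans (expS_le M z0); rewrite gerBl sumr_ge0// => k _.
by rewrite divr_ge0// exprn_ge0.
Qed.

Lemma integrable_lin m (I : Type) (r : seq I) (c : I -> R) (g : I -> euclid R m -> R) :
  (forall i, (L m).-integrable setT (EFin \o g i)) ->
  (L m).-integrable setT (EFin \o (fun u => \sum_(i <- r) c i * g i u)) /\
  \int[L m]_u (\sum_(i <- r) c i * g i u) = \sum_(i <- r) c i * \int[L m]_u g i u.
Proof.
move=> ig; elim: r => [|i r [IH1 IH2]].
  have -> : (fun u => \sum_(i <- [::]) c i * g i u) = (fun=> 0).
    by apply/funext => u; rewrite big_nil.
  rewrite big_nil; split; last by rewrite /Rintegral integral0.
  exact: integrable0.
have -> : (fun u => \sum_(i <- i :: r) c i * g i u) =
    (fun u => c i * g i u + \sum_(i <- r) c i * g i u).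
  by apply/funext => u; rewrite big_cons.
have ii : (L m).-integrable setT (EFin \o (fun u => c i * g i u)).
  by have := integrableZl measurableT (c i) (ig i); apply: eq_integrable.
rewrite big_cons -IH2; split.
  by have := integrableD measurableT ii IH1; apply: eq_integrable.
by rewrite RintegralD// RintegralZl.
Qed.

Variables (n : nat) (W F : mpoly n R).

Lemma bcsZ (c : R) (g : euclid R n -> R) : bcs g -> bcs (fun u => c * g u).
Proof.
move=> bg; have -> : (fun u => c * g u) = (fun u => g u * c).
  by apply/funext => u; rewrite mulrC.
by apply: bcsM => //; exists `|c|.
Qed.

Lemma bcs_sumZ (I : Type) (r : seq I) (c : I -> R) (g : I -> euclid R n -> R) :
  (forall i, bcs (g i)) -> bcs (fun u => \sum_(i <- r) c i * g i u).
Proof.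
move=> bg; elim: r => [|i r IH].
  have -> : (fun u => \sum_(i <- [::]) c i * g i u) = (fun=> 0).
    by apply/funext => u; rewrite big_nil.
  by split => //; exists 0 => u; rewrite normr0.
have -> : (fun u => \sum_(i <- i :: r) c i * g i u) =
    (fun u => c i * g i u + \sum_(i <- r) c i * g i u).
  by apply/funext => u; rewrite big_cons.
exact: bcsD (bcsZ (c i) (bg i)) IH.
Qed.

Lemma bcs_int_bound (g : euclid R n -> R) C : bcs g -> 0 <= C ->
  (forall u, cube u -> `|g u| <= C) -> `|\int[L n]_u g u| <= C.
Proof.
move=> bg C0 gC.
apply: (le_trans (le_normr_Rintegral measurableT (bcs_integrable bg))).
rewrite -lee_fin /Rintegral fineK; last first.
  apply: integrable_fin_num => //.
  exact: (integrable_norm (bcs_integrable bg)).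
apply: (@le_trans _ _ (\int[L n]_u (C * \1_(@cube R n) u)%:E)%E).
  apply: ge0_le_integral => //.
  - apply/measurable_EFinP; apply: measurableT_comp => //; by case: bg.
  - apply/measurable_EFinP; apply: measurable_funM => //.
    by apply: measurable_indic; exact: measurable_cube.
  - move=> u _; rewrite lee_fin indicE; case: (boolP (u \in _)) => hu.
      by rewrite mulr1; apply: gC; rewrite inE in hu.
    case: bg => _ [M hM]; rewrite (hM u).2 ?normr0 ?mulr0//.
    by move: hu; rewrite notin_setE.
under eq_integral do rewrite EFinM.
rewrite ge0_integralZl//; last first.
  by apply/measurable_EFinP; apply: measurable_indic; exact: measurable_cube.
rewrite integral_indic//; last exact: measurable_cube.
rewrite setIT -[leRHS]mule1 lee_wpmul2l//; exact: lebesgue_cube.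
Qed.

Definition vint (l k : nat) (u : euclid R n) : R :=
  KAP (fun=> 0%N) u *
  (meval (tnth u) W * (psi l%:R (meval (tnth u) F) * ln (meval (tnth u) F) ^+ k)).

Definition vcoef l k : R := \int[L n]_u vint l k u.

(** exp (|x| / 2) is one of exp (x / 2) and exp (-x / 2). For s = l >= 1 both exponents l + 1/2 and
    l - 1/2 are positive, so the right side is bounded on the cube. *)
Lemma psi_exp (s v : R) : psi s v * expR (`|ln v| / 2) <=
  psi (s + 2^-1) v + psi (s - 2^-1) v.
Proof.
rewrite /psi; case: ifP => v0; last by rewrite mul0r addr0.
rewrite -expRD; have [h|h] := ler0P (ln v).
  rewrite (_ : _ + _ = (s - 2^-1) * ln v); last by lra.
  by rewrite lerDr expR_ge0.
rewrite (_ : _ + _ / _ = (s + 2^-1) * ln v); last by lra.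
by rewrite lerDl expR_ge0.
Qed.

Lemma psi_exp_bound (l : nat) : (0 < l)%N -> exists2 C, 0 <= C & forall u : euclid R n, cube u ->
  psi l%:R (meval (tnth u) F) * expR (`|ln (meval (tnth u) F)| / 2) <= C.
Proof.
move=> l0; have [B hB] := meval_cube_bounded F.
pose M := Num.max 1 B; have l1 : (1 : R) <= l%:R by rewrite ler1n.
exists (expR ((l%:R + 2^-1) * ln M) + expR ((l%:R - 2^-1) * ln M)).
  by rewrite addr_ge0// expR_ge0.
move=> u cu; apply: (le_trans (psi_exp _ _)).
have M1 : 1 <= M by rewrite le_max lexx.
have FM : meval (tnth u) F <= M.
  by rewrite le_max (le_trans (ler_norm _) (hB u cu)) orbT.
by rewrite lerD// psi_bound//; lra.
Qed.

(** The inequality |ln v|^k <= 2^k k! exp (|ln v| / 2) reduces powers of the logarithm to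
    [psi_exp_bound]. *)
Lemma vint_bcs l k : (0 < l)%N -> bcs (vint l k).
Proof.
move=> l0; have l0' : 0 < l%:R :> R by rewrite ltr0n.
apply: (bcsM (@KAP_bcs R n (fun=> 0%N))).
  apply: measurable_funM; first exact: measurable_meval.
  apply: measurable_funM.
    exact: measurableT_comp (measurable_psi l0') (measurable_meval F).
  apply: measurable_funX; exact: measurableT_comp (@measurable_ln R) (measurable_meval F).
have [B hB] := meval_cube_bounded W; have [C C0 hC] := psi_exp_bound l0.
exists (B * (C * (2 ^+ k * k`!%:R))) => u cu.
rewrite normrM ler_pM//; first exact: hB.
rewrite normrM ger0_norm ?psi_ge0// normrX.
set v := meval _ F; have := @ler_exp_expR R (`|ln v| / 2) k.
rewrite divr_ge0// => /(_ isT) h.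
apply: (@le_trans _ _ (psi l%:R v * (expR (`|ln v| / 2) * (2 ^+ k * k`!%:R)))).
  rewrite ler_wpM2l ?psi_ge0//.
  have -> : `|ln v| ^+ k = (`|ln v| / 2) ^+ k / k`!%:R * (2 ^+ k * k`!%:R).
    rewrite expr_div_n [2 ^+ k * _]mulrC mulrA divfK ?pnatr_eq0 -?lt0n ?fact_gt0//.
    by rewrite divfK// expf_neq0.
  by rewrite ler_wpM2r// mulr_ge0// exprn_ge0.
by rewrite mulrA ler_wpM2r//; exact: hC.
Qed.

(** The exponential series of h ln F is truncated under the integral; its remainder, multiplied by
    F^l, is bounded uniformly on the cube. *)
Lemma Lam_taylor (l : nat) (h : R) : (0 < l)%N -> `|h| < 2^-1 ->
  exists2 C, 0 <= C & forall N,
  `|\sum_(k < N) (vcoef l k / k`!%:R * h ^+ k) - Lam F (fun=> 0%N) W (l%:R + h)| <=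
   (2 * `|h|) ^+ N * C.
Proof.
move=> l0 h2; have [B hB] := meval_cube_bounded W; have [C C0 hC] := psi_exp_bound l0.
have l1 : (1 : R) <= l%:R by rewrite ler1n.
have lh0 : 0 < l%:R + h by move: h2; rewrite ltr_norml; lra.
exists (`|B| * C); first exact: mulr_ge0.
move=> N; have q01 : 0 <= 2 * `|h| <= 1 by move: h2; have := normr_ge0 h; lra.
have bS := bcs_sumZ (index_enum 'I_N) (fun k : 'I_N => h ^+ k / k`!%:R)
  (fun k : 'I_N => vint_bcs k l0).
have [_ ES] := integrable_lin (index_enum 'I_N) (fun k : 'I_N => h ^+ k / k`!%:R)
  (fun k : 'I_N => bcs_integrable (vint_bcs k l0)).
have -> : \sum_(k < N) (vcoef l k / k`!%:R * h ^+ k) =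
    \sum_(k < N) h ^+ k / k`!%:R * \int[L n]_u vint l k u.
  by apply: eq_bigr => k _; rewrite /vcoef mulrC mulrA mulrAC.
have bI := itg_bcs F (fun=> 0%N) W lh0.
rewrite -ES /Lam -RintegralB//; last 2 first.
- exact: (bcs_integrable bS).
- exact: (bcs_integrable bI).
apply: bcs_int_bound.
- have := bcsD bS (bcsZ (-1) bI); congr bcs; apply/funext => u.
  by rewrite mulN1r.
- by rewrite !mulr_ge0// exprn_ge0//; case/andP: q01.
- move=> u cu; set v := meval (tnth u) F; set w := meval (tnth u) W.
  have -> : \sum_(k < N) h ^+ k / k`!%:R * vint l k u - itg F (fun=> 0%N) W (l%:R + h) u =
    KAP (fun=> 0%N) u * (w * (psi l%:R v * (expS (h * ln v) N - expR (h * ln v)))).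
    have -> : itg F (fun=> 0%N) W (l%:R + h) u = KAP (fun=> 0%N) u * (w * (psi l%:R v * expR (h * ln v))).
      rewrite /itg /hpsi -/v -/w /psi; case: ifP => _; last by rewrite mul0r.
      by rewrite -expRD -mulrDl.
    rewrite !mulrBr; congr (_ - _); rewrite /expS !mulr_sumr; apply: eq_bigr => k _.
    by rewrite /vint -/v -/w exprMn; ring.
  rewrite normrM -[leRHS]mul1r ler_pM//; first exact: KAP_bound.
  rewrite normrM mulrCA ler_pM//; first by rewrite (le_trans (hB u cu))// ler_norm.
  rewrite normrM ger0_norm ?psi_ge0//.
  apply: (@le_trans _ _ (psi l%:R v * ((2 * `|h|) ^+ N * expR (`|ln v| / 2)))).
    rewrite ler_wpM2l ?psi_ge0// expR_partial// ?divr_ge0//.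
    by rewrite normrM (_ : 2 * `|h| * (`|ln v| / 2) = `|h| * `|ln v|)//; field.
  by rewrite mulrCA ler_wpM2l ?hC// exprn_ge0//; case/andP: q01.
Qed.

End Taylor.

(** * Laurent coefficients of the zeta function *)

Section Germs.
Variable R : realType.
Variables (n : nat) (f : mpoly n.+1 rat).
Hypothesis hf : forall x : euclid R n.+1, simplex x ->
  0 <= meval (tnth x) (map_mpoly ratr f).
Variable J : R[i] -> R[i].
Hypothesis hJI : forall s : R[i], 0 < complex.Re s -> J s = simplex_zeta f s.

Local Notation F := (map_mpoly ratr (cubeF f) : mpoly n R).
Local Notation W := (map_mpoly ratr (cubeW n) : mpoly n R).

Lemma J_Lam (x : R) : 0 < x -> J x%:C%C = (Lam F (fun=> 0%N) W x)%:C%C.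
Proof. by move=> x0; rewrite hJI// simplex_zetaE. Qed.

Lemma J_germ (l : nat) : (0 < l)%N ->
  rgerm (fun x => J x%:C%C) l%:R 0 (fun k => (vcoef W F l k / k`!%:R)%:C%C).
Proof.
move=> l0; have l1 : (1 : R) <= l%:R by rewrite ler1n.
exists 2^-1 => [|h _ h2]; first by rewrite invr_gt0.
have [C C0 hC] := Lam_taylor W F l0 h2.
rewrite expr0 mul1r J_Lam; last by move: h2; rewrite ltr_norml; lra.
have q1 : `|2 * `|h| | < 1.
  by rewrite ger0_norm ?mulr_ge0//; move: h2; have := normr_ge0 h; lra.
move=> e e0; have eC : 0 < e / (C + 1) by rewrite divr_gt0// ltr_pwDr.
have /cvgrPdist_lt /(_ _ eC) [N _ hN] := cvg_expr q1.
exists N => m Nm.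
have -> : \sum_(k < m) (vcoef W F l k / k`!%:R)%:C%C * h%:C%C ^+ k =
    (\sum_(k < m) vcoef W F l k / k`!%:R * h ^+ k)%:C%C.
  by rewrite (rmorph_sum (real_complex R)); apply: eq_bigr => k _; rewrite [RHS](rmorphM (real_complex R)) (rmorphXn (real_complex R)).
rewrite -(rmorphB (real_complex R)) cnormR.
apply: (le_lt_trans (hC m)).
have := hN m Nm; rewrite /= sub0r normrN ger0_norm ?exprn_ge0 ?mulr_ge0// => h3.
apply: (@le_lt_trans _ _ ((2 * `|h|) ^+ m * (C + 1))).
  by rewrite ler_wpM2l ?exprn_ge0 ?mulr_ge0// lerDl.
by rewrite -ltr_pdivlMr// ltr_pwDr.
Qed.

(** The Q-span of the integrals of F^l (ln F)^k with the weights. A triple stores q, l - 1 and k,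
    which builds in l >= 1; the factor 1 / k! goes into q. *)
Definition vspan (z : R[i]) : Prop := exists s : seq (rat * nat * nat),
  z = (\sum_(x <- s) ratr x.1.1 * vcoef W F x.1.2.+1 x.2)%:C%C.

Lemma ratr_complex (q : rat) : ratr q = (ratr q : R)%:C%C :> R[i].
Proof. by rewrite (fmorph_rat (real_complex R)). Qed.

Lemma vspan_qspace : qspace vspan.
Proof.
split.
- by exists [::]; rewrite big_nil.
- move=> x y [s ->] [t ->]; exists (s ++ t).
  by rewrite big_cat rmorphD.
- move=> q x [s ->]; exists [seq (q * y.1.1, y.1.2, y.2) | y <- s].
  rewrite big_map/= ratr_complex -(rmorphM (real_complex R)) mulr_sumr; congr (_%:C)%C.
  by apply: eq_bigr => y _; rewrite rmorphM mulrA.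
Qed.

Lemma J_germ_vspan (l : nat) : (0 < l)%N -> exists m A,
  rgerm (fun x => J x%:C%C) l%:R m A /\ forall k, vspan (A k).
Proof.
case: l => // l _; exists 0%N; eexists; split; first exact: J_germ.
move=> k; exists [:: ((k`!%:R)^-1, l, k)].
by rewrite big_seq1/= (fmorphV (@ratr R)) rmorph_nat mulrC.
Qed.

(** The first polynomials of [cube_recurrence] may be zero. With j0 the first nonzero index,
    substituting x - j0 for x brings that one to position 0, as the descent requires. *)
Lemma J_recurrence : exists N (P : nat -> {poly R[i]}) (X : R),
  [/\ P 0%N != 0, forall j i, exists q : rat, (P j)`_i = ratr q &
    forall x : R, X < x ->
      \sum_(j < N.+1) (P j).[x%:C%C] * J (x + j%:R)%:C%C = 0].
Proof.
have [B [c [[e1 [j1 c1]] [X hX]]]] := @cube_recurrence R n (cubeW n) (cubeF f).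
pose p (j : nat) : {poly rat} := if insub j is Some j' then
  \poly_(e < B) (if insub e is Some e' then c e' j' else 0) else 0.
have pE (j : 'I_B) : p j = \poly_(e < B) (if insub e is Some e' then c e' j else 0).
  by rewrite /p valK.
have exj : exists j, p j != 0.
  exists j1; apply: contraNneq c1 => /(congr1 (fun q : {poly rat} => q`_e1)).
  by rewrite pE coef_poly ltn_ord valK coef0 => ->.
case: (ex_minnP exj) => j0 pj0 minj.
have horn (q : {poly rat}) (x : R) : (map_poly ratr q : {poly R[i]}).[x%:C%C] =
    ((map_poly ratr q : {poly R}).[x])%:C%C.
  rewrite -(horner_map (real_complex R)) -map_poly_comp; congr (_.[_]).
  by apply: eq_map_poly => z /=; exact: ratr_complex.
(* The bound on x makes x - j0 positive and larger than X. Indices from B on carry the zero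
   polynomial, so the longer sum changes nothing. *)
exists B, (fun j => map_poly ratr (p (j + j0)%N \Po ('X - j0%:R%:P))), (`|X| + j0%:R).
split.
- by rewrite map_poly_eq0 add0n comp_poly2_eq0 ?size_XsubC.
- by move=> j i; exists (p (j + j0)%N \Po ('X - j0%:R%:P))`_i; rewrite coef_map.
- move=> x xX.
  have X0 : 0 <= `|X| by exact: normr_ge0.
  have xj : X < x - j0%:R by rewrite ltrBrDr (le_lt_trans _ xX)// lerD2r ler_norm.
  have xj0 : 0 < x - j0%:R by rewrite subr_gt0 (le_lt_trans _ xX)// lerDr.
  have x0 : 0 < x by apply: lt_le_trans xj0 _; rewrite gerBl.
  have := hX _ xj.
  pose G j := (map_poly ratr (p j) : {poly R}).[x - j0%:R] *
    Lam F (fun=> 0%N) W (x - j0%:R + j%:R).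
  rewrite (eq_bigr (fun j : 'I_B => G j)) => [HG|j _]; last first.
    rewrite /G; congr (_ * _); rewrite pE.
    rewrite (_ : map_poly ratr _ = \poly_(e < B) (ratr (if insub e is Some e' then c e' j else 0) : R)).
      rewrite horner_poly; apply: eq_bigr => e _; by rewrite valK.
    apply/polyP => k; rewrite coef_map !coef_poly /=; case: ifP => _ //; exact: rmorph0.
  have G0 j : (B <= j)%N -> G j = 0.
    move=> Bj; rewrite /G /p insubN ?rmorph0 ?horner0 ?mul0r//.
    by rewrite -leqNgt.
  have G1 j : (j < j0)%N -> G j = 0.
    move=> jj; rewrite /G (_ : p j = 0) ?rmorph0 ?horner0 ?mul0r//.
    apply/eqP; apply: contraTT jj => /minj; by rewrite -leqNgt.
  have : \sum_(j0 <= j < (B.+1 + j0)) G j = 0.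
    have : \sum_(0 <= j < (B.+1 + j0)) G j = 0.
      rewrite (big_cat_nat _ (n := B))//=; last by lia.
      rewrite big_mkord HG add0r big_nat big1// => j /andP[h _]; exact: G0.
    rewrite (big_cat_nat _ (n := j0))//=; last by lia.
    have -> : \sum_(0 <= j < j0) G j = 0.
      by rewrite big_nat big1// => j /andP[_ h]; exact: G1.
    by rewrite add0r.
  rewrite -{1}[j0]add0n big_addn addnK big_mkord => HG'.
  rewrite -[RHS](rmorph0 (real_complex R)) -HG' rmorph_sum/=.
  apply: eq_bigr => j _; rewrite horn rmorphM/=; congr (_ * _).
    congr (_%:C)%C; rewrite map_comp_poly horner_comp; congr (_.[_]).
    by rewrite rmorphB/= map_polyX map_polyC/= rmorph_nat !hornerE.
  rewrite J_Lam; last by rewrite ltr_wpDr.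
  congr (_%:C)%C; congr Lam; rewrite natrD; ring.
Qed.

Lemma J_laurent (hJ : @meromorphic R[i] J) (s0 N : int) (a : int -> R[i]) :
  @laurent_expansion R[i] J s0%:~R N a -> forall i, N <= i -> vspan (a i).
Proof.
move=> ha.
have [N' [P [X [P0 Pq hP]]]] := J_recurrence.
have [m [A [hA VA]]] := laurent_descent hJ vspan_qspace P0 Pq hP J_germ_vspan s0.
exact: (laurent_coef vspan_qspace ha hA VA).
Qed.

End Germs.

(** * Logarithms as integrals *)

Section LogStep.
Variable R : realType.
Local Notation mu := (@lebesgue_measure R).
Local Notation L := (lebesgue R).

(* (v - 1) / (1 + (v - 1) t) where the denominator is positive; written with the
   exponential, it is measurable by composition. *)
Definition lg (t v : R) : R := (v - 1) * expR (- ln (1 + (v - 1) * t)).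

Lemma lg_den (t v : R) : 0 < v -> 0 <= t <= 1 -> 0 < 1 + (v - 1) * t.
Proof.
move=> v0 /andP[t0]; rewrite le_eqVlt => /orP[/eqP->|t1].
  by rewrite mulr1 addrC subrK.
have -> : 1 + (v - 1) * t = (1 - t) + v * t by ring.
by rewrite ltr_pwDl ?subr_gt0// mulr_ge0// ltW.
Qed.

Lemma lgE (t v : R) : 0 < v -> 0 <= t <= 1 -> lg t v = (v - 1) / (1 + (v - 1) * t).
Proof. by move=> v0 t01; rewrite /lg expRN lnK// posrE lg_den. Qed.

Lemma lg_derive (t v : R) : 0 < v -> 0 <= t <= 1 ->
  is_derive t (1 : R) (fun t => ln (1 + (v - 1) * t)) (lg t v).
Proof.
move=> v0 t01; have d0 := lg_den v0 t01.
have h1 := derD (der_cst 1 t) (derZ (v - 1) (is_derive_id1 t)).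
have /is_derive_eq := @der_comp R (@ln R) (fun t => 1 + (v - 1) * t) t _ _ (is_derive1_ln d0) h1.
by apply; rewrite add0r mulr1 lgE// mulrC.
Qed.

Lemma measurable_lg d (T : measurableType d) (t v : T -> R) :
  measurable_fun setT t -> measurable_fun setT v ->
  measurable_fun setT (fun x => lg (t x) (v x)).
Proof.
move=> mt mv; have m1 : measurable_fun setT (fun x => v x - 1) by exact: measurable_funB.
apply: measurable_funM => //; apply: measurableT_comp => //.
apply: measurableT_comp => //; apply: (measurableT_comp (@measurable_ln R)).
by apply: measurable_funD => //; exact: measurable_funM.
Qed.

Lemma int_lg (c v : R) : 0 < v ->
  (\int[mu]_(t in `]0%R, 1%R[) (c * lg t v)%:E = (c * ln v)%:E)%E.
Proof.
move=> v0.
have cln (t : R) : 0 <= t <= 1 -> {for t, continuous (fun t : R => c * ln (1 + (v - 1) * t))}.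
  move=> t01; apply: fderiv_cont.
  by have [] := derZ c (lg_derive v0 t01).
have clg (t : R) : 0 <= t <= 1 -> {for t, continuous (fun t : R => c * lg t v)}.
  move=> t01; apply: continuousM; first exact: cst_continuous.
  apply: continuousM; first exact: cst_continuous.
  apply: (@continuous_comp _ _ _ (fun t : R => - ln (1 + (v - 1) * t)) expR).
    apply: continuousN; apply: fderiv_cont; by have [] := lg_derive v0 t01.
  exact: continuous_expR.
rewrite -(@integral_itv_bndoo R 0 1 _ true false); last first.
  apply/measurable_funTS/measurable_EFinP; apply: measurable_funM => //.
  exact: (@measurable_lg _ (measurableTypeR R) (fun t => t) (fun=> v) (@measurable_id _ _ _) (@measurable_cst _ _ _ _ _ _)).
rewrite (@continuous_FTC2 R _ (fun t : R => c * ln (1 + (v - 1) * t)) 0 1 ltr01).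
- by rewrite mulr0 addr0 ln1 mulr0 (_ : 1 + (v - 1) * 1 = v) ?sube0//; ring.
- apply: continuous_in_subspaceT => t; rewrite inE/= in_itv/=; exact: clg.
- split.
  + move=> t; rewrite in_itv/= => /andP[t0 t1].
    have t01 : 0 <= t <= 1 by rewrite !ltW.
    by have [] := derZ c (lg_derive v0 t01).
  + by apply: cvg_at_right_filter; apply: cln; rewrite lexx ler01.
  + by apply: cvg_at_left_filter; apply: cln; rewrite lexx ler01.
- move=> t; rewrite in_itv/= => /andP[t0 t1].
  have t01 : 0 <= t <= 1 by rewrite !ltW.
  by rewrite derive1E; have [_ ->] := derZ c (lg_derive v0 t01).
Qed.

Definition etl m (x : euclid R m.+1) : euclid R m := [tuple of behead x].

Lemma ecK m (t : R) (y : euclid R m) : etl (ec t y) = y.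
Proof. exact/val_inj. Qed.

Lemma etlK m (x : euclid R m.+1) : ec (tnth x ord0) (etl x) = x.
Proof. by rewrite [RHS]tuple_eta; exact/val_inj. Qed.

Lemma measurable_etl m : measurable_fun setT (@etl m).
Proof. exact: measurable_behead. Qed.

(** The flag tells whether an auxiliary variable t produces a logarithm or merely the factor 1;
    [wval] is the integral over t. *)
Definition wgt (a : bool) (t v : R) : R := if a then lg t v else 1.
Definition wval (a : bool) (v : R) : R := if a then ln v else 1.

Lemma int_wgt a (c v : R) : 0 < v ->
  (\int[mu]_t (\1_`]0%R, 1%R[ t * (c * wgt a t v))%:E = (c * wval a v)%:E)%E.
Proof.
move=> v0; transitivity (\int[mu]_(t in `]0%R, 1%R[) (c * wgt a t v)%:E)%E.
  rewrite [RHS]integral_mkcond; apply: eq_integral => t _.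
  by rewrite patchE indicE; case: ifPn => _; rewrite ?mul1r ?mul0r.
case: a; first exact: int_lg.
rewrite /wgt /wval integral_cst//.
have E : (mu `]0%R, 1%R[%classic = 1)%E.
  by rewrite lebesgue_measure_itv/= lte_fin ltr01 -EFinD subr0.
by rewrite [X in (_ * X)%E]E mule1.
Qed.

(** For fixed v > 0 the integrand of the logarithm keeps the sign of v - 1 on [0, 1]; [c] is this
    sign. Integrals of absolute values can thus be computed exactly. *)
Lemma abs_wgt a (v : R) : 0 < v -> exists c : R, `|c * wval a v| = c * wval a v /\
  `|c * wval a v| = `|wval a v| /\
  forall t, 0 <= t <= 1 -> `|wgt a t v| = c * wgt a t v.
Proof.
move=> v0; case: a; last first.
  by exists 1; rewrite !mul1r /wval /wgt normr1.
have [v1|v1] := leP 1 v.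
  exists 1; rewrite !mul1r /wval /wgt (ger0_norm (ln_ge0 v1)); split=> //; split=> //.
  move=> t t01; rewrite mul1r ger0_norm// mulr_ge0 ?expR_ge0// subr_ge0//.
exists (-1); rewrite !mulN1r /wval /wgt normrN (ler0_norm (ln_le0 (ltW v1))).
split=> //; split=> // t t01.
rewrite mulN1r ler0_norm// nmulr_rle0 ?expR_ge0// subr_lt0//.
Qed.

Lemma int_abs_wgt a (c v : R) : 0 < v ->
  (\int[mu]_t `|(\1_`]0%R, 1%R[ t * (c * wgt a t v))%:E| = `|c * wval a v|%:E)%E.
Proof.
move=> v0; have [s [s1 [s2 hs]]] := abs_wgt a v0.
rewrite normrM -s2 s1 mulrA -int_wgt//; apply: eq_integral => t _.
rewrite indicE; case: (boolP (t \in _)) => ht; last by rewrite !mul0r abse0.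
rewrite !mul1r abse_EFin normrM hs ?mulrA//.
by move: ht; rewrite inE/= in_itv/= => /andP[h1 h2]; rewrite !ltW.
Qed.

Section Step.
Variables (m : nat) (a : bool) (v f : euclid R m -> R).
Hypotheses (mv : measurable_fun setT v) (mf : measurable_fun setT f).
Hypothesis fv : forall y, ~ 0 < v y -> f y = 0.

Definition stepf (x : euclid R m.+1) : R :=
  \1_`]0%R, 1%R[ (tnth x ord0) * (f (etl x) * wgt a (tnth x ord0) (v (etl x))).

Lemma measurable_stepf : measurable_fun setT stepf.
Proof.
have mt : measurable_fun setT (fun x : euclid R m.+1 => tnth x ord0).
  exact: measurable_tnth.
apply: measurable_funM.
  exact: (measurableT_comp (measurable_indic (measurable_itv _)) mt).
apply: measurable_funM; first exact: measurableT_comp mf (@measurable_etl m).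
rewrite /wgt; case: (a) => //.
exact: measurable_lg mt (measurableT_comp mv (@measurable_etl m)).
Qed.

Lemma stepf_ec t y : stepf (ec t y) = \1_`]0%R, 1%R[ t * (f y * wgt a t (v y)).
Proof. by rewrite /stepf tnth_ec0 ecK. Qed.

Hypothesis intf : (L m).-integrable setT (fun y => (f y * wval a (v y))%:E).

(** Tonelli with t innermost: the integral of the absolute value is that of |f| times |[wval]|,
    finite by [intf]. *)
Let pre : (mu \x L m)%E.-integrable setT (fun p => (stepf (ec p.1 p.2))%:E).
Proof.
have ms : measurable_fun setT (fun p : measurableTypeR R * euclid R m => (stepf (ec p.1 p.2))%:E).
  by apply/measurable_EFinP; exact: measurableT_comp measurable_stepf (@measurable_ec R m).
apply/integrableP; split => //.
rewrite (@fubini_tonelli2 _ _ _ _ _ mu (L m) (fun p => `|(stepf (ec p.1 p.2))%:E|%E))//; last first.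
  exact: measurableT_comp.
rewrite /fubini_G /=.
move/integrableP : intf => [_]; apply: le_lt_trans.
rewrite le_eqVlt; apply/orP; left; apply/eqP; apply: eq_integral => y _.
have [v0|v0] := pselect (0 < v y).
  under eq_integral do rewrite stepf_ec.
  exact: (int_abs_wgt a (f y) v0).
rewrite fv// mul0r /= normr0; apply: integral0_eq => t _.
by rewrite stepf_ec fv// mul0r mulr0 /= normr0.
Qed.

Lemma stepf_integrable : (L m.+1).-integrable setT (EFin \o stepf).
Proof.
move/integrableP : pre => [_ h]; apply/integrableP; split.
  apply/measurable_EFinP; exact: measurable_stepf.
apply: le_lt_trans h; rewrite tonelli//; last first.
  by apply: measurableT_comp => //; apply/measurable_EFinP; exact: measurable_stepf.
rewrite fubini_tonelli1//; apply: measurableT_comp => //; apply/measurable_EFinP.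
exact: measurableT_comp measurable_stepf (@measurable_ec R m).
Qed.

Lemma stepf_int : \int[L m.+1]_x stepf x = \int[L m]_y (f y * wval a (v y)).
Proof.
rewrite /Rintegral; congr fine.
have ms : measurable_fun setT (EFin \o stepf) by apply/measurable_EFinP; exact: measurable_stepf.
have := @integral_pushforward _ _ _ _ R _ (@measurable_euclid_cons R m)
  (mu \x L m)%E setT (EFin \o stepf) ms pre measurableT.
rewrite preimage_setT => E.
transitivity (\int[mu \x L m]_p (stepf (ec p.1 p.2))%:E)%E; first exact: E.
rewrite -(integral21_prod_meas1 pre); apply: eq_integral => y _.
rewrite /fubini_G /=.
under eq_integral do rewrite stepf_ec.
have [v0|v0] := pselect (0 < v y); first exact: int_wgt.
by rewrite fv// mul0r; apply: integral0_eq => t _; rewrite mul0r mulr0.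
Qed.

End Step.

End LogStep.

(** * Periods *)

Section Period.
Variable R : realType.
Local Notation L := (lebesgue R).

Definition plift m (p : mpoly m rat) : mpoly m.+1 rat :=
  sub_mpoly [seq mpolyX rat (mnm1 (lift ord0 i)) | i <- enum 'I_m] p.

Lemma plift_ec m (t : R) (y : euclid R m) (p : mpoly m rat) :
  rmeval (tnth (ec t y)) (plift p) = rmeval (tnth y) p.
Proof.
rewrite rmeval_sub -map_comp (_ : [seq _ | i <- enum 'I_m] = y).
  by apply: meval_eq => i; rewrite (tnth_nth 0).
rewrite -[RHS]map_tnth_enum; apply: eq_map => i /=.
by rewrite rmevalX tnth_ecS.
Qed.

Lemma plift_etl m (x : euclid R m.+1) (p : mpoly m rat) :
  rmeval (tnth x) (plift p) = rmeval (tnth (etl x)) p.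
Proof. by rewrite -{1}(etlK x) plift_ec. Qed.

Lemma measurable_rmeval m (p : mpoly m rat) :
  measurable_fun [set: euclid R m] (fun y => rmeval (tnth y) p).
Proof. exact: measurable_meval. Qed.

(** The denominator has no zero on D, so sums and products may be put over a common denominator
    pointwise. *)
Definition ratl m (D : set (euclid R m)) (g : euclid R m -> R) :=
  exists p q : mpoly m rat, forall x, D x ->
    rmeval (tnth x) q != 0 /\ g x = rmeval (tnth x) p / rmeval (tnth x) q.

Lemma ratl_sum m (D : set (euclid R m)) (I : Type) (r : seq I) (c : I -> rat)
    (g : I -> euclid R m -> R) :
  (forall i, ratl D (g i)) -> ratl D (fun x => \sum_(i <- r) ratr (c i) * g i x).
Proof.
move=> hg; elim: r => [|i r [p [q hpq]]].
  exists 0, 1 => x _; rewrite (rmorph1 (rmeval (tnth x))) oner_eq0; split=> //.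
  by rewrite big_nil (rmorph0 (rmeval (tnth x))) mul0r.
have [p' [q' hpq']] := hg i.
exists (mpolyC m (c i) * p' * q + p * q'), (q * q') => x Dx.
have [q0 E] := hpq x Dx; have [q0' E'] := hpq' x Dx.
rewrite (rmorphD (rmeval (tnth x))) !(rmorphM (rmeval (tnth x)))/= rmevalC.
rewrite big_cons E E'; move: q0 q0'.
move: (rmeval _ q) (rmeval _ q') (rmeval _ p) (rmeval _ p') (ratr _) => b b' a a' e.
by move=> b0 b0'; split; [rewrite mulf_neq0|field; rewrite b0 b0'].
Qed.

Lemma stepf_ratl m (D : set (euclid R m)) (a : bool) (P : mpoly m rat) g :
  ratl D g -> (forall y, D y -> 0 < rmeval (tnth y) P) ->
  ratl [set x : euclid R m.+1 | 0 < tnth x ord0 < 1 /\ D (etl x)]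
    (stepf a (fun y => rmeval (tnth y) P) g).
Proof.
move=> [p [q hpq]] P0.
pose X0 : mpoly m.+1 rat := mpolyX rat (mnm1 ord0).
exists (plift p * (if a then plift P - 1 else 1)).
exists (plift q * (if a then 1 + (plift P - 1) * X0 else 1)) => x /= [x01 De].
have [q0 E] := hpq _ De; have := P0 _ De.
rewrite !(rmorphM (rmeval (tnth x)))/= !plift_etl /stepf E.
rewrite indicE mem_set/= ?mul1r; last by rewrite in_itv.
have vE := plift_etl x P; set v := rmeval _ P in vE *; move=> F0.
rewrite /wgt; case: a; last by rewrite (rmorph1 (rmeval (tnth x))) !mulr1.
have t01 : 0 <= tnth x ord0 <= 1 by case/andP: x01 => h1 h2; rewrite !ltW.
have d0 := lg_den F0 t01.
rewrite (rmorphD (rmeval (tnth x))) (rmorphM (rmeval (tnth x))).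
rewrite !(rmorphB (rmeval (tnth x))) (rmorph1 (rmeval (tnth x)))/= rmevalX vE.
rewrite lgE//; move: q0 d0; move: (rmeval _ q) (rmeval _ p) (tnth x ord0) (v) => b c t w.
move=> b0 /lt0r_neq0 d0; split; first by rewrite mulf_neq0. field.
by rewrite b0 d0.
Qed.

Variables (n : nat) (F W : mpoly n rat).
Implicit Type h : euclid R n -> R.

Fixpoint FK K : mpoly (K + n) rat :=
  if K is K'.+1 then plift (FK K') else F.

Definition DK K : set (euclid R (K + n)) :=
  [set x | cube x /\ 0 < rmeval (tnth x) (FK K)].

Lemma DK_etl K (x : euclid R (K.+1 + n)) :
  DK x <-> 0 < tnth x ord0 < 1 /\ @DK K (etl x).
Proof.
rewrite /DK /= (plift_etl (x : euclid R (K + n).+1)).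
rewrite -{1}(etlK (x : euclid R (K + n).+1)) cube_ec.
by split=> [[[h1 h2] h3]|[h1 [h2 h3]]].
Qed.

(* The first K coordinates are auxiliary; k of them carry the integrand of a
   logarithm and the others integrate to 1, so that all k <= K share a domain. *)
Fixpoint TK K (k : nat) (h : euclid R n -> R) : euclid R (K + n) -> R :=
  if K is K'.+1 then
    stepf (0 < k)%N (fun y => rmeval (tnth y) (FK K')) (@TK K' k.-1 h)
  else h.

(** The factor depends on the last n coordinates only and passes through all the auxiliary steps. *)
Lemma TK_mul K k h a (x : euclid R (K + n)) :
  TK k (fun y => h y * wval a (rmeval (tnth y) F)) x =
  TK k h x * wval a (rmeval (tnth x) (FK K)).
Proof.
elim: K k x => [//|K IH] k x /=.
rewrite /stepf IH (plift_etl (x : euclid R (K + n).+1)).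
set e := etl _; set T := TK _ _ _; set w := wval _ _; set g := wgt _ _ _.
by rewrite -!mulrA [w * g]mulrC.
Qed.

Lemma TK_out K k h (x : euclid R (K + n)) :
  (forall y, ~ @DK 0 y -> h y = 0) -> ~ DK x -> TK k h x = 0.
Proof.
move=> h0; elim: K k x => [|K IH] k x Dx; first exact: h0.
rewrite /= /stepf; have [De|De] := pselect (@DK K (etl x)); last first.
  by rewrite IH// mul0r mulr0.
rewrite indicE memNset ?mul0r// => /=; rewrite in_itv/= => x01; apply: Dx.
exact/DK_etl.
Qed.

Lemma measurable_TK K k h : measurable_fun setT h -> measurable_fun setT (@TK K k h).
Proof.
move=> mh; elim: K k => [//|K IH] k /=.
by apply: measurable_stepf; [exact: measurable_rmeval|exact: IH].
Qed.

(** Integrating the outermost variable yields ln F or 1; this factor is moved into h by [TK_mul],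
    and the induction hypothesis is used for the new h with one logarithm fewer. *)
Lemma TK_int K k h : (k <= K)%N -> measurable_fun setT h ->
  (forall y, ~ @DK 0 y -> h y = 0) ->
  (L n).-integrable setT (fun y => (h y * ln (rmeval (tnth y) F) ^+ k)%:E) ->
  (L (K + n)).-integrable setT (EFin \o @TK K k h) /\
  \int[L (K + n)]_x TK k h x = \int[L n]_y (h y * ln (rmeval (tnth y) F) ^+ k).
Proof.
elim: K k h => [|K IH] k h.
  rewrite leqn0 => /eqP-> mh h0 ih; split.
    by apply: eq_integrable ih => // y _; rewrite expr0 mulr1.
  by apply: eq_Rintegral => y _; rewrite expr0 mulr1.
move=> kK mh h0 ih.
pose a := (0 < k)%N.
pose h' y := h y * wval a (rmeval (tnth y) F).
have h'E y : h' y * ln (rmeval (tnth y) F) ^+ k.-1 = h y * ln (rmeval (tnth y) F) ^+ k.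
  rewrite /h' /a /wval; case: (k) => [|k']; first by rewrite ltnn expr0 !mulr1.
  by rewrite ltn0Sn -mulrA -exprS.
have mh' : measurable_fun setT h'.
  apply: measurable_funM => //; rewrite /wval; case: (a) => //.
  exact: measurableT_comp (@measurable_ln R) (measurable_rmeval F).
have h'0 y : ~ @DK 0 y -> h' y = 0 by move=> hy; rewrite /h' h0// mul0r.
have k1K : (k.-1 <= K)%N by case: (k) kK.
have [I1 I2] : (L (K + n)).-integrable setT (EFin \o @TK K k.-1 h') /\
    \int[L (K + n)]_x TK k.-1 h' x = \int[L n]_y (h y * ln (rmeval (tnth y) F) ^+ k).
  have ih' : (L n).-integrable setT (fun y => (h' y * ln (rmeval (tnth y) F) ^+ k.-1)%:E).
    by apply: eq_integrable ih => // y _; rewrite h'E.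
  have [I1 I2] := IH k.-1 h' k1K mh' h'0 ih'; split=> //.
  by rewrite I2; apply: eq_Rintegral => y _; rewrite h'E.
have mT := @measurable_TK K k.-1 h mh.
have mFK := @measurable_rmeval _ (FK K).
have supp (y : euclid R (K + n)) : ~ 0 < rmeval (tnth y) (FK K) -> TK k.-1 h y = 0.
  by move=> hy; apply: TK_out => // -[].
have J : (L (K + n)).-integrable setT
    (fun y => (TK k.-1 h y * wval a (rmeval (tnth y) (FK K)))%:E).
  by apply: eq_integrable I1 => // y _; rewrite /= TK_mul.
split; first exact: (stepf_integrable mFK mT supp J).
rewrite /= (stepf_int mFK mT supp J) -I2; apply: eq_Rintegral => y _.
by rewrite TK_mul.
Qed.

Lemma TK_ratl K k h : ratl (@DK 0) h -> ratl (@DK K) (TK k h).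
Proof.
move=> hh; elim: K k => [//|K IH] k.
have F0 (y : euclid R (K + n)) : DK y -> 0 < rmeval (tnth y) (FK K) by case.
have [p [q hpq]] := stepf_ratl (0 < k)%N (IH k.-1) F0.
by exists p, q => x /DK_etl[x01 De]; exact: hpq.
Qed.

End Period.

(** * Rational combinations of Taylor coefficients are periods *)

Section VspanPeriod.
Variable R : realType.
Local Notation L := (lebesgue R).

Lemma ratr_Ralg (q : rat) : (ratr q : R) \in @Ralg R.
Proof.
apply/asboolP; exists ('X - q%:P); first by rewrite polyXsubC_eq0.
by rewrite map_polyXsubC root_XsubC.
Qed.

Lemma map_mpoly_Ralg m (p : mpoly m rat) : map_mpoly ratr p \is a mpolyOver m (@Ralg R).
Proof.
rewrite qualifE /=; apply/allP => _ /mapP[k _ ->].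
by rewrite mcoeff_map_mpoly; exact: ratr_Ralg.
Qed.

Lemma map_mpoly_ratr_neq0 m (p : mpoly m rat) : p != 0 -> map_mpoly (@ratr R) p != 0.
Proof.
apply: contraNneq => p0; apply/eqP/mpolyP => k.
have := congr1 (fun q : mpoly m R => mcoeff k q) p0.
rewrite mcoeff_map_mpoly !mcoeff0 => /eqP; rewrite fmorph_eq0 => /eqP.
by [].
Qed.

Lemma semi_arithmetic_basic_pos m (p : mpoly m rat) :
  semi_arithmetic_basic [set x : euclid R m | 0 < rmeval (tnth x) p].
Proof. by exists (map_mpoly ratr p); [exact: map_mpoly_Ralg|left]. Qed.

Lemma semi_arithmetic_pos m (s : seq (mpoly m rat)) :
  semi_arithmetic [set x : euclid R m | forall p, p \in s -> 0 < rmeval (tnth x) p].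
Proof.
exists [:: [seq [set x : euclid R m | 0 < rmeval (tnth x) p] | p <- s]].
  move=> t; rewrite inE => /eqP -> A /mapP[p _ ->]; exact: semi_arithmetic_basic_pos.
rewrite big_seq1 big_map; elim: s => [|p s IH].
  by rewrite big_nil; apply/seteqP; split.
rewrite big_cons -IH; apply/seteqP; split => x /=.
  by move=> h; split=> [|q qs]; apply: h; rewrite inE ?eqxx ?qs ?orbT.
by move=> [h1 h2] q; rewrite inE => /orP[/eqP->//|]; exact: h2.
Qed.

Lemma ratl_real_period m (D : set (euclid R m)) (g : euclid R m -> R) :
  semi_arithmetic D -> measurable D -> ratl D g -> (forall x, ~ D x -> g x = 0) ->
  (L m).-integrable setT (EFin \o g) -> real_period (\int[L m]_x g x).
Proof.
move=> sD mD [p [q hpq]] g0 ig.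
have [p' [q' [q0 h]]] : exists p q : mpoly m rat, q != 0 /\
    forall x, D x -> g x = rmeval (tnth x) p / rmeval (tnth x) q.
  (* A zero denominator forces D to be empty, and 0 / 1 serves as well. *)
  have [q0|q0] := eqVneq q 0.
    exists 0, 1; rewrite oner_eq0; split=> // x /hpq[].
    by rewrite q0 (rmorph0 (rmeval (tnth x))) eqxx.
  by exists p, q; split=> // x /hpq[].
exists m, D, (map_mpoly ratr p'), (map_mpoly ratr q') => /=.
have gE : g = g \_ D.
  apply/funext => x; rewrite patchE; case: ifPn => // /negP hx.
  by apply: g0 => Dx; apply: hx; rewrite inE.
have iD : (L m).-integrable D (EFin \o g) by exact: integrableS ig.
split.
- exact: sD.
- exact: map_mpoly_Ralg.
- split; [exact: map_mpoly_Ralg|exact: map_mpoly_ratr_neq0].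
- by apply: eq_integrable iD => // x; rewrite inE => Dx; rewrite /= h.
- rewrite /Rintegral; congr fine.
  transitivity (\int[L m]_(x in D) (g x)%:E)%E.
    rewrite [RHS]integral_mkcond; apply: eq_integral => x _.
    by rewrite {1}gE !patchE; case: ifP.
  by apply: eq_integral => x; rewrite inE => Dx; rewrite /= h.
Qed.

Lemma real_period0 : real_period (0 : R).
Proof.
have := @ratl_real_period 0 set0 (fun=> 0); rewrite /Rintegral integral0; apply => //.
- exists [::] => //; by rewrite big_nil.
- by exists 0, 1.
- exact: integrable0.
Qed.

Variables (n : nat) (F W : mpoly n rat).

Definition DK_polys K : seq (mpoly (K + n) rat) :=
  FK F K :: [seq mpolyX rat (mnm1 i) | i <- enum 'I_(K + n)] ++
  [seq 1 - mpolyX rat (mnm1 i) | i <- enum 'I_(K + n)].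

Lemma DK_semi_arithmetic K : semi_arithmetic (@DK R n F K).
Proof.
have := semi_arithmetic_pos (DK_polys K); congr semi_arithmetic.
apply/seteqP; split => x /=.
  move=> h; split; last by apply: h; rewrite inE eqxx.
  move=> i; apply/andP; split.
    rewrite -(rmevalX (tnth x)); apply: h; rewrite inE mem_cat; apply/orP; right.
    by apply/orP; left; apply/mapP; exists i; rewrite ?mem_enum.
  rewrite -subr_gt0 -(rmevalX (tnth x)) -(rmorph1 (rmeval (tnth x))).
  rewrite -(rmorphB (rmeval (tnth x))).
  apply: h; rewrite inE mem_cat; apply/orP; right.
  by apply/orP; right; apply/mapP; exists i; rewrite ?mem_enum.
move=> [cx Fx] p; rewrite inE mem_cat => /orP[/eqP->//|/orP[]/mapP[i _ ->]].
  by rewrite rmevalX; case/andP: (cx i).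
rewrite (rmorphB (rmeval (tnth x))) (rmorph1 (rmeval (tnth x)))/= rmevalX subr_gt0.
by case/andP: (cx i).
Qed.

Lemma measurable_DK K : measurable (@DK R n F K).
Proof.
apply: measurableI; first exact: measurable_cube.
have := @measurable_rmeval R _ (FK F K) measurableT `]0, +oo[%classic (measurable_itv _).
rewrite setTI; congr (measurable _); apply/seteqP.
by split => x /=; rewrite in_itv/= andbT.
Qed.

Definition hl (l : nat) (u : euclid R n) : R := KAP (fun=> 0%N) u *
  (rmeval (tnth u) W * psi l%:R (rmeval (tnth u) F)).

(** Where F > 0 the truncated power is F^l, and on the cube the weight without logarithms is a
    polynomial. *)
Lemma hl_ratl l : ratl (@DK R n F 0) (hl l).
Proof.
exists ((\prod_i (mpolyX rat (mnm1 i) * (1 - mpolyX rat (mnm1 i))) ^+ 2) * (W * F ^+ l)), 1.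
move=> u [cu Fu]; rewrite (rmorph1 (rmeval (tnth u))) oner_eq0; split=> //.
rewrite divr1 /hl (rmorphM (rmeval (tnth u))) (rmorphM (rmeval (tnth u)) W).
rewrite (rmorphXn (rmeval (tnth u))) (rmorph_prod (rmeval (tnth u)))/=.
congr (_ * (_ * _)).
  apply: eq_bigr => i _; rewrite (rmorphXn (rmeval (tnth u))) (rmorphM (rmeval (tnth u))).
  rewrite (rmorphB (rmeval (tnth u))) (rmorph1 (rmeval (tnth u)))/= rmevalX.
  by rewrite /kap cu expr0 fact0 divr1 mulr1.
by rewrite -[l%:R]add0r psiDn /psi Fu mul0r expR0 mulr1.
Qed.

Lemma hl_out l u : ~ DK F (K := 0) u -> hl l u = 0.
Proof.
move=> Du; rewrite /hl; have [cu|cu] := pselect (cube u); last by rewrite KAP_out// mul0r.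
rewrite /psi; case: ifP => Fu; last by rewrite !mulr0.
by case: Du.
Qed.

Lemma hl_vint l k u : hl l u * ln (rmeval (tnth u) F) ^+ k =
  vint (map_mpoly ratr W) (map_mpoly ratr F) l k u.
Proof. by rewrite /hl /vint -!mulrA. Qed.

(** All exponents k <= K are realised in the same dimension K + n and on the same domain, so the
    combination is a single integral of a rational function. *)
Lemma vcoef_period (s : seq (rat * nat * nat)) : real_period
  (\sum_(x <- s) ratr x.1.1 *
    vcoef (map_mpoly ratr W) (map_mpoly ratr F) x.1.2.+1 x.2 : R).
Proof.
pose K := (\max_(x <- s) x.2)%N.
(* The minimum keeps the exponent within K for every triple and changes nothing for the triples of
   [s]. *)
pose g (x : rat * nat * nat) := @TK R n F K (minn x.2 K) (hl x.1.2.+1).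
have mhl l : measurable_fun setT (hl l.+1).
  apply: measurable_funM; first exact: measurable_KAP.
  apply: measurable_funM; first exact: measurable_rmeval.
  have l0 : 0 < l.+1%:R :> R by rewrite ltr0n.
  exact: measurableT_comp (measurable_psi l0) (@measurable_rmeval R n F).
have gI (x : rat * nat * nat) : (L (K + n)).-integrable setT (EFin \o g x) /\
    \int[L (K + n)]_y g x y =
    vcoef (map_mpoly ratr W) (map_mpoly ratr F) x.1.2.+1 (minn x.2 K).
  have [||||I1 I2] := @TK_int R n F K (minn x.2 K) (hl x.1.2.+1).
  - exact: geq_minr.
  - exact: mhl.
  - by move=> y; exact: hl_out.
  - have H := bcs_integrable (vint_bcs (map_mpoly ratr W) (map_mpoly ratr F) (minn x.2 K) (ltn0Sn x.1.2)).
    rewrite (_ : (fun y => _) = EFin \o vint (map_mpoly ratr W) (map_mpoly ratr F) x.1.2.+1 (minn x.2 K)).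
      exact: H.
    by apply/funext => y; rewrite hl_vint.
  split=> //; rewrite /g I2; apply: eq_Rintegral => y _; exact: hl_vint.
have -> : \sum_(x <- s) ratr x.1.1 * vcoef (map_mpoly ratr W) (map_mpoly ratr F) x.1.2.+1 x.2 =
    \sum_(x <- s) ratr x.1.1 * \int[L (K + n)]_y g x y.
  apply: eq_big_seq => x xs; rewrite (gI x).2; congr (_ * vcoef _ _ _ _).
  by apply/esym/minn_idPl; exact: (leq_bigmax_seq x xs).
have [iS ->] : (L (K + n)).-integrable setT
    (EFin \o (fun y => \sum_(x <- s) ratr x.1.1 * g x y)) /\
    \sum_(x <- s) ratr x.1.1 * \int[L (K + n)]_y g x y =
    \int[L (K + n)]_y \sum_(x <- s) ratr x.1.1 * g x y.
  have [h1 h2] := integrable_lin s (fun x => ratr x.1.1) (fun x => (gI x).1).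
  by rewrite h2.
apply: (@ratl_real_period _ (@DK R n F K)).
- exact: DK_semi_arithmetic.
- exact: measurable_DK.
- by apply: ratl_sum => x; apply: TK_ratl; exact: hl_ratl.
- move=> y Dy; rewrite big1// => x _; rewrite /g TK_out ?mulr0// => u; exact: hl_out.
- exact: iS.
Qed.

End VspanPeriod.

Lemma vspan_period (R : realType) n (f : mpoly n.+1 rat) (z : R[i]) :
  vspan f z -> period z.
Proof. by move=> [s ->]; split; [exact: vcoef_period|exact: real_period0]. Qed.

Theorem theorem0p2 (R : realType) (n : nat) (hn : (1 <= n)%N)
    (f : mpoly n.+1 rat)
    (hf : forall x : euclid R n.+1, simplex x ->
      0 <= meval (tnth x) (map_mpoly ratr f))
    (J : R[i] -> R[i])
    (hJ : @meromorphic R[i] J)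
    (hJI : forall s : R[i], 0 < complex.Re s -> J s = simplex_zeta f s)
    (s0 : int) (N : int) (a : int -> R[i])
    (ha : @laurent_expansion R[i] J s0%:~R N a) :
  forall i : int, N <= i -> period (a i).
Proof.
by move=> i Ni; exact: vspan_period (J_laurent hf hJI hJ ha Ni).
Qed.
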